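(* Let $\ket\Psi=\ket{\Psi_N}$ be pure states of local lattice systems with Hamiltonians $H=H_N$ on $N\ge2$ sites (setting in the context) satisfying assumption (SR). Then there is a constant $K'\ge0$, independent of $N$ (and of $T$), such that for all $T>0$ $$\int_0^T\frac{dt}{T}\,|F(t)|^2\le\frac{5\pi}{2\sigma T}+K'\frac{\log^{2D}(N)}{\sqrt N}.$$
   Context: Setting. $\Lambda$ is a regular $D$-dimensional lattice of $N$ sites, each carrying a $d$-dimensional Hilbert space. $H=\sum_{x\in\Lambda}h_x$ is a local Hamiltonian: each $h_x$ is supported on at most $b$ neighbouring sites and $\|h_x\|\le h$; $d,D,b,h$ do not depend on $N$. $\hbar=1$; log is the natural logarithm. $F(t)=|\bra\Psi e^{-itH}\ket\Psi|$. Assumption (SR). The pure state $\ket\Psi$ has exponentially decaying correlations with finite correlation length (there are constants $C,\xi>0$ independent of $N$ with $|\langle AB\rangle-\langle A\rangle\langle B\rangle|\le C\|A\|\|B\|e^{-\mathrm{dist}(A,B)/\xi}$ for observables $A,B$ supported on regions at distance $\mathrm{dist}(A,B)$), and $\sigma:=\sqrt{\langle H^2\rangle-\langle H\rangle^2}=s\sqrt N$ for a constant $s>0$ independent of $N$. *)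

(* Defs.v *)
From HB Require Import structures.
From mathcomp Require Import all_boot all_order all_algebra complex.
From mathcomp Require Import all_classical all_reals all_analysis.
Set Implicit Arguments.
Unset Strict Implicit.
Unset Printing Implicit Defensive.
Import Order.TTheory GRing.Theory Num.Theory.
Import numFieldNormedType.Exports.
Local Open Scope ring_scope.
Local Open Scope sesquilinear_scope.

(* The translation-invariant pattern of a D-dimensional regular lattice:
   nbasis sites per unit cell of Z^D, and finitely many bonds (i, j, e), each
   joining, for every cell u, basis site i of u to basis site j of u + e.  The
   hypercubic lattice has nbasis = 1 and the D unit vectors as bonds. *)
Record lattice_type (D : nat) := LatticeType {
  nbasis : nat;
  bonds : seq ('I_nbasis * 'I_nbasis * {ffun 'I_D -> int}) }.

(* A finite box of side k cells in direction k, with periodic or open boundary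
   conditions chosen separately in each direction. *)
Record lattice (D : nat) (U : lattice_type D) := Lattice {
  side : 'I_D -> nat;
  periodic : 'I_D -> bool }.

Section Lattice.
Variables (D : nat) (U : lattice_type D) (L : lattice U).

Definition site : finType :=
  ({dffun forall k : 'I_D, 'I_(side L k)} * 'I_(nbasis U))%type.

Definition bonded (p q : site) : bool :=
  has (fun be : 'I_(nbasis U) * 'I_(nbasis U) * {ffun 'I_D -> int} =>
    [&& p.2 == be.1.1, q.2 == be.1.2 &
      [forall k : 'I_D,
        if periodic L k
        then ((q.1 k)%:Z == (p.1 k)%:Z + be.2 k %[mod (side L k)%:Z])%Z
        else (q.1 k)%:Z == (p.1 k)%:Z + be.2 k]]) (bonds U).

Definition adj : rel site :=
  [rel p q | (p != q) && (bonded p q || bonded q p)].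

Definition connected_lattice : Prop := forall p q : site, connect adj p q.

Definition connected_region (X : {set site}) : Prop :=
  forall p q, p \in X -> q \in X ->
    connect [rel u v | [&& u \in X, v \in X & adj u v]] p q.

(* Graph distance; the value for disconnected sites is #|site|, which exceeds
   every actual distance. *)
Definition site_dist (p q : site) : nat :=
  find (fun n => [exists w : n.-tuple site, path adj p w && (last p w == q)])
       (iota 0 #|site|).

Definition region_dist (X Y : {set site}) : nat :=
  \big[minn/#|site|]_(p in X) \big[minn/#|site|]_(q in Y) site_dist p q.

End Lattice.

(* The Hilbert space of a finite set T of d-level sites, in the product basis
   labelled by the configurations T -> 'I_d. *)
Definition config (d : nat) (T : finType) : finType := {ffun T -> 'I_d}.

Definition state (R : realType) (d : nat) (T : finType) : Type :=
  'cV[R[i]]_#|config d T|.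

Definition op (R : realType) (d : nat) (T : finType) : Type :=
  'M[R[i]]_#|config d T|.

(* The library norm of a matrix is the maximum of its entries, so the Hilbert
   space norm and the operator norm are defined here. *)
Definition l2norm (R : realType) (n : nat) (v : 'cV[R[i]]_n) : R :=
  Num.sqrt (\sum_i Normc.normc (v i ord0) ^+ 2).

Definition opnorm (R : realType) (n : nat) (A : 'M[R[i]]_n) : R :=
  sup [set l2norm (A *m v) | v in [set v : 'cV[R[i]]_n | l2norm v = 1]]%classic.

Section Operators.
Variables (R : realType) (d : nat) (T : finType).

Definition restr (X : {set T}) (s : config d T) : config d {x : T | x \in X} :=
  [ffun x => s (val x)].

(* The operator a (x) 1 acting as a on the sites of X and trivially elsewhere. *)
Definition extend (X : {set T}) (a : op R d {x : T | x \in X}) : op R d T :=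
  \matrix_(i, j)
    let s : config d T := enum_val i in
    let t : config d T := enum_val j in
    if [forall x, (x \notin X) ==> (s x == t x)]
    then a (enum_rank (restr X s)) (enum_rank (restr X t)) else 0.

Definition supported_on (X : {set T}) (A : op R d T) : Prop :=
  exists a : op R d {x : T | x \in X}, A = extend a.

Definition expect (psi : state R d T) (A : op R d T) : R[i] :=
  (psi ^t* *m A *m psi) ord0 ord0.

Definition energy_std (H : op R d T) (psi : state R d T) : R :=
  Num.sqrt (complex.Re (expect psi (H *m H) - expect psi H ^+ 2)).

End Operators.

Definition mexp (K : numFieldType) (n : nat) (A : 'M[K]_n) : 'M[K]_n :=
  limn (series (fun k : nat => (k`!%:R)^-1 *: A ^+ k)).

Definition evolution (R : realType) (n : nat) (H : 'M[R[i]]_n) (t : R) :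
    'M[R[i]]_n :=
  mexp ((0 -i* t)%C *: H).

Definition fidelity (R : realType) (d : nat) (T : finType)
    (H : op R d T) (psi : state R d T) (t : R) : R :=
  Normc.normc (expect psi (evolution H t)).

Record lattice_system (R : realType) (d D : nat) (U : lattice_type D) :=
  LatticeSystem {
    lat : lattice U;
    local_term : site lat -> op R d (site lat);
    psi : state R d (site lat) }.

Section System.
Variables (R : realType) (d D : nat) (U : lattice_type D).
Variable S : lattice_system R d U.

Definition nsites : nat := #|site (lat S)|.

Definition hamiltonian : op R d (site (lat S)) :=
  \sum_(x : site (lat S)) local_term x.

(* Acting on at most b neighbouring sites is read as: supported on a connected
   cluster of at most b sites that contains the site x labelling the term. *)
Definition local_hamiltonian (b : nat) (h : R) : Prop :=
  forall x : site (lat S),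
    [/\ (local_term x : 'M[R[i]]__) \is hermsymmx,
        opnorm (local_term x) <= h &
        exists X : {set site (lat S)},
          [/\ x \in X, (#|X| <= b)%N, connected_region X &
              supported_on X (local_term x)]].

Definition decaying_correlations (C xi : R) : Prop :=
  forall (X Y : {set site (lat S)}) (A B : op R d (site (lat S))),
    (A : 'M[R[i]]__) \is hermsymmx -> (B : 'M[R[i]]__) \is hermsymmx ->
    supported_on X A -> supported_on Y B ->
    Normc.normc (expect (psi S) (A *m B)
                 - expect (psi S) A * expect (psi S) B)
      <= C * opnorm A * opnorm B * expR (- ((region_dist X Y)%:R / xi)).

End System.

(* Main.v *)
(* Let f_S(t) be the expectation of exp(-i t H_S), where H_S sums the centred
   terms of the sites of S.  For t <= T0 = const / log^(2D) N the Dyson series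
   comparing H_S with H_S stripped of a ball of radius O(log N) converges
   geometrically, and its terms are local.  Expanding f_S' = -i sum_x <k_x
   exp(-i t H_S)> around each site x and using the decay of correlations gives
   f_S' = - sigma^2 t f_S + error, where the error is a small multiple of
   sigma^2 t times a bound on |f_Q| for the regions Q obtained from S by
   removing one further ball of radius O(log^2 N), up to O(1/N).  Gronwall turns
   this into |f_S(t)| <= (8/7) exp(- sigma^2 t^2 / 4) + eta, where eta halves
   each time one more ball may be removed; O(log N) rounds give eta = O(1/N).
   The Gaussian bound settles T <= T0.  For T > T0, |F|^2 is a positive definite
   function of time, so its integral over any window of length T0 is at most
   four times its integral over [0, T0]. *)
Require Import Defs.
From HB Require Import structures.
From mathcomp Require Import all_boot all_order all_algebra complex.
From mathcomp Require Import all_classical all_reals all_analysis.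
From mathcomp Require Import zify ring lra.
Set Implicit Arguments.
Unset Strict Implicit.
Unset Printing Implicit Defensive.
Import Order.TTheory GRing.Theory Num.Theory.
Import numFieldNormedType.Exports.
Local Open Scope ring_scope.
Local Open Scope sesquilinear_scope.
Local Notation normc := Normc.normc.

(** * Norms on a finite-dimensional Hilbert space *)

(** The exponent [2 * D] has one source, the time [T0]: past it the average is of order 1 / (sigma
    T0). Two requirements force the same power. The expansion at a site uses balls of volume O(log^D
    N), and its second-order remainder, summed over all sites, is small against sigma^2 t only if t
    (log^D N)^2 is bounded. Bounding that remainder by |f_Q| takes O(log N) further shells, hence
    balls of volume O(log^(2D) N), and the Dyson series over such a volume converges only if t
    log^(2D) N is bounded. The obstacle is that the equation for f_S does not close: its error
    involves stripped regions, so the bound is proved for all regions at once, with a budget of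
    removed sites that shrinks from round to round. An absolute bound on the error is not enough, as
    sigma^2 t is of order N t; its main part must carry a factor bounding some |f_Q|. The removed
    sites also shift the variance, essentially by O(log^(3D+1) N), which sigma^2 absorbs for large
    N; for the other N the average is at most 1 and K' covers it. *)

Section ComplexModulus.
Variable R : realType.
Implicit Types (z w : R[i]) (r : R).

Lemma normc_ge0 z : 0 <= normc z.
Proof. by case: z => a b; exact: sqrtr_ge0. Qed.

Lemma normcD z w : normc (z + w) <= normc z + normc w.
Proof. exact: (@le_normcD R z w). Qed.

Lemma normc_opp z : normc (- z) = normc z.
Proof. exact: (@normcN R z). Qed.

Lemma normc_sqr z : normc z ^+ 2 = complex.Re z ^+ 2 + complex.Im z ^+ 2.
Proof. by case: z => a b /=; rewrite sqr_sqrtr// addr_ge0// sqr_ge0. Qed.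

Lemma normc_conj z : normc (z^*)%C = normc z.
Proof. by case: z => a b /=; rewrite sqrrN. Qed.

Lemma normc_real r : normc r%:C%C = `|r|.
Proof. by rewrite /= expr0n/= addr0 sqrtr_sqr. Qed.

Lemma normc_sum (I : Type) (s : seq I) (P : pred I) (F : I -> R[i]) :
  normc (\sum_(i <- s | P i) F i) <= \sum_(i <- s | P i) normc (F i).
Proof.
elim/big_rec2: _ => [|i x y _ IH]; first by rewrite Normc.normc0.
by rewrite (le_trans (normcD _ _))// lerD2l.
Qed.

Lemma Re_le_normc z : `|complex.Re z| <= normc z.
Proof.
rewrite -[leLHS]sqrtr_sqr; case: z => a b /=.
by rewrite ler_wsqrtr// lerDl sqr_ge0.
Qed.

Lemma mulcconj z : z * (z^*)%C = (normc z ^+ 2)%:C%C.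
Proof.
rewrite normc_sqr; case: z => a b; apply/eqP; rewrite eq_complex /=.
by apply/andP; split; apply/eqP; ring.
Qed.

(** Taking [w] to be the conjugate phase of [z] makes [w * z] equal to |z|. Estimates on a modulus
    thus become estimates on real parts, where the mean value theorem applies. *)
Lemma normc_le_of_rotations z r :
  (forall w, normc w = 1 -> complex.Re (w * z) <= r) -> normc z <= r.
Proof.
move=> h; have [z0|z0] := eqVneq z 0.
  rewrite z0 Normc.normc0; have := h 1 (@Normc.normc1 R).
  by rewrite mul1r z0 /=.
have nz : normc z != 0 by apply: contra_neq z0; exact: Normc.eq0_normc.
have := h ((z^*)%C / (normc z)%:C%C).
rewrite Normc.normcM normc_conj Normc.normcV normc_real (ger0_norm (normc_ge0 _)).
move/(_ (divff nz)); rewrite mulrAC [_ * z]mulrC mulcconj -fmorphV -rmorphM /=.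
by rewrite expr2 mulfK.
Qed.

End ComplexModulus.

Lemma adjM (R : realType) m n p (A : 'M[R[i]]_(m, n)) (B : 'M[R[i]]_(n, p)) :
  (A *m B)^t* = B^t* *m A^t*.
Proof. by rewrite trmx_mul map_mxM. Qed.

Section HilbertSpace.
Variables (R : realType) (n : nat).
Local Notation C := R[i].
Implicit Types (u v psi : 'cV[C]_n) (A B : 'M[C]_n) (z : C) (a b : R).

Lemma sum_mul_le_sqrt (x y : 'I_n -> R) :
  \sum_i x i * y i <= Num.sqrt (\sum_i x i ^+ 2) * Num.sqrt (\sum_i y i ^+ 2).
Proof.
set X := \sum_i x i ^+ 2; set Y := \sum_i y i ^+ 2.
have X0 : 0 <= X by apply: sumr_ge0 => i _; exact: sqr_ge0.
have Y0 : 0 <= Y by apply: sumr_ge0 => i _; exact: sqr_ge0.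
have [sX|sX] := eqVneq X 0.
  rewrite sX sqrtr0 mul0r big1// => i _.
  have /eqP := sX; rewrite psumr_eq0; last by move=> j _; exact: sqr_ge0.
  by move=> /allP/(_ i (mem_index_enum _))/=; rewrite sqrf_eq0 => /eqP ->; rewrite mul0r.
have [sY|sY] := eqVneq Y 0.
  rewrite sY sqrtr0 mulr0 big1// => i _.
  have /eqP := sY; rewrite psumr_eq0; last by move=> j _; exact: sqr_ge0.
  by move=> /allP/(_ i (mem_index_enum _))/=; rewrite sqrf_eq0 => /eqP ->; rewrite mulr0.
set p := Num.sqrt X; set q := Num.sqrt Y.
have p0 : 0 < p by rewrite sqrtr_gt0 lt_def sX.
have q0 : 0 < q by rewrite sqrtr_gt0 lt_def sY.
have : 0 <= \sum_i (q * x i - p * y i) ^+ 2 by apply: sumr_ge0 => i _; exact: sqr_ge0.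
have -> : \sum_i (q * x i - p * y i) ^+ 2 =
    q ^+ 2 * X + p ^+ 2 * Y - 2 * p * q * \sum_i x i * y i.
  rewrite !mulr_sumr -big_split -sumrB /=; apply: eq_bigr => i _; ring.
have eX : X = p ^+ 2 by rewrite sqr_sqrtr.
have eY : Y = q ^+ 2 by rewrite sqr_sqrtr.
rewrite eX eY; move: (\sum_i x i * y i) => S H.
rewrite -(ler_pM2l (mulr_gt0 (mulr_gt0 (ltr0n _ 2) p0) q0)) -subr_ge0.
by apply: le_trans H _; rewrite le_eqVlt; apply/orP; left; apply/eqP; ring.
Qed.

Definition dot u v : C := (u^t* *m v) ord0 ord0.

Lemma dotE u v : dot u v = \sum_i (u i ord0)^*%C * v i ord0.
Proof. by rewrite /dot !mxE; apply: eq_bigr => i _; rewrite !mxE. Qed.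

Lemma l2norm_ge0 v : 0 <= l2norm v.
Proof. exact: sqrtr_ge0. Qed.

Lemma sqr_l2norm v : l2norm v ^+ 2 = \sum_i normc (v i ord0) ^+ 2.
Proof. by rewrite sqr_sqrtr// sumr_ge0// => i _; rewrite sqr_ge0. Qed.

Lemma dotvv v : dot v v = (l2norm v ^+ 2)%:C%C.
Proof.
rewrite sqr_l2norm dotE rmorph_sum /=; apply: eq_bigr => i _.
by rewrite mulrC mulcconj.
Qed.

Lemma normc_dot_le u v : normc (dot u v) <= l2norm u * l2norm v.
Proof.
rewrite dotE (le_trans (normc_sum _ _ _))// /l2norm.
rewrite (le_trans _ (sum_mul_le_sqrt _ _))// le_eqVlt; apply/orP; left; apply/eqP.
by apply: eq_bigr => i _; rewrite Normc.normcM normc_conj.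
Qed.

Lemma dotC u v : dot v u = (dot u v)^*%C.
Proof.
rewrite !dotE rmorph_sum; apply: eq_bigr => i _ /=.
by rewrite rmorphM /= conjcK mulrC.
Qed.

Lemma l2normD u v : l2norm (u + v) <= l2norm u + l2norm v.
Proof.
rewrite -(@ler_pXn2r _ 2)// ?nnegrE ?l2norm_ge0// ?addr_ge0 ?l2norm_ge0//.
have -> : l2norm (u + v) ^+ 2 =
    l2norm u ^+ 2 + l2norm v ^+ 2 + (complex.Re (dot u v)) *+ 2.
  rewrite !sqr_l2norm dotE !raddf_sum /= -!sumrMnl -!big_split /=.
  apply: eq_bigr => i _; rewrite !normc_sqr !mxE.
  by case: (u i 0) => a b; case: (v i 0) => c d /=; ring.
have := le_trans (Re_le_normc _) (normc_dot_le u v).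
move/(le_trans (ler_norm _)) => h.
by rewrite sqrrD -addrA [in leRHS]addrAC -addrA lerD2l lerD2l lerMn2r h orbT.
Qed.

Lemma l2normZ z v : l2norm (z *: v) = normc z * l2norm v.
Proof.
apply/eqP; rewrite -(@eqrXn2 _ 2)// ?mulr_ge0 ?l2norm_ge0 ?normc_ge0//.
rewrite exprMn !sqr_l2norm mulr_sumr; apply/eqP/eq_bigr => i _.
by rewrite mxE Normc.normcM exprMn.
Qed.

Lemma l2norm0 : l2norm (0 : 'cV[C]_n) = 0.
Proof.
by rewrite /l2norm big1 ?sqrtr0// => i _; rewrite mxE Normc.normc0 expr0n.
Qed.

Lemma l2norm_eq0 v : l2norm v = 0 -> v = 0.
Proof.
move=> v0; have := sqr_l2norm v; rewrite v0 expr0n /= => /esym/eqP.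
rewrite psumr_eq0; last by move=> j _; exact: sqr_ge0.
move=> /allP h; apply/colP => i; rewrite mxE; apply: Normc.eq0_normc.
by apply/eqP; rewrite -sqrf_eq0; exact: (h i (mem_index_enum _)).
Qed.

Lemma dot_adj A u v : dot (A^t* *m u) v = dot u (A *m v).
Proof.
rewrite /dot; congr (_ _ _); rewrite mulmxA; congr (_ *m _).
by rewrite adjM trmxCK.
Qed.

(** An upper bound on the operator norm, kept relational so that it passes through sums, products
    and adjoints without handling a supremum. In dimension zero the inequality does not force
    [0 <= a], hence the first conjunct. *)
Definition bnd A a := 0 <= a /\ forall v, l2norm (A *m v) <= a * l2norm v.

Lemma bnd_ge0 A a : bnd A a -> 0 <= a.
Proof. by case. Qed.

Lemma bnd_le A a b : a <= b -> bnd A a -> bnd A b.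
Proof.
move=> ab [a0 h]; split=> [|v]; first exact: le_trans ab.
by rewrite (le_trans (h v))// ler_wpM2r// l2norm_ge0.
Qed.

Lemma bnd1 : bnd 1%:M 1.
Proof. by split=> // v; rewrite mul1mx mul1r. Qed.

Lemma bnd0 : bnd 0 0.
Proof. by split=> // v; rewrite mul0mx l2norm0 mul0r. Qed.

Lemma bndD A B a b : bnd A a -> bnd B b -> bnd (A + B) (a + b).
Proof.
move=> [a0 hA] [b0 hB]; split=> [|v]; first exact: addr_ge0.
by rewrite mulmxDl mulrDl (le_trans (l2normD _ _))// lerD.
Qed.

Lemma bndZ A a z : bnd A a -> bnd (z *: A) (normc z * a).
Proof.
move=> [a0 hA]; split=> [|v]; first by rewrite mulr_ge0 ?normc_ge0.
by rewrite -scalemxAl l2normZ -mulrA ler_wpM2l ?normc_ge0.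
Qed.

Lemma bndN A a : bnd A a -> bnd (- A) a.
Proof. by move=> /(bndZ (-1)); rewrite scaleN1r normc_opp Normc.normc1 mul1r. Qed.

Lemma bndB A B a b : bnd A a -> bnd B b -> bnd (A - B) (a + b).
Proof. by move=> hA hB; apply: bndD => //; exact: bndN. Qed.

Lemma bndM A B a b : bnd A a -> bnd B b -> bnd (A *m B) (a * b).
Proof.
move=> [a0 hA] [b0 hB]; split=> [|v]; first exact: mulr_ge0.
by rewrite -mulmxA (le_trans (hA _))// -mulrA ler_wpM2l.
Qed.

Lemma bnd_sum (I : Type) (s : seq I) (P : pred I) (F : I -> 'M[C]_n) (f : I -> R) :
  (forall i, P i -> bnd (F i) (f i)) ->
  bnd (\sum_(i <- s | P i) F i) (\sum_(i <- s | P i) f i).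
Proof.
move=> h; elim/big_rec2: _ => [|i x y Pi]; first exact: bnd0.
by apply: bndD; exact: h.
Qed.

(** With [w] the image of [v] under the adjoint, |w|^2 = <v, A w> <= a |v| |w|; divide by |w|. *)
Lemma bnd_adj A a : bnd A a -> bnd (A^t*) a.
Proof.
move=> [a0 h]; split=> // v; set w := A^t* *m v.
have [w0|w0] := eqVneq (l2norm w) 0; first by rewrite w0 mulr_ge0 ?l2norm_ge0.
have wp : 0 < l2norm w by rewrite lt_def w0 l2norm_ge0.
rewrite -(ler_pM2r wp) -expr2.
have -> : l2norm w ^+ 2 = complex.Re (dot v (A *m w)) by rewrite -dot_adj -/w dotvv.
rewrite (le_trans (ler_norm _))// (le_trans (Re_le_normc _))//.
rewrite (le_trans (normc_dot_le _ _))//.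
by rewrite [a * _]mulrC -mulrA ler_wpM2l ?l2norm_ge0.
Qed.

Lemma bnd_unitary A : A^t* *m A = 1%:M -> bnd A 1.
Proof.
move=> h; split=> // v; rewrite mul1r -(@ler_pXn2r _ 2)// ?nnegrE ?l2norm_ge0//.
suff -> : l2norm (A *m v) ^+ 2 = l2norm v ^+ 2 by [].
apply: complexI; rewrite -!dotvv.
have -> : dot (A *m v) (A *m v) = dot v (A^t* *m (A *m v)).
  by rewrite -(dot_adj (A^t*)) /= trmxCK.
by rewrite mulmxA h mul1mx.
Qed.

Definition ev psi A : C := (psi^t* *m A *m psi) ord0 ord0.

Lemma evE psi A : ev psi A = dot psi (A *m psi).
Proof. by rewrite /ev /dot mulmxA. Qed.

Lemma evD psi A B : ev psi (A + B) = ev psi A + ev psi B.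
Proof. by rewrite /ev mulmxDr mulmxDl mxE. Qed.

Lemma evZ psi z A : ev psi (z *: A) = z * ev psi A.
Proof. by rewrite /ev -scalemxAr -scalemxAl mxE. Qed.

Lemma evN psi A : ev psi (- A) = - ev psi A.
Proof. by rewrite -scaleN1r evZ mulN1r. Qed.

Lemma evB psi A B : ev psi (A - B) = ev psi A - ev psi B.
Proof. by rewrite evD evN. Qed.

Lemma ev0 psi : ev psi 0 = 0.
Proof. by rewrite -(scale0r 0) evZ mul0r. Qed.

Lemma ev_sum psi (I : Type) (s : seq I) (P : pred I) (F : I -> 'M[C]_n) :
  ev psi (\sum_(i <- s | P i) F i) = \sum_(i <- s | P i) ev psi (F i).
Proof.
elim/big_rec2: _ => [|i x y _ <-]; [exact: ev0 | exact: evD].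
Qed.

Lemma ev_adj psi A : ev psi (A^t*) = (ev psi A)^*%C.
Proof. by rewrite !evE -dot_adj trmxCK -dotC. Qed.

Lemma ev1 psi : l2norm psi = 1 -> ev psi 1%:M = 1.
Proof. by move=> h; rewrite evE mul1mx dotvv h expr1n. Qed.

Lemma normc_ev_le psi A a : l2norm psi = 1 -> bnd A a -> normc (ev psi A) <= a.
Proof.
move=> h [a0 hA]; rewrite evE (le_trans (normc_dot_le _ _))// h mul1r.
by rewrite (le_trans (hA _))// h mulr1.
Qed.

Lemma bnd_opnorm A : bnd A (opnorm A).
Proof.
set E := [set l2norm (A *m v) | v in [set v : 'cV[C]_n | l2norm v = 1]]%classic.
have Eub : has_ubound E.
  exists (\sum_i \sum_j normc (A i j)) => _ [v /= v1 <-].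
  rewrite -(@ler_pXn2r _ 2)// ?nnegrE ?l2norm_ge0//; last first.
    by apply: sumr_ge0 => i _; apply: sumr_ge0 => j _; exact: normc_ge0.
  rewrite sqr_l2norm.
  have h i : normc ((A *m v) i ord0) <= \sum_j normc (A i j).
    rewrite !mxE (le_trans (normc_sum _ _ _))//; apply: ler_sum => j _.
    rewrite Normc.normcM ler_piMr ?normc_ge0// -(@expr_le1 _ 2)// ?normc_ge0//.
    rewrite -[leRHS](expr1n _ 2) -v1 sqr_l2norm (bigD1 j)//= lerDl.
    by apply: sumr_ge0 => k _; exact: sqr_ge0.
  rewrite expr2 mulr_suml; apply: ler_sum => i _.
  rewrite expr2 ler_pM ?normc_ge0// ?(le_trans (h i))//.
  rewrite [leRHS](bigD1 i)//= lerDl.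
  by apply: sumr_ge0 => k _; apply: sumr_ge0 => j _; exact: normc_ge0.
have ge0 : 0 <= opnorm A.
  (* In dimension zero there is no unit vector, and [sup] of the empty set is 0. *)
  have [[x Ex]|E0] := pselect (nonempty E).
    apply: le_trans (ub_le_sup Eub Ex); case: Ex => v _ <-; exact: l2norm_ge0.
  by rewrite /opnorm -/E sup_out// => -[].
split=> // v; have [v0|v0] := eqVneq (l2norm v) 0.
  by rewrite (l2norm_eq0 v0) mulmx0 l2norm0 mulr0.
have vp : 0 < l2norm v by rewrite lt_def v0 l2norm_ge0.
have : l2norm (A *m ((l2norm v)^-1%:C%C *: v)) <= opnorm A.
  apply: ub_le_sup => //; exists ((l2norm v)^-1%:C%C *: v) => //=.
  by rewrite l2normZ normc_real ger0_norm ?invr_ge0 ?l2norm_ge0// mulVf.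
rewrite -scalemxAr l2normZ normc_real ger0_norm ?invr_ge0 ?l2norm_ge0//.
by rewrite mulrC ler_pdivrMr.
Qed.

Lemma opnorm_le A a : bnd A a -> opnorm A <= a.
Proof.
move=> [a0 h]; rewrite /opnorm.
set E := [set _ | _ in _]%classic.
have [E0|E0] := pselect (nonempty E).
  by apply: ge_sup => // _ [v /= v1 <-]; rewrite (le_trans (h v))// v1 mulr1.
by rewrite sup_out// => -[].
Qed.

End HilbertSpace.

(** * Derivatives of complex and matrix valued functions *)

Section Calculus.
Variable R : realType.
Implicit Types (f : R -> R) (g h : R -> R[i]) (a b t x : R).

Lemma ReM (z w : R[i]) :
  complex.Re (z * w) = complex.Re z * complex.Re w - complex.Im z * complex.Im w.
Proof. by case: z => a b; case: w. Qed.

Lemma ImM (z w : R[i]) :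
  complex.Im (z * w) = complex.Re z * complex.Im w + complex.Im z * complex.Re w.
Proof. by case: z => a b; case: w. Qed.

Lemma ReD (z w : R[i]) : complex.Re (z + w) = complex.Re z + complex.Re w.
Proof. by case: z => a b; case: w. Qed.

Lemma ImD (z w : R[i]) : complex.Im (z + w) = complex.Im z + complex.Im w.
Proof. by case: z => a b; case: w. Qed.

Lemma ler_of_derive f (f' : R -> R) a b : a <= b ->
  (forall x, is_derive x 1 f (f' x)) -> (forall x, a <= x <= b -> 0 <= f' x) ->
  f a <= f b.
Proof.
move=> ab df f'0.
have cf : {within `[a, b], continuous f}%classic.
  apply: continuous_subspaceT => x; apply: differentiable_continuous.
  by apply/derivable1_diffP; case: (df x).
have [c] := MVT_segment ab (fun x _ => df x) cf.
rewrite in_itv /= => cab.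
move/eqP; rewrite subr_eq => /eqP ->; rewrite lerDr mulr_ge0 ?subr_ge0//.
exact: f'0.
Qed.

Definition cder g t (g' : R[i]) :=
  is_derive t 1 (fun s => complex.Re (g s)) (complex.Re g') /\
  is_derive t 1 (fun s => complex.Im (g s)) (complex.Im g').

Lemma cder_eq g t (z w : R[i]) : cder g t z -> z = w -> cder g t w.
Proof. by move=> + <-. Qed.

Lemma cder_cst t (z : R[i]) : cder (fun=> z) t 0.
Proof. by split; exact: is_derive_cst. Qed.

Lemma cderD g h t (g' h' : R[i]) :
  cder g t g' -> cder h t h' -> cder (fun s => g s + h s) t (g' + h').
Proof.
move=> [g1 g2] [h1 h2]; split.
  have -> : (fun s => complex.Re (g s + h s)) =
      (fun s => complex.Re (g s)) + (fun s => complex.Re (h s)).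
    by apply/funext => s; rewrite ReD.
  by rewrite ReD; exact: is_deriveD.
have -> : (fun s => complex.Im (g s + h s)) =
    (fun s => complex.Im (g s)) + (fun s => complex.Im (h s)).
  by apply/funext => s; rewrite ImD.
by rewrite ImD; exact: is_deriveD.
Qed.

Lemma cderM g h t (g' h' : R[i]) : cder g t g' -> cder h t h' ->
  cder (fun s => g s * h s) t (g' * h t + g t * h').
Proof.
move=> [g1 g2] [h1 h2]; split.
  have -> : (fun s => complex.Re (g s * h s)) =
      (fun s => complex.Re (g s)) * (fun s => complex.Re (h s)) -
      (fun s => complex.Im (g s)) * (fun s => complex.Im (h s)).
    by apply/funext => s; rewrite ReM.
  by apply: is_derive_eq; rewrite ReD !ReM /GRing.scale /=; ring.
have -> : (fun s => complex.Im (g s * h s)) =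
    (fun s => complex.Re (g s)) * (fun s => complex.Im (h s)) +
    (fun s => complex.Im (g s)) * (fun s => complex.Re (h s)).
  by apply/funext => s; rewrite ImM.
by apply: is_derive_eq; rewrite ImD !ImM /GRing.scale /=; ring.
Qed.

Lemma cder_sum (I : Type) (r : seq I) (F : I -> R -> R[i]) t (F' : I -> R[i]) :
  (forall i, cder (F i) t (F' i)) ->
  cder (fun s => \sum_(i <- r) F i s) t (\sum_(i <- r) F' i).
Proof.
move=> h; elim: r => [|i r IH].
  rewrite big_nil; have -> : (fun s => \sum_(i <- [::]) F i s) = (fun=> 0).
    by apply/funext => s; rewrite big_nil.
  exact: cder_cst.
rewrite big_cons.
have -> : (fun s => \sum_(i <- (i :: r)) F i s) =
    (fun s => F i s + \sum_(i <- r) F i s).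
  by apply/funext => s; rewrite big_cons.
exact: cderD.
Qed.

Lemma cder_real f t (f' : R) : is_derive t 1 f f' -> cder (fun s => (f s)%:C%C) t f'%:C%C.
Proof. by move=> df; split=> //=; exact: is_derive_cst. Qed.

Lemma is_derive_pow n t : is_derive t 1 (fun s : R => s ^+ n) (n%:R * t ^+ n.-1).
Proof.
have -> : (fun s : R => s ^+ n) = (@id R) ^+ n.
  by elim: n => [|n IH]; apply/funext => s;
    rewrite ?expr0// !exprS; congr (_ * _); exact: (congr1 (@^~ s) IH).
by apply: is_derive_eq; rewrite /GRing.scale /= mulr1.
Qed.

(** After any rotation [w] the real function [f - Re (w g)] is nondecreasing on [0, t];
    [normc_le_of_rotations] then removes the rotation. *)
Lemma normc_incr_le g (g' : R -> R[i]) f (f' : R -> R) t : 0 <= t ->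
  (forall s, cder g s (g' s)) -> (forall s : R, is_derive s 1 f (f' s)) ->
  (forall s, 0 <= s <= t -> normc (g' s) <= f' s) ->
  normc (g t - g 0) <= f t - f 0.
Proof.
move=> t0 dg df h; apply: normc_le_of_rotations => w w1.
pose F := f - (fun s => complex.Re (w * g s)).
have dF (s : R) : is_derive s 1 F (f' s - complex.Re (w * g' s)).
  apply: is_deriveB; have [] := cderM (cder_cst s w) (dg s).
  by rewrite mul0r add0r.
have : F 0 <= F t.
  apply: (ler_of_derive t0 dF) => s hs; rewrite subr_ge0.
  rewrite (le_trans (ler_norm _))// (le_trans (Re_le_normc _))//.
  by rewrite Normc.normcM w1 mul1r h.
rewrite /F /= !fctE mulrBr raddfB /=; lra.
Qed.

Definition cis (x : R) : R[i] := (cos x +i* sin x)%C.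

Lemma normc_cis x : normc (cis x) = 1.
Proof. by rewrite /cis /= cos2Dsin2 sqrtr1. Qed.

Lemma cisD x y : cis (x + y) = cis x * cis y.
Proof.
by apply/eqP; rewrite eq_complex /= cosD sinD addrC; apply/andP; split; apply/eqP; ring.
Qed.

Lemma cis0 : cis 0 = 1.
Proof. by rewrite /cis cos0 sin0. Qed.

Lemma cisN x : cis (- x) = (cis x)^*%C.
Proof. by rewrite /cis cosN sinN. Qed.

Lemma cder_cis (l : R) t :
  cder (fun s => cis (- (s * l))) t ((0 -i* l)%C * cis (- (t * l))).
Proof.
have dl : is_derive t 1 (fun s : R => - (s * l)) (- l).
  by apply: is_derive_eq; rewrite /GRing.scale /=; ring.
split.
  have -> : (fun s => complex.Re (cis (- (s * l)))) = cos \o (fun s : R => - (s * l)) by [].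
  by apply: is_derive_eq; rewrite ReM /=; ring.
have -> : (fun s => complex.Im (cis (- (s * l)))) = sin \o (fun s : R => - (s * l)) by [].
by apply: is_derive_eq; rewrite ImM /=; ring.
Qed.

Definition mder m n (A : R -> 'M[R[i]]_(m, n)) t (A' : 'M[R[i]]_(m, n)) :=
  forall i j, cder (fun s => A s i j) t (A' i j).

Lemma mder_eq m n (A : R -> 'M[R[i]]_(m, n)) t A1 A2 :
  mder A t A1 -> A1 = A2 -> mder A t A2.
Proof. by move=> + <-. Qed.

Lemma mder_cst m n (A : 'M[R[i]]_(m, n)) t : mder (fun=> A) t 0.
Proof. by move=> i j; rewrite mxE; exact: cder_cst. Qed.

Lemma mderM m n p (A : R -> 'M[R[i]]_(m, n)) (B : R -> 'M[R[i]]_(n, p)) t A' B' :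
  mder A t A' -> mder B t B' ->
  mder (fun s => A s *m B s) t (A' *m B t + A t *m B').
Proof.
move=> hA hB i j; rewrite !mxE -big_split /=.
have -> : (fun s => (A s *m B s) i j) = (fun s => \sum_k A s i k * B s k j).
  by apply/funext => s; rewrite mxE.
by apply: cder_sum => k; exact: cderM.
Qed.

Lemma mderMl m n p (A : 'M[R[i]]_(m, n)) (B : R -> 'M[R[i]]_(n, p)) t B' :
  mder B t B' -> mder (fun s => A *m B s) t (A *m B').
Proof.
move=> hB; apply: mder_eq (mderM (mder_cst A t) hB) _.
by rewrite mul0mx add0r.
Qed.

Lemma mderMr m n p (A : R -> 'M[R[i]]_(m, n)) (B : 'M[R[i]]_(n, p)) t A' :
  mder A t A' -> mder (fun s => A s *m B) t (A' *m B).
Proof.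
move=> hA; apply: mder_eq (mderM hA (mder_cst B t)) _.
by rewrite mulmx0 addr0.
Qed.

Lemma mder_sum m n (I : Type) (r : seq I) (F : I -> R -> 'M[R[i]]_(m, n)) t F' :
  (forall i, mder (F i) t (F' i)) ->
  mder (fun s => \sum_(i <- r) F i s) t (\sum_(i <- r) F' i).
Proof.
move=> h i j; rewrite summxE.
have -> : (fun s => (\sum_(k <- r) F k s) i j) = (fun s => \sum_(k <- r) F k s i j).
  by apply/funext => s; rewrite summxE.
by apply: cder_sum => k; exact: h.
Qed.

Lemma mder_pow m n k (A : 'M[R[i]]_(m, n)) t :
  mder (fun s => (s ^+ k)%:C%C *: A) t ((k%:R * t ^+ k.-1)%:C%C *: A).
Proof.
move=> i j; rewrite mxE.
have -> : (fun s : R => ((s ^+ k)%:C%C *: A) i j) = (fun s : R => (s ^+ k)%:C%C * A i j).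
  by apply/funext => s; rewrite mxE.
apply: cder_eq (cderM (cder_real (is_derive_pow k t)) (cder_cst t (A i j))) _.
by rewrite mulr0 addr0.
Qed.

End Calculus.

(** * Unitary evolution *)

Lemma diag_entry (K : nzRingType) n (Q P : 'M[K]_n) (e : 'rV[K]_n) i j :
  (Q *m diag_mx e *m P) i j = \sum_k Q i k * e ord0 k * P k j.
Proof.
by rewrite mxE; apply: eq_bigr => k _; congr (_ * _); rewrite mul_mx_diag mxE.
Qed.

Lemma diag_conj_pow (K : fieldType) n (P Q : 'M[K]_n) (a : 'rV[K]_n) k :
  P *m Q = 1%:M ->
  (Q *m diag_mx a *m P) ^+ k = Q *m diag_mx (\row_j a ord0 j ^+ k) *m P.
Proof.
move=> PQ; elim: k => [|k IH].
  rewrite expr0; have -> : (\row_j a ord0 j ^+ 0) = const_mx 1.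
    by apply/rowP => j; rewrite !mxE expr0.
  by rewrite diag_const_mx mulmx1 (mulmx1C PQ).
rewrite exprS IH -[LHS]/(_ *m _) -!mulmxA [P *m (Q *m _)]mulmxA PQ mul1mx.
rewrite !mulmxA; congr (_ *m _); rewrite -mulmxA mulmx_diag.
by congr (_ *m diag_mx _); apply/rowP => j; rewrite !mxE exprS.
Qed.

Section MatrixExponential.
Variables (K : numFieldType) (n : nat).

Lemma cvg_mx_entries (u : nat -> 'M[K]_n) (l : 'M[K]_n) :
  (forall i j, (u k i j @[k --> \oo] --> l i j)%classic) ->
  (u k @[k --> \oo] --> l)%classic.
Proof.
move=> h; apply/cvg_ballP => e e0.
have H : \forall k \near \oo%classic, forall i j, ball (l i j) e (u k i j).
  apply: filter_forall => i; apply: filter_forall => j.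
  by move: (h i j) => /cvg_ballP; apply.
by near=> k; split=> //; near: k; exact: H.
Unshelve. all: by end_near. Qed.

Lemma cvg_sumr (I : Type) (r : seq I) (F : nat -> I -> K) (l : I -> K) :
  (forall i, (F k i @[k --> \oo] --> l i)%classic) ->
  ((\sum_(i <- r) F k i) @[k --> \oo] --> (\sum_(i <- r) l i))%classic.
Proof.
move=> h; elim: r => [|i r IH].
  by rewrite big_nil; under eq_fun do rewrite big_nil; exact: cvg_cst.
by rewrite big_cons; under eq_fun do rewrite big_cons; exact: cvgD.
Qed.

(** Conjugation passes through the partial sums of the series, so convergence is only needed
    eigenvalue by eigenvalue. *)
Lemma mexp_diag (P Q : 'M[K]_n) (a e : 'rV[K]_n) : P *m Q = 1%:M ->
  (forall j (eps : K), 0 < eps -> exists N0, forall N, (N0 <= N)%N ->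
     `|e ord0 j - \sum_(0 <= k < N) (k`!%:R)^-1 * a ord0 j ^+ k| < eps) ->
  mexp (Q *m diag_mx a *m P) = Q *m diag_mx e *m P.
Proof.
move=> PQ h; apply: cvg_lim; first exact: norm_hausdorff.
have serE N : series (fun k => (k`!%:R)^-1 *: (Q *m diag_mx a *m P) ^+ k) N =
    Q *m diag_mx (\row_j \sum_(0 <= k < N) (k`!%:R)^-1 * a ord0 j ^+ k) *m P.
  rewrite /series /=.
  have -> : diag_mx (\row_j \sum_(0 <= k < N) (k`!%:R)^-1 * a ord0 j ^+ k) =
      \sum_(0 <= k < N) diag_mx (\row_j ((k`!%:R)^-1 * a ord0 j ^+ k)).
    apply/matrixP => i j; rewrite !mxE summxE -sumrMnl.
    by apply: eq_bigr => k _; rewrite !mxE.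
  rewrite mulmx_sumr mulmx_suml; apply: eq_bigr => k _.
  rewrite diag_conj_pow// scalemxAl scalemxAr; congr (_ *m _ *m _).
  by apply/matrixP => i j; rewrite !mxE mulrnAr.
apply: cvg_mx_entries => i j.
pose v N := \row_j \sum_(0 <= k < N) (k`!%:R)^-1 * a ord0 j ^+ k.
have E := funext (fun N => etrans (congr1 (fun M : 'M[K]_n => M i j) (serE N)) (diag_entry Q P
  (v N) i j)).
rewrite diag_entry; suff : ((\sum_k Q i k * v N ord0 k * P k j) @[N --> \oo] -->
    (\sum_k Q i k * e ord0 k * P k j))%classic by rewrite -E.
apply: cvg_sumr => k; apply: cvgMr_tmp; apply: cvgMl_tmp.
apply/cvgrPdist_lt => eps eps0; have [N0 hN0] := h k eps eps0.
by exists N0 => // N /= hN; rewrite mxE; exact: hN0.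
Qed.

End MatrixExponential.

Section Evolution.
Variables (R : realType) (n : nat).
Local Notation C := R[i].
Implicit Types (H P : 'M[C]_n) (d : 'I_n -> R) (t c x : R).

(** The parity factors reproduce the shape of [cos_coeff] and [sin_coeff], so that the partial sums
    of the exponential series split into those of cosine and sine. *)
Lemma pow_negi (x : R) k : ((0 -i* x)%C : C) ^+ k =
  ((~~ odd k)%:R * (-1) ^+ k./2 * x ^+ k
     -i* ((odd k)%:R * (-1) ^+ k.-1./2 * x ^+ k))%C.
Proof.
have H2 m : ((0 -i* x)%C : C) ^+ m.*2 = ((-1) ^+ m * x ^+ m.*2)%:C%C.
  elim: m => [|m IH]; first by rewrite /= !expr0 mulr1.
  rewrite doubleS !exprS IH; apply/eqP; rewrite eq_complex /=.
  by apply/andP; split; apply/eqP; ring.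
have [m [->|->]] : exists m, k = m.*2 \/ k = m.*2.+1.
  by exists k./2; have := odd_double_half k; lia.
  rewrite H2 odd_double doubleK /=.
  by apply/eqP; rewrite eq_complex /=; apply/andP; split; apply/eqP; ring.
rewrite exprS H2 /= odd_double /= doubleK exprS uphalf_double.
move: ((-1) ^+ m) (x ^+ m.*2) => u w.
by apply/eqP; rewrite eq_complex /=; apply/andP; split; apply/eqP; ring.
Qed.

Lemma cis_series x (e : C) : 0 < e -> exists N0, forall N, (N0 <= N)%N ->
  `|cis (- x) - \sum_(0 <= k < N) (k`!%:R)^-1 * ((0 -i* x)%C : C) ^+ k| < e.
Proof.
case: e => e1 e2; rewrite ltcE /= => /andP[/eqP -> e0].
have sE N : \sum_(0 <= k < N) (k`!%:R)^-1 * ((0 -i* x)%C : C) ^+ k =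
    (series (cos_coeff x) N -i* series (sin_coeff x) N)%C.
  rewrite /series /=; elim: N => [|N IH]; first by rewrite !big_nil oppr0.
  rewrite !big_nat_recr//= IH pow_negi.
  have -> : ((N`!%:R)^-1 : C) = ((N`!%:R)^-1)%:C%C by rewrite fmorphV rmorph_nat.
  have -> : cos_coeff x N = (~~ odd N)%:R * (-1) ^+ N./2 * x ^+ N / N`!%:R by [].
  have -> : sin_coeff x N = (odd N)%:R * (-1) ^+ N.-1./2 * x ^+ N / N`!%:R by [].
  move: (_ * (-1) ^+ N./2) (_ * (-1) ^+ N.-1./2) (x ^+ N) (_^-1) => u w y z.
  apply/eqP; rewrite eq_complex /=.
  by apply/andP; split; apply/eqP; ring.
have /cvgrPdist_lt/(_ (e1 / 2)) hc : (series (cos_coeff x) @ \oo --> cos x)%classic.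
  by rewrite cos.unlock; exact: is_cvg_series_cos_coeff.
have /cvgrPdist_lt/(_ (e1 / 2)) hs : (series (sin_coeff x) @ \oo --> sin x)%classic.
  by rewrite sin.unlock; exact: is_cvg_series_sin_coeff.
have [N1 _ h1] := hc ltac:(lra); have [N2 _ h2] := hs ltac:(lra).
exists (maxn N1 N2) => N; rewrite geq_max => /andP[l1 l2].
have {}h1 := h1 N l1; have {}h2 := h2 N l2; rewrite /= in h1 h2.
rewrite sE ltcE /= eqxx /= /cis cosN sinN /= opprK.
set a := cos x - _ in h1 *; set b := - sin x + _.
have hb : `|b| < e1 / 2 by rewrite -normrN /b opprD opprK.
rewrite -(@ltr_pXn2r _ 2)// ?nnegrE ?sqrtr_ge0 ?(ltW e0)//.
rewrite sqr_sqrtr ?addr_ge0 ?sqr_ge0// -[a ^+ 2]real_normK ?num_real//.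
rewrite -[b ^+ 2]real_normK ?num_real//.
have := normr_ge0 a; have := normr_ge0 b; nra.
Qed.

Lemma evolution_diag P d t : P \is unitarymx ->
  evolution (P^t* *m diag_mx (\row_j (d j)%:C%C) *m P) t =
  P^t* *m diag_mx (\row_j cis (- (t * d j))) *m P.
Proof.
move=> /unitarymxP PP; rewrite /evolution scalemxAl scalemxAr.
have -> : (0 -i* t)%C *: diag_mx (\row_j (d j)%:C%C) =
    diag_mx (\row_j ((0 -i* (t * d j))%C : C)).
  apply/matrixP => i j; rewrite !mxE mulrnAr; congr (_ *+ _).
  by apply/eqP; rewrite eq_complex /=; apply/andP; split; apply/eqP; ring.
by apply: mexp_diag => // j e e0; rewrite !mxE; exact: cis_series.
Qed.

Lemma hermsymmxE H : H \is hermsymmx -> H^t* = H.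
Proof.
by move=> /is_hermitianmxP; rewrite expr0 scale1r => <-.
Qed.

Lemma hermsymmx_of_adj H : H^t* = H -> H \is hermsymmx.
Proof.
by move=> h; apply/is_hermitianmxP; rewrite expr0 scale1r.
Qed.

Lemma hermitian_diag H : H \is hermsymmx -> exists P d,
  P \is unitarymx /\ H = P^t* *m diag_mx (\row_j (d j)%:C%C) *m P.
Proof.
move=> hH; exists (spectralmx H), (fun j => complex.Re (spectral_diag H ord0 j)).
split; first exact: spectral_unitarymx.
have /orthomx_spectralP := hermitian_normalmx hH.
rewrite (invmx_unitary (spectral_unitarymx H)) {1}/spectralmx => {1}->.
congr (_ *m diag_mx _ *m _); apply/rowP => j; rewrite mxE.
have /mxOverP/(_ ord0 j) := hermitian_spectral_diag_real hH.
by move=> /RRe_real.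
Qed.

Lemma evolution0 H : H \is hermsymmx -> evolution H 0 = 1%:M.
Proof.
move=> /hermitian_diag[P [d [hP ->]]]; rewrite evolution_diag//.
have -> : \row_j cis (- (0 * d j)) = const_mx 1.
  by apply/rowP => j; rewrite !mxE mul0r oppr0 cis0.
rewrite diag_const_mx mulmx1; have /unitarymxP := hP; exact: mulmx1C.
Qed.

Lemma evolution_adj H t : H \is hermsymmx -> (evolution H t)^t* = evolution H (- t).
Proof.
move=> /hermitian_diag[P [d [hP ->]]]; rewrite !evolution_diag//.
rewrite !adjM trmxCK mulmxA.
congr (_ *m _ *m _); rewrite tr_diag_mx map_diag_mx; congr diag_mx.
by apply/rowP => j; rewrite !mxE mulNr [RHS]cisN.
Qed.

Lemma evolution_unitary H t : H \is hermsymmx ->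
  (evolution H t)^t* *m evolution H t = 1%:M.
Proof.
move=> hH; rewrite evolution_adj//.
case: (hermitian_diag hH) => [P [d [hP ->]]]; rewrite !evolution_diag//.
have /unitarymxP PP := hP.
rewrite !mulmxA; set Q := P^t*; rewrite -[Q *m _ *m P *m Q]mulmxA PP mulmx1.
rewrite -[Q *m _ *m _]mulmxA mulmx_diag.
have -> : (\row_j ((\row_j0 cis (- (- t * d j0))) ord0 j *
    (\row_j0 cis (- (t * d j0))) ord0 j)) = const_mx 1 :> 'rV[C]_n.
  by apply/rowP => j; rewrite !mxE -cisD mulNr opprK subrr cis0.
by rewrite diag_const_mx mulmx1 (mulmx1C PP).
Qed.

Lemma bnd_evolution H t : H \is hermsymmx -> bnd (evolution H t) 1.
Proof. by move=> hH; apply: bnd_unitary; exact: evolution_unitary. Qed.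

Lemma mder_evolution H t : H \is hermsymmx ->
  mder (evolution H) t ((0 -i* 1)%C *: (H *m evolution H t)).
Proof.
move=> /hermitian_diag[P [d [hP ->]]].
rewrite (_ : evolution _ = fun s => P^t* *m diag_mx (\row_j cis (- (s * d j))) *m P);
  last by apply/funext => s; rewrite evolution_diag.
have /unitarymxP PP := hP.
have dd : mder (fun s => diag_mx (\row_j cis (- (s * d j)))) t
    (diag_mx (\row_j ((0 -i* d j)%C * cis (- (t * d j))))).
  move=> i j; rewrite !mxE.
  case: (eqVneq i j) => [<-|ij]; last first.
    rewrite mulr0n (_ : (fun s => _) = (fun=> 0)); first exact: cder_cst.
    by apply/funext => s; rewrite !mxE (negbTE ij) mulr0n.
  rewrite mulr1n (_ : (fun s => _) = (fun s => cis (- (s * d i)))); first exact: cder_cis.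
  by apply/funext => s; rewrite !mxE eqxx mulr1n.
apply: mder_eq (mderMr _ (mderMl _ dd)) _.
rewrite !mulmxA; set Q := P^t*; rewrite -[Q *m _ *m P *m Q]mulmxA PP mulmx1.
rewrite -[Q *m _ *m diag_mx _]mulmxA mulmx_diag scalemxAl scalemxAr.
congr (_ *m _ *m _); apply/matrixP => i j; rewrite !mxE mulrnAr; congr (_ *+ _).
by rewrite mulrA; congr (_ * _); apply/eqP; rewrite eq_complex /=; apply/andP; split;
  apply/eqP; ring.
Qed.

(** An energy shift costs only a phase, so the Hamiltonian can be centred without changing the
    fidelity. *)
Lemma evolution_shift H c t : H \is hermsymmx ->
  evolution (H - c%:C%C%:M) t = cis (t * c) *: evolution H t.
Proof.
move=> /hermitian_diag[P [d [hP ->]]]; rewrite evolution_diag//.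
have /unitarymxP PP := hP.
have -> : P^t* *m diag_mx (\row_j (d j)%:C%C) *m P - c%:C%C%:M =
    P^t* *m diag_mx (\row_j (d j - c)%:C%C) *m P.
  have -> : diag_mx (\row_j (d j - c)%:C%C) =
      diag_mx (\row_j (d j)%:C%C) - c%:C%C%:M :> 'M[C]_n.
    apply/matrixP => i j; rewrite !mxE; case: (i == j);
    by rewrite ?mulr1n ?mulr0n ?rmorphB ?subr0.
  rewrite mulmxBr mulmxBl; congr (_ - _).
  by rewrite mul_mx_scalar -scalemxAl (mulmx1C PP) scalemx1.
rewrite evolution_diag// scalemxAl scalemxAr; congr (_ *m _ *m _).
apply/matrixP => i j; rewrite !mxE mulrnAr -cisD; congr (cis _ *+ _); ring.
Qed.

(** The weights are the squared amplitudes of [psi] in an eigenbasis: the expectation is the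
    characteristic function of the energy distribution, and its positive definiteness in time is
    read off from this form. *)
Lemma ev_evolution H (psi : 'cV[C]_n) : H \is hermsymmx -> l2norm psi = 1 ->
  exists (p d : 'I_n -> R), [/\ forall j, 0 <= p j, \sum_j p j = 1 &
    forall t, ev psi (evolution H t) = \sum_j (p j)%:C%C * cis (- (t * d j))].
Proof.
move=> /hermitian_diag[P [d [hP ->]]] psi1.
have /unitarymxP PP := hP.
exists (fun j => normc ((P *m psi) j ord0) ^+ 2), d; split=> [j||t].
- exact: sqr_ge0.
- rewrite -sqr_l2norm; apply: complexI; rewrite -dotvv.
  have -> : dot (P *m psi) (P *m psi) = dot psi (P^t* *m (P *m psi)).
    by rewrite -(dot_adj (P^t*)) /= trmxCK.
  by rewrite mulmxA (mulmx1C PP) mul1mx dotvv psi1 expr1n.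
rewrite evolution_diag// evE -!mulmxA -dot_adj trmxCK dotE.
apply: eq_bigr => j _; rewrite mul_diag_mx !mxE mulrCA mulrC; congr (_ * _).
by rewrite mulrC mulcconj.
Qed.

End Evolution.

(** * Supports of operators *)

Section Support.
Variables (R : realType) (d : nat) (T : finType).
Local Notation C := R[i].
Implicit Types (A B : op R d T) (X Y : {set T}) (s t u : config d T).

Definition entry A s t : C := A (enum_rank s) (enum_rank t).

Lemma entryP A B : (forall s t, entry A s t = entry B s t) -> A = B.
Proof.
move=> h; apply/matrixP => i j.
by have := h (enum_val i) (enum_val j); rewrite /entry !enum_valK.
Qed.

Lemma entryM A B s t : entry (A *m B) s t = \sum_u entry A s u * entry B u t.
Proof.
rewrite /entry mxE (reindex (@enum_rank (config d T))) //=.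
by apply: onW_bij; exact: enum_rank_bij.
Qed.

Definition agree (X : pred T) s t := [forall x, X x ==> (s x == t x)].

Lemma agreeP (X : pred T) s t : reflect (forall x, X x -> s x = t x) (agree X s t).
Proof.
by apply: (iffP forallP) => h x; have := h x;
  [move=> /implyP/(_ _)/eqP + Xx; apply | move=> ?; apply/implyP => /h/eqP].
Qed.

Definition on X : pred T := fun x => x \in X.
Definition off X : pred T := fun x => x \notin X.

(** An intrinsic form of [supported_on] on matrix elements between configurations. It avoids
    operators over the subtype of sites and lets products and commutators be computed entrywise. *)
Definition supp X A :=
  (forall s t, ~~ agree (off X) s t -> entry A s t = 0) /\
  (forall s t s' t', agree (off X) s t -> agree (off X) s' t' ->
     agree (on X) s s' -> agree (on X) t t' -> entry A s t = entry A s' t').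

Definition glue X s t : config d T := [ffun x => if x \in X then s x else t x].

Lemma glue_in X s t x : x \in X -> glue X s t x = s x.
Proof. by rewrite ffunE => ->. Qed.

Lemma glue_off X s t x : x \notin X -> glue X s t x = t x.
Proof. by rewrite ffunE => /negbTE ->. Qed.

Lemma restrE X s s' : (restr X s == restr X s') = agree (on X) s s'.
Proof.
apply/eqP/agreeP => [h x xX|h].
  by move/ffunP/(_ (exist _ x xX)): h; rewrite !ffunE.
by apply/ffunP => x; rewrite !ffunE h//; exact: (valP x).
Qed.

Lemma suppP X A : supported_on X A <-> supp X A.
Proof.
split.
  move=> [a ->]; split=> [s t|s t s' t'].
    by rewrite /entry !mxE /= !enum_rankK => /negbTE; rewrite /agree /off => ->.
  rewrite /entry !mxE /= !enum_rankK -/(agree (off X) s t) -/(agree (off X) s' t').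
  move=> -> ->; rewrite -!restrE.
  by move=> /eqP -> /eqP ->.
(* A reference configuration [s0] fills in the sites outside [X]. When no configuration exists, all
   matrices are empty. *)
move=> [h0 h1]; case: (pickP (@predT (config d T))) => [s0 _|no]; last first.
  exists 0; apply: entryP => s; have := no s; by [].
pose up (r : config d {x : T | x \in X}) : config d T :=
  [ffun x => if insub x is Some y then r y else s0 x].
have upX r : restr X (up r) = r.
  apply/ffunP => x; rewrite !ffunE; case: insubP => [y _ e|]; last first.
    by rewrite (valP x).
  by congr (r _); exact: val_inj.
have upO r x : x \notin X -> up r x = s0 x.
  by move=> xX; rewrite !ffunE insubN.
exists (\matrix_(i, j) entry A (up (enum_val i)) (up (enum_val j))).
apply: entryP => s t; rewrite [in RHS]/entry !mxE /= !enum_rankK.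
rewrite -/(agree (off X) s t); case: ifP => [st|/negbT /h0 //].
rewrite !mxE /= !enum_rankK; apply: h1 => //.
- by apply/agreeP => x xX; rewrite !upO.
- by rewrite -restrE upX.
- by rewrite -restrE upX.
Qed.

Lemma suppS X Y A : X \subset Y -> supp X A -> supp Y A.
Proof.
move=> /fintype.subsetP XY [h0 h1]; split=> [s t st|s t s' t' st st' ss tt].
  apply: h0; apply: contra st => /agreeP h; apply/agreeP => x xY; apply: h.
  by apply: contra xY; exact: XY.
move: st st' ss tt => /agreeP st /agreeP st' /agreeP ss /agreeP tt.
have E : agree (off X) s' t' = agree (off X) s t.
  apply/agreeP/agreeP => h x xX; have [xY|xY] := boolP (x \in Y); try by [apply: st|apply: st'].
    by rewrite ss// tt// h.
  by rewrite -ss// -tt// h.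
have [a|a] := boolP (agree (off X) s t); last by rewrite !h0// E.
by apply: h1; rewrite ?E//; apply/agreeP => x xX; [apply: ss | apply: tt]; exact: XY.
Qed.

Lemma supp_lin X A B z : supp X A -> supp X B -> supp X (A + z *: B).
Proof.
have eE s t : entry (A + z *: B) s t = entry A s t + z * entry B s t.
  by rewrite /entry !mxE.
move=> [a0 a1] [b0 b1]; split=> [s t st|s t s' t' st st' ss tt]; rewrite !eE.
  by rewrite a0// b0// mulr0 addr0.
by congr (_ + _ * _); [exact: a1 | exact: b1].
Qed.

Lemma supp0 X : supp X (0 : op R d T).
Proof. by split=> *; rewrite /entry !mxE. Qed.

Lemma supp1 X : supp X (1%:M : op R d T).
Proof.
have eE s t : entry 1%:M s t = (s == t)%:R.
  by rewrite /entry !mxE (inj_eq enum_rank_inj).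
split=> [s t st|s t s' t' /agreeP st /agreeP st' /agreeP ss /agreeP tt]; rewrite !eE.
  by case: eqVneq st => // ->; rewrite (introT (agreeP _ _ _)).
congr (nat_of_bool _)%:R; apply/eqP/eqP => h; apply/ffunP => x.
  by have [xX|xX] := boolP (x \in X); [rewrite -ss// -tt// h | exact: st'].
by have [xX|xX] := boolP (x \in X); [rewrite ss// tt// h | exact: st].
Qed.

Lemma suppD X A B : supp X A -> supp X B -> supp X (A + B).
Proof. by move=> sA sB; rewrite -[B]scale1r; exact: supp_lin. Qed.

Lemma suppZ X A z : supp X A -> supp X (z *: A).
Proof. by rewrite -(add0r (z *: A)); apply: supp_lin; exact: supp0. Qed.

Lemma suppB X A B : supp X A -> supp X B -> supp X (A - B).
Proof. by rewrite -scaleN1r; exact: supp_lin. Qed.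

Lemma supp_sum X (I : Type) (r : seq I) (P : pred I) (F : I -> op R d T) :
  (forall i, P i -> supp X (F i)) -> supp X (\sum_(i <- r | P i) F i).
Proof.
move=> h; elim/big_rec: _ => [|i x Pi]; first exact: supp0.
by apply: suppD; exact: h.
Qed.

(** Only intermediate configurations that agree with the outer one off [X] contribute, and they are
    determined by their values on [X]; [glue] carries those attached to [s] over to those attached
    to [s']. *)
Lemma suppM X A B : supp X A -> supp X B -> supp X (A *m B).
Proof.
move=> [a0 a1] [b0 b1]; split=> [s t st|s t s' t' st st' ss tt]; rewrite !entryM.
  rewrite big1// => u _; have [su|su] := boolP (agree (off X) s u); last first.
    by rewrite a0// mul0r.
  rewrite b0 ?mulr0//; apply: contra st => /agreeP ut; apply/agreeP => x xX.
  by move/agreeP: su => ->//; exact: ut.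
have small (p q : config d T) : \sum_u entry A p u * entry B u q =
    \sum_(u | agree (off X) p u) entry A p u * entry B u q.
  rewrite (bigID (agree (off X) p))/= [X in _ + X]big1 ?addr0// => u pu.
  by rewrite a0// mul0r.
rewrite !small (reindex_onto (fun u => glue X u s) (fun u => glue X u s')) /=.
  apply: eq_big => [u|u].
    apply/andP/agreeP => [[/agreeP h1 /eqP h2] x xX|h].
      by rewrite -h2 glue_off.
    split; first by apply/agreeP => x xX; rewrite glue_off.
    apply/eqP/ffunP => x; have [xX|xX] := boolP (x \in X).
      by rewrite !glue_in.
    by rewrite glue_off// h.
  move=> /andP[/agreeP h1 /eqP h2].
  have su : agree (off X) s (glue X u s) by apply/agreeP => x xX; rewrite glue_off.
  have su' : agree (off X) s' u.
    by apply/agreeP => x xX; rewrite -h2 glue_off.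
  have uu : agree (on X) (glue X u s) u by apply/agreeP => x xX; rewrite glue_in.
  congr (_ * _); first exact: a1.
  apply: b1 => //.
    apply/agreeP => x xX; rewrite glue_off//; exact: (agreeP _ _ _ st).
  apply/agreeP => x xX; rewrite -(agreeP _ _ _ su')//; exact: (agreeP _ _ _ st').
move=> u /agreeP h; apply/ffunP => x; have [xX|xX] := boolP (x \in X).
  by rewrite !glue_in.
by rewrite glue_off// h.
Qed.

Lemma supp_adj X A : supp X A -> supp X (A^t*).
Proof.
have eE s t : entry (A^t*) s t = (entry A t s)^*%C by rewrite /entry !mxE.
have sym P s t : agree P s t -> agree P t s.
  by move=> /agreeP h; apply/agreeP => x /h.
move=> [a0 a1]; split=> [s t st|s t s' t' st st' ss tt]; rewrite !eE.
  rewrite a0 ?conjc0//; apply: contra st; exact: sym.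
by congr (_^*)%C; apply: a1 => //; exact: sym.
Qed.

(** In either product at most one intermediate configuration survives, [u1] for [A *m B] and [u2]
    for [B *m A]. Their contributions coincide if [s] and [t] agree off both regions, and both
    vanish otherwise. *)
Lemma supp_comm X Y A B : [disjoint X & Y] -> supp X A -> supp Y B ->
  A *m B = B *m A.
Proof.
move=> XY [a0 a1] [b0 b1].
have YX x : x \in Y -> x \notin X by move=> xY; apply: contraTN xY => /(disjointFr XY) ->.
have offY x : x \in X -> x \notin Y by move=> /(disjointFr XY) ->.
apply: entryP => s t; rewrite !entryM.
pose u1 := glue X t s; pose u2 := glue X s t.
rewrite (bigD1 u1)//= [X in _ + X]big1 ?addr0; last first.
  move=> u uu; have [/agreeP su|su] := boolP (agree (off X) s u); last first.
    by rewrite a0// mul0r.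
  rewrite b0 ?mulr0//; apply: contra uu => /agreeP ut; apply/eqP/ffunP => x.
  have [xX|xX] := boolP (x \in X); last by rewrite glue_off// su.
  by rewrite glue_in// ut// /off offY.
rewrite (bigD1 u2)//= [X in _ = _ + X]big1 ?addr0; last first.
  move=> u uu; have [/agreeP ut|ut] := boolP (agree (off X) u t); last first.
    by rewrite a0// mulr0.
  rewrite b0 ?mul0r//; apply: contra uu => /agreeP su; apply/eqP/ffunP => x.
  have [xX|xX] := boolP (x \in X); last by rewrite glue_off// ut.
  by rewrite glue_in// su// /off offY.
rewrite mulrC.
have -> : entry A s u1 = entry A u2 t.
  by apply: a1; apply/agreeP => x xX;
    [rewrite glue_off|rewrite glue_off|rewrite glue_in|rewrite glue_in].
congr (_ * _).
pose Z x := (x \notin X) && (x \notin Y).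
have [/agreeP st|st] := boolP (agree Z s t).
  apply: b1; apply/agreeP => x xY.
  - have [xX|xX] := boolP (x \in X); first by rewrite glue_in.
    by rewrite glue_off// st// /Z xX.
  - have [xX|xX] := boolP (x \in X); first by rewrite glue_in.
    by rewrite glue_off// st// /Z xX.
  - by rewrite glue_off// YX.
  - by rewrite glue_off// YX.
rewrite !b0//; apply: contra st => /agreeP h; apply/agreeP => x /andP[xX xY].
  by have := h x xY; rewrite glue_off.
by have := h x xY; rewrite glue_off.
Qed.

End Support.

Section EvolutionSupport.
Variables (R : realType) (n : nat).
Local Notation C := R[i].

(** A linear relation between two entries that holds for all powers survives in the exponential: in
    an eigenbasis the defect is a fixed linear form in the eigenvalues of the evolution, every
    partial sum of the series gives exactly zero in it, and so it is bounded by a tail. The cases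
    [z = 0] and [z = 1] give the two clauses of [supp]. *)
Lemma evolution_entry (H : 'M[C]_n) (t : R) i j i' j' (z : C) : H \is hermsymmx ->
  (forall k, (H ^+ k) i j = z * (H ^+ k) i' j') ->
  evolution H t i j = z * evolution H t i' j'.
Proof.
move=> /hermitian_diag[P [d [hP ->]]]; rewrite evolution_diag//.
have /unitarymxP PP := hP; set Q := P^t*.
pose c l := Q i l * P l j - z * (Q i' l * P l j').
have entE (e : 'rV[C]_n) : (Q *m diag_mx e *m P) i j - z * (Q *m diag_mx e *m P) i' j' =
    \sum_l c l * e ord0 l.
  rewrite !diag_entry mulr_sumr -sumrB; apply: eq_bigr => l _.
  by rewrite /c; ring.
move=> h; apply/eqP; rewrite -subr_eq0 entE; apply/eqP.
have h' k : \sum_l c l * (d l)%:C%C ^+ k = 0.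
  have := h k; rewrite diag_conj_pow// => /eqP; rewrite -subr_eq0 entE => /eqP e0.
  by apply: etrans e0; apply: eq_bigr => l _; rewrite !mxE.
set S := \sum_l _.
have hN N : S = \sum_l c l * (cis (- (t * d l)) -
    \sum_(0 <= k < N) (k`!%:R)^-1 * ((0 -i* (t * d l))%C : C) ^+ k).
  rewrite -[LHS]subr0 -[X in S - X](_ : \sum_l c l *
    (\sum_(0 <= k < N) (k`!%:R)^-1 * ((0 -i* (t * d l))%C : C) ^+ k) = 0).
    by rewrite -sumrB; apply: eq_bigr => l _; rewrite mxE mulrBr.
  under eq_bigr do rewrite mulr_sumr.
  rewrite exchange_big big1//= => k _.
  rewrite (eq_bigr (fun l => (k`!%:R)^-1 * (0 -i* t)%C ^+ k * (c l * (d l)%:C%C ^+ k))).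
    by rewrite -mulr_sumr h' mulr0.
  move=> l _; have -> : ((0 -i* (t * d l))%C : C) = (0 -i* t)%C * (d l)%:C%C.
    by apply/eqP; rewrite eq_complex /=; apply/andP; split; apply/eqP; ring.
  by rewrite exprMn; ring.
apply/eqP/negPn/negP => S0.
pose M := \sum_l `|c l|.
have M0 : 0 <= M by apply: sumr_ge0.
have eps0 : 0 < `|S| / (M + 1) by rewrite divr_gt0 ?normr_gt0 ?ltr_wpDl.
have [N hb] : exists N, forall l, `|cis (- (t * d l)) -
    \sum_(0 <= k < N) (k`!%:R)^-1 * ((0 -i* (t * d l))%C : C) ^+ k| < `|S| / (M + 1).
  have /choice[N hN'] : forall l, exists N0, forall N, (N0 <= N)%N ->
      `|cis (- (t * d l)) -
    \sum_(0 <= k < N) (k`!%:R)^-1 * ((0 -i* (t * d l))%C : C) ^+ k| < `|S| / (M + 1).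
    by move=> l; exact: cis_series.
  exists (\max_l N l)%N => l; apply: hN'; exact: leq_bigmax.
have : `|S| <= M * (`|S| / (M + 1)).
  rewrite {1}(hN N) (le_trans (ler_norm_sum _ _ _))// mulr_suml.
  by apply: ler_sum => l _; rewrite normrM ler_wpM2l// ltW.
rewrite mulrCA ler_pMr ?normr_gt0// ler_pdivlMr ?ltr_wpDl// mul1r.
by rewrite -subr_ge0 opprD addNKr oppr_ge0 ler10.
Qed.

End EvolutionSupport.

Lemma supp_evolution (R : realType) d (T : finType) (X : {set T}) (H : op R d T) t :
  (H : 'M[R[i]]__) \is hermsymmx -> supp X H -> supp X (evolution H t).
Proof.
move=> hH sH; have sk k : supp X (H ^+ k).
  by elim: k => [|k IH]; [exact: supp1 | rewrite exprS; exact: suppM].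
split=> [s u su|s u s' u' su su' ss uu].
  rewrite /entry; have := @evolution_entry _ _ H t (enum_rank s) (enum_rank u)
    (enum_rank s) (enum_rank u) 0 hH.
  rewrite mul0r => -> // k; rewrite mul0r; exact: (sk k).1.
rewrite /entry -[RHS]mul1r; apply: evolution_entry => // k.
by rewrite mul1r; exact: (sk k).2.
Qed.

(** * Gaussian decay of the characteristic function of the energy *)

Section Neighbourhood.
Variables (T : finType) (e : rel T).
Implicit Types (X Y Z : {set T}) (r : nat).

Definition nbh X : {set T} := X :|: [set q | [exists p in X, e p q]].

Definition hood X r : {set T} := iter r nbh X.

Lemma hoodD X r r' : hood X (r + r') = hood (hood X r) r'.
Proof. by rewrite /hood addnC iterD. Qed.

Lemma nbhS X Y : X \subset Y -> nbh X \subset nbh Y.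
Proof.
move=> XY; apply: finset.setUSS => //; apply/fintype.subsetP => q; rewrite !inE.
by move=> /existsP[p /andP[pX pq]]; apply/existsP; exists p; rewrite (fintype.subsetP XY).
Qed.

Lemma hoodS X Y r : X \subset Y -> hood X r \subset hood Y r.
Proof. by move=> XY; elim: r => //= r; exact: nbhS. Qed.

Lemma sub_hood X r : X \subset hood X r.
Proof. by elim: r => //= r IH; rewrite (fintype.subset_trans IH)// finset.subsetUl. Qed.

Lemma hood_leq X r r' : (r <= r')%N -> hood X r \subset hood X r'.
Proof. by move=> /subnKC <-; rewrite hoodD sub_hood. Qed.

End Neighbourhood.

Opaque hood.

(** The left side is the derivative of U W U1 when U' = - z U H, U1' = z H1 U1 and W' = z (H W - W
    H1) - c V; everything but the defect V cancels. *)
Lemma duhamel_cancel (R : realType) n (U H W V U1 H1 : 'M[R[i]]_n) (z c : R[i]) :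
  (- z *: (U *m H)) *m (W *m U1) +
  U *m ((z *: (H *m W - W *m H1) - c *: V) *m U1 + W *m (z *: (H1 *m U1))) =
  - (c *: (U *m (V *m U1))).
Proof.
have -> : (- z *: (U *m H)) *m (W *m U1) = - (z *: (U *m H *m W *m U1)).
  by rewrite -scalemxAl scaleNr !mulmxA.
have -> : U *m ((z *: (H *m W - W *m H1) - c *: V) *m U1 + W *m (z *: (H1 *m U1))) =
    z *: (U *m H *m W *m U1) - z *: (U *m W *m H1 *m U1) - c *: (U *m (V *m U1)) +
    z *: (U *m W *m H1 *m U1).
  rewrite mulmxDr mulmxBl mulmxBr -!scalemxAl mulmxBl scalerBr mulmxBr -!scalemxAr.
  by rewrite !mulmxA.
by rewrite addrAC subrK addKr.
Qed.

Lemma normcM_le (R : realType) (u v : R[i]) (x y : R) :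
  normc u <= x -> normc v <= y -> normc (u * v) <= x * y.
Proof. by move=> hu hv; rewrite Normc.normcM ler_pM ?normc_ge0. Qed.

Lemma normc_split3 (R : realType) (u v w : R[i]) (x y z : R) :
  normc (u - v - w) <= x -> normc v <= y -> normc w <= z -> normc u <= x + (y + z).
Proof.
move=> hu hv hw; have -> : u = (u - v - w) + (v + w) by ring.
by rewrite (le_trans (normcD _ _))// lerD// (le_trans (normcD _ _))// lerD.
Qed.

(** First [q] is replaced by [A * g], then [g] by [f]. In the application [p], [q], [r] come from
    orders zero, one and higher of the Dyson series, [f] is f_S and [g] is f_Q for a smaller
    region. *)
Lemma normc_first_order (R : realType) (u p q r A f g : R[i]) (t x y z w w' a : R) :
  0 <= t -> normc (u - (p + (0 -i* t)%C * q + r)) <= x -> normc p <= y ->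
  normc r <= z -> normc (q - A * g) <= w -> normc (f - g) <= w' -> normc A <= a ->
  normc (u + (0 +i* t)%C * A * f) <= x + y + z + t * w + t * a * w'.
Proof.
move=> t0 hx hy hz hw hw' ha.
have nt : normc (0 -i* t)%C = t.
  by rewrite /= expr0n/= add0r sqrrN sqrtr_sqr ger0_norm.
have -> : u + (0 +i* t)%C * A * f = (u - (p + (0 -i* t)%C * q + r)) + p + r +
    (0 -i* t)%C * (q - A * g) + (0 -i* t)%C * A * (g - f).
  have -> : (0 +i* t)%C = - (0 -i* t)%C :> R[i] by apply/eqP; rewrite eq_complex /= oppr0 opprK
    !eqxx.
  ring.
have h5 : normc ((0 -i* t)%C * A * (g - f)) <= t * a * w'.
  apply: normcM_le; last by rewrite -normc_opp opprB.
  by apply: normcM_le => //; rewrite nt.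
have h4 : normc ((0 -i* t)%C * (q - A * g)) <= t * w.
  by rewrite Normc.normcM nt ler_wpM2l.
by do 4 (apply: le_trans (normcD _ _) _; apply: lerD; last by []).
Qed.

Lemma normc_le_split (R : realType) (u v w : R[i]) (x y : R) :
  normc (u - v - w) <= x -> normc w <= y -> normc (u - v) <= x + y.
Proof.
move=> hu hw; have -> : u - v = (u - v - w) + w by ring.
by rewrite (le_trans (normcD _ _))// lerD.
Qed.

Lemma first_order_arith (R : realType) (y eps1 eps M w : R) :
  0 <= y <= 4^-1 -> 0 <= eps1 <= eps -> 0 <= M -> 0 <= w ->
  eps1 * (1 + y) + 4 * (y ^+ 2 * (2 * M + 2 * eps + w)) <=
  8 * y ^+ 2 * M + 2 * eps + w.
Proof.
move=> /andP[y0 y1] /andP[e0 e1] M0 w0.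
have y2 : y ^+ 2 <= 16^-1 by rewrite expr2; nra.
have h1 : eps1 * (1 + y) <= eps * (5 / 4) by apply: ler_pM => //; lra.
have h2 : y ^+ 2 * eps <= 16^-1 * eps by rewrite ler_wpM2r// (le_trans e0).
have h3 : y ^+ 2 * w <= 16^-1 * w by rewrite ler_wpM2r.
move: (y ^+ 2) y2 h2 h3 => z; rewrite !mulrDr; lra.
Qed.

(** Since [2 * x] is at most 1/2, a pass halves the previous bound; [2 * M] and [2 * eps] are the
    fixed points of u -> M + u / 2 and u -> eps + u / 2. *)
Lemma chain_arith (R : realType) (a x M eps w : R) : 0 <= a -> 0 <= M -> 0 <= eps ->
  0 <= w -> 0 <= x <= 4^-1 ->
  a * eps + (a * M + a * (2 * x) * (2 * M + 2 * eps + w)) <=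
  a * (2 * M + 2 * eps + 2^-1 * w).
Proof.
move=> a0 M0 e0 w0 /andP[x0 x1].
have : (2 * x) * (2 * M + 2 * eps + w) <= 2^-1 * (2 * M + 2 * eps + w).
  by rewrite ler_wpM2r ?addr_ge0 ?mulr_ge0//; lra.
move=> /(ler_wpM2l a0); rewrite -mulrA; lra.
Qed.

Lemma normc_telescope (R : realType) (u v w p : R[i]) (x y : R) :
  normc (u - (v + w)) <= x -> normc (v - p) <= y -> normc (u - p - w) <= x + y.
Proof.
move=> hx hy; have -> : u - p - w = (u - (v + w)) + (v - p) by ring.
by rewrite (le_trans (normcD _ _))// lerD.
Qed.

(** * A Gronwall inequality with Gaussian forcing *)

Section Gronwall.
Variable R : realType.

(** Serves both the integrating factor ([c = v / 2]) and the Gaussian of the conclusion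
    ([c = v / 4]). *)
Lemma is_derive_expR_sqr (c t : R) :
  is_derive t 1 (fun s : R => expR (c * s ^+ 2)) (expR (c * t ^+ 2) * (c * (2 * t))).
Proof.
have d2 : is_derive t 1 (fun s : R => c * s ^+ 2) (c * (2 * t)).
  have := @is_deriveZ _ _ _ (fun s : R => s ^+ 2) c t 1 _ (is_derive_pow 2 t).
  by [].
exact: (is_derive1_comp (is_derive_expR _) d2).
Qed.

(** The integrating factor is exp(v t^2 / 2), yet forcing and conclusion decay only like exp(- v t^2
    / 4). This loss is what allows iteration: the integral of v s exp(v s^2 / 4) is at most 2 exp(v
    t^2 / 4), whereas forcing at the full rate would leave a factor growing like v t^2. *)
Lemma gronwall (g g' : R -> R[i]) (v kappa A eta eps T0 : R) :
  0 < v -> 0 <= kappa -> 0 <= A -> 0 <= eta -> 0 <= eps -> g 0 = 1 ->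
  (forall s, cder g s (g' s)) ->
  (forall t, 0 <= t <= T0 -> normc (g' t + (t * v)%:C%C * g t) <=
     kappa * v * t * (A * expR (- (v / 4) * t ^+ 2) + eta) + eps) ->
  forall t, 0 <= t <= T0 ->
    normc (g t) <= (1 + 2 * kappa * A) * expR (- (v / 4) * t ^+ 2) + kappa * eta + eps * t.
Proof.
move=> v0 k0 A0 eta0 eps0 g0 dg hg t /andP[t0 tT].
pose E2 s := expR (v / 2 * s ^+ 2); pose E4 s := expR (v / 4 * s ^+ 2).
pose u s := (E2 s)%:C%C * g s.
have du s : cder u s ((E2 s)%:C%C * (g' s + (s * v)%:C%C * g s)).
  apply: cder_eq (cderM (cder_real (is_derive_expR_sqr (v / 2) s)) (dg s)) _.
  rewrite -/(E2 s) mulrDr addrC; congr (_ + _).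
  by rewrite rmorphM -!mulrA; congr (_ * _); congr (_%:C%C * _); field.
(* A majorant built so that the derivative of each summand dominates one forcing term times [E2].
   The derivative of [s * E2 s] exceeds [E2 s], so no Gaussian has to be integrated. *)
pose E s := (2 * kappa * A) * E4 s + (kappa * eta) * E2 s + eps * (s * E2 s).
have dE (s : R) : is_derive s 1 E ((2 * kappa * A) * (E4 s * (v / 4 * (2 * s))) +
    (kappa * eta) * (E2 s * (v / 2 * (2 * s))) +
    eps * (E2 s + s * (E2 s * (v / 2 * (2 * s))))).
  have d4 := is_derive_expR_sqr (v / 4) s; have d2 := is_derive_expR_sqr (v / 2) s.
  have -> : E = (2 * kappa * A) *: (fun s : R => expR (v / 4 * s ^+ 2)) +
      (kappa * eta) *: (fun s : R => expR (v / 2 * s ^+ 2)) +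
      eps *: (id * (fun s : R => expR (v / 2 * s ^+ 2))) by [].
  apply: is_derive_eq (is_deriveD (is_deriveD (is_deriveZ (2 * kappa * A) d4)
    (is_deriveZ (kappa * eta) d2)) (is_deriveZ eps (is_deriveM (is_derive_id s 1) d2))) _.
  rewrite /GRing.scale /= -/(E2 s) -/(E4 s); move: (E2 s) (E4 s) => p q; ring.
have E24 s : E2 s * expR (- (v / 4) * s ^+ 2) = E4 s.
  by rewrite /E2 /E4 -expRD; congr expR; field.
have hu : normc (u t - u 0) <= E t - E 0.
  apply: (normc_incr_le t0 du dE) => s /andP[s0 st].
  rewrite Normc.normcM normc_real (ger0_norm (expR_ge0 _)).
  have hs := hg s; rewrite s0 (le_trans st tT) in hs.
  apply: le_trans (ler_wpM2l (expR_ge0 _) (hs isT)) _.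
  rewrite -[expR _]/(E2 s) mulrDr.
  have -> : E2 s * (kappa * v * s * (A * expR (- (v / 4) * s ^+ 2) + eta)) =
      kappa * v * s * (A * (E2 s * expR (- (v / 4) * s ^+ 2)) + eta * E2 s) by ring.
  rewrite E24.
  have : 0 <= eps * (s * (E2 s * (v / 2 * (2 * s)))).
    by rewrite !mulr_ge0// ?expR_ge0// ltW.
  move: (E2 s) (E4 s) => p q; lra.
have u0 : u 0 = 1 by rewrite /u g0 mulr1 /E2 expr0n mulr0 expR0.
have E0 : 0 <= E 0.
  by rewrite /E mul0r mulr0 addr0 addr_ge0// !mulr_ge0// expR_ge0.
have hut : normc (u t) <= 1 + E t.
  rewrite -[u t](subrK (u 0)) (le_trans (normcD _ _))// u0 Normc.normc1 addrC lerD2l.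
  by rewrite -u0 (le_trans hu)// lerBlDr lerDl.
have E2p : 0 < E2 t by exact: expR_gt0.
rewrite -(ler_pM2l E2p); move: hut.
rewrite /u Normc.normcM normc_real (ger0_norm (ltW E2p)) => /le_trans; apply.
have E41 : 1 <= E4 t.
  by rewrite /E4 -expR0 ler_expR mulr_ge0 ?sqr_ge0// divr_ge0// ltW.
rewrite !mulrDr mulrCA E24 /E; lra.
Qed.

End Gronwall.

(** * Local expansion of the characteristic function and its bootstrap *)

Section ManyBody.
Variables (R : realType) (d : nat) (T : finType) (e : rel T).
Variables (k : T -> op R d T) (psi : state R d T) (h0 : R) (b : nat).
Local Notation C := R[i].
Local Notation hood := (hood e).
Local Opaque evolution.
Implicit Types (S X Y Z : {set T}) (A : op R d T) (a t : R).

Hypothesis kherm : forall x, (k x : 'M[C]__) \is hermsymmx.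
Hypothesis kbnd : forall x, bnd (k x) h0.
(** Finite range in both directions, since [e] is not assumed symmetric. *)
Hypothesis ksupp : forall x, exists Y, [/\ supp Y (k x), Y \subset hood [set x] b &
  forall Z, ~~ [disjoint Y & Z] -> x \in hood Z b].
Hypothesis psi1 : l2norm psi = 1.
Hypothesis k_mean0 : forall x, ev psi (k x) = 0.

(** [L] plays four parts, all of order log N: the distance over which correlations decay to [delta],
    the order at which the Dyson series is cut, the number of shells stripped, and the number of
    Gronwall rounds. *)
Variables (L : nat) (delta : R).
Hypothesis L_gt0 : (0 < L)%N.
Hypothesis delta_ge0 : 0 <= delta.
Hypothesis decay : forall X Y A A' a a',
  [disjoint Y & hood X L] -> supp X A -> supp Y A' -> bnd A a -> bnd A' a' ->
  normc (ev psi (A *m A') - ev psi A * ev psi A') <= a * a' * delta.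

Definition HS S : op R d T := \sum_(x in S) k x.
Definition US S t : op R d T := evolution (HS S) t.
Definition fS S t : C := ev psi (US S t).

Lemma HS_herm S : (HS S : 'M[C]__) \is hermsymmx.
Proof.
apply: hermsymmx_of_adj; rewrite /HS; elim/big_rec: _ => [|x A _ IH].
  by rewrite trmx0 map_mx0.
by rewrite raddfD map_mxD/= IH hermsymmxE.
Qed.

Lemma HS_bnd S : bnd (HS S) (h0 * #|S|%:R).
Proof.
have := bnd_sum (index_enum T) (fun x (_ : x \in S) => kbnd x).
by rewrite sumr_const mulr_natr.
Qed.

Lemma h0_ge0 (x : T) : 0 <= h0.
Proof. exact: (kbnd x).1. Qed.

Lemma HS_near S : supp (hood S b) (HS S).
Proof.
apply: supp_sum => x xS; have [Y [sY Yx _]] := ksupp x.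
by apply: suppS sY; apply: fintype.subset_trans Yx _; apply: hoodS; rewrite finset.sub1set.
Qed.

Lemma HS_far S Z : [disjoint S & hood Z b] -> supp (~: Z) (HS S).
Proof.
move=> SZ; apply: supp_sum => x xS; have [Y [sY _ YZ]] := ksupp x.
apply: suppS sY; rewrite -finset.disjoints_subset; apply: contraTT xS => /YZ xZ.
by rewrite (disjointFl SZ).
Qed.

Lemma HSU S Q : HS S = HS (S :&: Q) + HS (S :\: Q).
Proof.
rewrite /HS (bigID (mem Q))/=; congr (_ + _); apply: eq_bigl => x; rewrite !inE//.
by rewrite andbC.
Qed.

Lemma US_bnd S t : bnd (US S t) 1.
Proof. by apply: bnd_evolution; exact: HS_herm. Qed.

Lemma normc_fS_le1 S t : normc (fS S t) <= 1.
Proof. by apply: normc_ev_le => //; exact: US_bnd. Qed.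

(* Taylor coefficients at [s = 0] of [W s = US S s *m (US S1 s)^t*], read off
   from [W' = -i (HS S *m W - W *m HS S1)]. *)
Fixpoint dyson S S1 i : op R d T :=
  if i is j.+1 then (0 -i* (j.+1%:R)^-1)%C *: (HS S *m dyson S S1 j - dyson S S1 j *m HS S1)
  else 1%:M.
Arguments dyson : simpl never.

Lemma dysonS S S1 i : dyson S S1 i.+1 =
  (0 -i* (i.+1%:R)^-1)%C *: (HS S *m dyson S S1 i - dyson S S1 i *m HS S1).
Proof. by []. Qed.

(** Terms away from [Z] commute with [A] and are common to both Hamiltonians, so they cancel. This
    is why the coefficients stay local although [HS S] is extensive. *)
Lemma dyson_step S S1 Z A : S1 \subset S -> S :\: S1 \subset Z -> supp Z A ->
  let Q := hood Z b in
  HS S *m A - A *m HS S1 = HS (S :&: Q) *m A - A *m HS (S1 :&: Q).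
Proof.
move=> S1S SZ sA Q; rewrite (HSU S Q) (HSU S1 Q).
have -> : S1 :\: Q = S :\: Q.
  apply/finset.setP => x; rewrite !inE; case: (boolP (x \in Q)) => //= xQ.
  apply/idP/idP => [|xS]; first exact: (fintype.subsetP S1S).
  apply: contraNT xQ => xS1; apply: (fintype.subsetP (sub_hood e Z b)).
  by apply: (fintype.subsetP SZ); rewrite !inE xS1.
have c : HS (S :\: Q) *m A = A *m HS (S :\: Q).
  symmetry; apply: (@supp_comm _ _ _ Z (~: Z)) => //.
    by rewrite -finset.setI_eq0 finset.setICr.
  by apply: HS_far; rewrite finset.disjoints_subset; apply/fintype.subsetP => x; rewrite !inE
    => /andP[].
by rewrite mulmxDl mulmxDr c opprD addrACA subrr addr0.
Qed.

Lemma dyson_supp S S1 Z i : S1 \subset S -> S :\: S1 \subset Z ->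
  supp (hood Z (2 * b * i)) (dyson S S1 i).
Proof.
move=> S1S SZ; elim: i => [|i IH]; first exact: supp1.
rewrite dysonS.
have SZ' : S :\: S1 \subset hood Z (2 * b * i).
  by rewrite (fintype.subset_trans SZ) ?sub_hood.
apply: suppZ; rewrite (dyson_step S1S SZ' IH).
have -> : (2 * b * i.+1 = 2 * b * i + (b + b))%N by lia.
rewrite !hoodD; set Q := hood (hood Z (2 * b * i)) b.
have sV : supp (hood Q b) (dyson S S1 i).
  apply: suppS IH; exact: fintype.subset_trans (sub_hood _ _ b) (sub_hood _ _ b).
have sH X : supp (hood Q b) (HS (X :&: Q)).
  apply: suppS (HS_near _); apply: hoodS; exact: finset.subsetIr.
by apply: suppB; apply: suppM.
Qed.

(** Each order costs at most twice the norm of the terms near the current support; the factor 1 / (i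
    + 1) is bounded by 1, which leaves geometric growth. Order [n.+1] is included because its last
    commutator only involves terms within [2 * b * n + b] of [Z]. *)
Lemma dyson_bnd S S1 Z n vol i : S1 \subset S -> S :\: S1 \subset Z -> 0 <= h0 ->
  (#|hood Z (2 * b * n + b)| <= vol)%N -> (i <= n.+1)%N ->
  bnd (dyson S S1 i) ((2 * h0 * vol%:R) ^+ i).
Proof.
move=> S1S SZ h00 hvol; elim: i => [|i IH] ilen; first exact: bnd1.
rewrite dysonS.
have {}IH := IH (ltnW ilen).
have SZ' : S :\: S1 \subset hood Z (2 * b * i).
  by rewrite (fintype.subset_trans SZ) ?sub_hood.
rewrite (dyson_step S1S SZ' (dyson_supp i S1S SZ)).
rewrite -hoodD; set Q := hood Z _.
have cQ X : (#|X :&: Q| <= vol)%N.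
  apply: leq_trans hvol; apply: leq_trans (subset_leq_card (finset.subsetIr _ _)) _.
  by apply/subset_leq_card/hood_leq; rewrite leq_add2r leq_mul2l; apply/orP; right.
have bQ X : bnd (HS (X :&: Q)) (h0 * vol%:R).
  by apply: bnd_le (HS_bnd _); rewrite ler_wpM2l// ler_nat.
have := bndZ (0 -i* (i.+1%:R)^-1)%C (bndB (bndM (bQ S) IH) (bndM IH (bQ S1))).
apply: bnd_le; rewrite -[leRHS]mul1r; apply: ler_pM => //.
- exact: normc_ge0.
- by have := bnd_ge0 (bndB (bndM (bQ S) IH) (bndM IH (bQ S1))).
- rewrite /= expr0n /= add0r sqrrN sqrtr_sqr ger0_norm// invf_le1 ?ltr0Sn//.
  by rewrite ler1n.
- by rewrite exprS le_eqVlt; apply/orP; left; apply/eqP; ring.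
Qed.

Lemma mder_adj m n (A : R -> 'M[C]_(m, n)) t (A' : 'M[C]_(m, n)) :
  mder A t A' -> mder (fun s => (A s)^t*) t (A'^t*).
Proof.
move=> h i j; rewrite !mxE; have [h1 h2] := h j i; split.
  rewrite (_ : (fun s => _) = (fun s => complex.Re (A s j i))).
    by move: h1; case: (A' j i).
  by apply/funext => s; rewrite !mxE; case: (A s j i).
rewrite (_ : (fun s => _) = - (fun s => complex.Im (A s j i))).
  have -> : complex.Im (Num.conj (A' j i)) = - complex.Im (A' j i) by case: (A' j i).
  exact: is_deriveN.
by apply/funext => s; rewrite !mxE fctE; case: (A s j i).
Qed.

Lemma cder_ev n (phi : 'cV[C]_n) (A : R -> 'M[C]_n) t (A' : 'M[C]_n) :
  mder A t A' -> cder (fun s => ev phi (A s)) t (ev phi A').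
Proof. by move=> h; exact: (mderMr phi (mderMl (phi^t*) h)). Qed.

Definition dyson_sum S S1 n (s : R) : op R d T :=
  \sum_(0 <= i < n.+1) (s ^+ i)%:C%C *: dyson S S1 i.

(** With the full series in place of [dyson_sum] this would be constantly the identity, so its drift
    from the identity measures the truncation error. *)
Definition duhamel S S1 n (s : R) : op R d T :=
  (US S s)^t* *m (dyson_sum S S1 n s *m US S1 s).

(** The truncated series obeys the equation of the full one up to its first omitted term, left over
    by the shift of index. *)
Lemma mder_dyson_sum S S1 n s : mder (dyson_sum S S1 n) s
  ((0 -i* 1)%C *: (HS S *m dyson_sum S S1 n s - dyson_sum S S1 n s *m HS S1) -
   (n.+1%:R * s ^+ n)%:C%C *: dyson S S1 n.+1).
Proof.
have key j : (0 -i* 1)%C *: (HS S *m dyson S S1 j - dyson S S1 j *m HS S1) =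
    j.+1%:R *: dyson S S1 j.+1.
  rewrite dysonS scalerA; congr (_ *: _).
  have -> : (j.+1%:R : C) = (j.+1%:R : R)%:C%C by rewrite rmorph_nat.
  by apply/eqP; rewrite eq_complex /= mulr0 !mul0r subr0 addr0 mulrN mulfV ?pnatr_eq0// !eqxx.
have -> : (0 -i* 1)%C *: (HS S *m dyson_sum S S1 n s - dyson_sum S S1 n s *m HS S1) =
    \sum_(0 <= i < n.+1) (s ^+ i)%:C%C *: (i.+1%:R *: dyson S S1 i.+1).
  rewrite mulmx_sumr mulmx_suml -sumrB scaler_sumr; apply: eq_bigr => i _.
  by rewrite -scalemxAr -scalemxAl -scalerBr -key !scalerA mulrC.
apply: mder_eq (mder_sum _ (fun i => mder_pow i (dyson S S1 i) s)) _.
rewrite big_nat_recl// mul0r scale0r add0r big_nat_recr//=.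
have -> : (n.+1%:R * s ^+ n)%:C%C = (s ^+ n)%:C%C * n.+1%:R :> C.
  by rewrite rmorphM /= rmorph_nat mulrC.
rewrite [_ *: (n.+1%:R *: _)]scalerA addrK; apply: eq_bigr => i _.
by rewrite scalerA; congr (_ *: _); rewrite rmorphM /= rmorph_nat mulrC.
Qed.

Lemma mder_duhamel S S1 n s : mder (duhamel S S1 n) s
  (- ((n.+1%:R * s ^+ n)%:C%C *: ((US S s)^t* *m (dyson S S1 n.+1 *m US S1 s)))).
Proof.
have dU X : mder (US X) s ((0 -i* 1)%C *: (HS X *m US X s)).
  by apply: mder_evolution; exact: HS_herm.
have dU' := mder_adj (dU S).
apply: mder_eq (mderM dU' (mderM (mder_dyson_sum S S1 n s) (dU S1))) _.
set W := dyson_sum _ _ _ _; set V := dyson _ _ _; set c := (_ * _)%:C%C.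
have -> : ((0 -i* 1)%C *: (HS S *m US S s))^t* =
    (- (0 -i* 1)%C) *: ((US S s)^t* *m HS S).
  rewrite linearZ /= map_mxZ adjM (hermsymmxE (HS_herm S)); congr (_ *: _).
  by apply/eqP; rewrite eq_complex /= oppr0 !eqxx.
set U := (US S s)^t*; set U1 := US S1 s; set z := (0 -i* 1)%C.
exact: duhamel_cancel.
Qed.

(** Unitary factors cost nothing in norm, so the derivative of [duhamel] is at most (n + 1) s^n (2
    h0 vol)^(n + 1), which integrates to the stated power. *)
Lemma duhamel_bound S S1 Z n vol A a t : S1 \subset S -> S :\: S1 \subset Z ->
  0 <= h0 -> (#|hood Z (2 * b * n + b)| <= vol)%N -> 0 <= t -> bnd A a ->
  normc (ev psi (A *m US S t) - ev psi (A *m (dyson_sum S S1 n t *m US S1 t)))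
    <= a * (t * (2 * h0 * vol%:R)) ^+ n.+1.
Proof.
move=> S1S SZ h00 hvol t0 bA; set th := 2 * h0 * vol%:R.
have th0 : 0 <= th by rewrite !mulr_ge0.
have UU : US S t *m (US S t)^t* = 1%:M.
  by apply: mulmx1C; apply: evolution_unitary; exact: HS_herm.
have D0 : duhamel S S1 n 0 = 1%:M.
  rewrite /duhamel /dyson_sum /US !evolution0 ?HS_herm// big_nat_recl//= expr0 scale1r.
  rewrite big1 ?addr0; last by move=> i _; rewrite exprS mul0r scale0r.
  by rewrite trmx1 map_mx1 !mul1mx.
pose g s := ev psi (A *m US S t *m duhamel S S1 n s).
have gt : g t = ev psi (A *m (dyson_sum S S1 n t *m US S1 t)).
  by rewrite /g /duhamel -mulmxA [US S t *m (_ *m _)]mulmxA UU mul1mx.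
have g0 : g 0 = ev psi (A *m US S t) by rewrite /g D0 mulmx1.
rewrite -gt -g0 -normc_opp opprB.
have dg s := cder_ev psi (mderMl (A *m US S t) (mder_duhamel S S1 n s)).
pose f s := (a * th ^+ n.+1) * s ^+ n.+1.
have df (s : R) : is_derive s 1 f ((a * th ^+ n.+1) * (n.+1%:R * s ^+ n)).
  have := @is_deriveZ _ _ _ (fun s : R => s ^+ n.+1) (a * th ^+ n.+1) s 1 _ (is_derive_pow n.+1
    s).
  by [].
have -> : a * (t * th) ^+ n.+1 = f t - f 0.
  by rewrite /f [0 ^+ _]exprS mul0r mulr0 subr0 exprMn; ring.
apply: (normc_incr_le t0 dg df) => s /andP[s0 _].
rewrite mulmxN evN normc_opp -scalemxAr evZ Normc.normcM normc_real ger0_norm; last first.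
  by rewrite mulr_ge0 ?exprn_ge0.
rewrite [leRHS]mulrC ler_wpM2l ?mulr_ge0 ?exprn_ge0//.
have bV : bnd (dyson S S1 n.+1) (th ^+ n.+1) by apply: (dyson_bnd S1S SZ h00 hvol).
have bb := bndM (bndM bA (US_bnd S t)) (bndM (bnd_adj (US_bnd S s)) (bndM bV (US_bnd S1 s))).
have := normc_ev_le psi1 bb; by rewrite !mulr1 mul1r.
Qed.

Lemma dyson_tail_supp S S1 Z n m t : S1 \subset S -> S :\: S1 \subset Z ->
  supp (hood Z (2 * b * n)) (\sum_(m <= i < n.+1) (t ^+ i)%:C%C *: dyson S S1 i).
Proof.
move=> S1S SZ; rewrite big_nat_cond; apply: supp_sum => i /andP[/andP[_ ilen] _].
apply: suppZ; apply: suppS (dyson_supp i S1S SZ); apply: hood_leq.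
by rewrite leq_mul2l -ltnS ilen orbT.
Qed.

Lemma sum_geometric_le (x : R) m n : 0 <= x <= 4^-1 ->
  \sum_(m <= i < n) x ^+ i <= 2 * x ^+ m.
Proof.
move=> /andP[x0 x1]; have [mn|nm] := leqP m n; last first.
  by rewrite big_geq ?mulr_ge0 ?exprn_ge0// ltnW.
(* The slack [2 * x ^+ n] closes the induction, since [x ^+ n + 2 * x ^+ n.+1 <= 2 * x ^+ n]. *)
suff : \sum_(m <= i < n) x ^+ i + 2 * x ^+ n <= 2 * x ^+ m.
  by apply: le_trans; rewrite lerDl mulr_ge0 ?exprn_ge0.
elim: n mn => [|n IH]; first by rewrite leqn0 => /eqP ->; rewrite big_geq// add0r.
rewrite leq_eqVlt => /predU1P[<-|mn]; first by rewrite big_geq// add0r.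
rewrite big_nat_recr//=; apply: le_trans (IH mn); rewrite -addrA lerD2l exprS.
have := exprn_ge0 n x0; nra.
Qed.

Lemma dyson_tail_bnd S S1 Z n vol m t : S1 \subset S -> S :\: S1 \subset Z ->
  0 <= h0 -> (#|hood Z (2 * b * n + b)| <= vol)%N -> 0 <= t ->
  t * (2 * h0 * vol%:R) <= 4^-1 ->
  bnd (\sum_(m <= i < n.+1) (t ^+ i)%:C%C *: dyson S S1 i)
    (2 * (t * (2 * h0 * vol%:R)) ^+ m).
Proof.
move=> S1S SZ h00 hvol t0; set th := 2 * h0 * vol%:R => x1.
have th0 : 0 <= th by rewrite !mulr_ge0.
apply: bnd_le (sum_geometric_le m n.+1 _) _; first by rewrite mulr_ge0.
rewrite big_nat_cond [X in bnd _ X]big_nat_cond.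
apply: bnd_sum => i /andP[/andP[_ ilen] _].
have := bndZ (t ^+ i)%:C%C (dyson_bnd S1S SZ h00 hvol (ltnW ilen)).
by rewrite normc_real ger0_norm ?exprn_ge0// -exprMn.
Qed.

(** Terms labelled outside [hood X (L + b)] have range [b], so they and the evolution they generate
    act outside [hood X L]; decay of correlations then applies. *)
Lemma decouple X S A a t : supp X A -> bnd A a -> [disjoint S & hood X (L + b)] ->
  normc (ev psi (A *m US S t) - ev psi A * fS S t) <= a * delta.
Proof.
move=> sA bA SX; rewrite -[a]mulr1.
apply: (@decay X (~: hood X L)) => //; last exact: US_bnd.
  by rewrite disjoint_sym -finset.setI_eq0 finset.setICr.
apply: supp_evolution; first exact: HS_herm.
by apply: HS_far; rewrite -hoodD.
Qed.

(* Stripping the terms of [S] near the support of [A] leaves an expectation of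
   the same form, with an operator of larger support and smaller norm. *)
Lemma shell_step X S Z n vol A a t : (0 < n)%N ->
  supp X A -> bnd A a -> Z = hood X (L + b) ->
  0 <= h0 -> (#|hood Z (2 * b * n + b)| <= vol)%N -> 0 <= t ->
  t * (2 * h0 * vol%:R) <= 4^-1 ->
  exists A', [/\ supp (hood Z (2 * b * n)) A',
    bnd A' (a * (2 * (t * (2 * h0 * vol%:R)))) &
    normc (ev psi (A *m US S t) - ev psi A * fS (S :\: Z) t
           - ev psi (A' *m US (S :\: Z) t))
      <= a * ((t * (2 * h0 * vol%:R)) ^+ n.+1 + delta)].
Proof.
move=> n0 sA bA ZE h00 hvol t0 x1; set th := 2 * h0 * vol%:R in x1 *.
have S1S : S :\: Z \subset S by exact: finset.subsetDl.
have SZ : S :\: (S :\: Z) \subset Z.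
  by apply/fintype.subsetP => x; rewrite !inE; case: (x \in Z) => //=; rewrite andNb.
have XZ : X \subset hood Z (2 * b * n).
  rewrite ZE; exact: fintype.subset_trans (sub_hood _ _ _) (sub_hood _ _ _).
pose W' := \sum_(1 <= i < n.+1) (t ^+ i)%:C%C *: dyson S (S :\: Z) i.
exists (A *m W'); split.
- by apply: suppM; [exact: suppS sA | exact: dyson_tail_supp].
- by apply: bndM => //; have := dyson_tail_bnd 1 S1S SZ h00 hvol t0 x1; rewrite expr1.
have WE : dyson_sum S (S :\: Z) n t = 1%:M + W'.
  by rewrite /dyson_sum big_ltn// expr0 scale1r.
have := duhamel_bound S1S SZ h00 hvol t0 bA; rewrite -/th WE.
rewrite mulmxDl mul1mx mulmxDr mulmxA evD => h1.
have h2 : normc (ev psi (A *m US (S :\: Z) t) - ev psi A * fS (S :\: Z) t) <= a * delta.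
  apply: decouple sA bA _; rewrite -ZE finset.disjoints_subset.
  by apply/fintype.subsetP => x; rewrite !inE => /andP[].
by rewrite mulrDr; exact: normc_telescope h1 h2.
Qed.

(** [shell_step] is iterated [m] times. Each round leaves a product with |f_S'| <= M, an error
    [eps], and an expectation of the same kind with at most half the norm; the last one is bounded
    trivially, whence [2^-1 ^+ m]. A round enlarges the support by [L + b] for the shell and
    [2 * b * n] for the Dyson coefficients. *)
Lemma local_expectation_bound n vol t m X S A a M : (0 < n)%N -> 0 <= h0 -> 0 <= t ->
  t * (2 * h0 * vol%:R) <= 4^-1 -> 0 <= M ->
  (#|hood X (m * (L + b + 2 * b * n) + b)| <= vol)%N ->
  supp X A -> bnd A a ->
  (forall S', S' \subset S -> S :\: S' \subset hood X (m * (L + b + 2 * b * n)) ->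
     normc (fS S' t) <= M) ->
  normc (ev psi (A *m US S t)) <=
    a * (2 * M + 2 * ((t * (2 * h0 * vol%:R)) ^+ n.+1 + delta) + 2^-1 ^+ m).
Proof.
move=> n0 h00 t0; set th := 2 * h0 * vol%:R => x1 M0; set G := (L + b + 2 * b * n)%N.
set eps := _ + delta.
have th0 : 0 <= t * th by rewrite !mulr_ge0.
have eps0 : 0 <= eps by rewrite addr_ge0// exprn_ge0.
elim: m X S A a => [|m IH] X S A a hvol sA bA hM; have a0 := bnd_ge0 bA.
  rewrite expr0 (le_trans (normc_ev_le psi1 (bndM bA (US_bnd S t))))// ler_wpM2l//.
  by rewrite lerDr addr_ge0 ?mulr_ge0.
set Z := hood X (L + b).
have GE : hood Z (2 * b * n) = hood X G by rewrite -hoodD.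
have hvolZ : (#|hood Z (2 * b * n + b)| <= vol)%N.
  rewrite -hoodD; apply: leq_trans hvol; apply/subset_leq_card/hood_leq.
  by rewrite addnA leq_add2r -/G mulSn leq_addr.
have [A' [sA' bA' hA']] := shell_step S n0 sA bA (erefl Z) h00 hvolZ t0 x1.
rewrite -/th -/eps in bA' hA'; rewrite GE in sA'.
have S1S : S :\: Z \subset S by exact: finset.subsetDl.
have ZG : Z \subset hood X (m.+1 * G).
  by apply: hood_leq; rewrite mulSn {1}/G -addnA leq_addr.
have hI : normc (ev psi (A' *m US (S :\: Z) t)) <=
    a * (2 * (t * th)) * (2 * M + 2 * eps + 2^-1 ^+ m).
  apply: (IH (hood X G)) => //; first by rewrite -hoodD addnA -mulSn.
  move=> S' S'S hS'; apply: hM; first exact: fintype.subset_trans S'S S1S.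
  apply/fintype.subsetP => x; rewrite inE => /andP[xS' xS].
  have [xZ|xZ] := boolP (x \in Z); first exact: (fintype.subsetP ZG).
  by rewrite mulSn hoodD; apply: (fintype.subsetP hS'); rewrite !inE xS' xZ.
have hf : normc (fS (S :\: Z) t) <= M.
  apply: hM => //; apply/fintype.subsetP => x; rewrite !inE.
  case: (boolP (x \in Z)) => [xZ _|_]; last by rewrite andNb.
  exact: (fintype.subsetP ZG).
have hA1 : normc (ev psi A * fS (S :\: Z) t) <= a * M.
  exact: normcM_le (normc_ev_le psi1 bA) hf.
apply: le_trans (normc_split3 hA' hA1 hI) _.
rewrite exprS; by apply: chain_arith; rewrite ?exprn_ge0 ?invr_ge0 ?x1 ?th0.
Qed.

Local Notation G := (L + b + 2 * b * L)%N.

(** Order zero factorizes with <k_x> = 0, order one gives the main term, and the tail is bounded by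
    [local_expectation_bound]. Two volumes are kept apart: the tail is measured by [y], built on the
    volume of radius O(L), because N y^2 must stay small against sigma^2 t for t up to order
    L^(-2D); the larger [vol], of radius O(L^2), only has to make the series converge. *)
Lemma local_first_order x S Z t M vol1 vol (y eps : R) : 0 <= t -> 0 <= M ->
  y = t * (2 * h0 * vol1%:R) -> eps = (t * (2 * h0 * vol%:R)) ^+ L.+1 + delta ->
  Z = hood [set x] (b + (L + b)) ->
  (#|hood [set x] (2 * b + 2 * G)| <= vol1)%N ->
  (#|hood [set x] (2 * b + 2 * G + L * G)| <= vol)%N -> (vol1 <= vol)%N ->
  t * (2 * h0 * vol%:R) <= 4^-1 ->
  (forall S', S' \subset S -> S :\: S' \subset hood [set x] (b + 2 * G + L * G) ->
     normc (fS S' t) <= M) ->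
  normc (ev psi (k x *m US S t) + (0 +i* t)%C * ev psi (k x *m HS (S :&: Z)) * fS S t) <=
    h0 * (8 * y ^+ 2 * M + 2 * eps + 2^-1 ^+ L).
Proof.
move=> t0 M0 yE epsE ZdE hv1 hv v1v x1 hM.
have h00 := h0_ge0 x.
have th0 : 0 <= t * (2 * h0 * vol%:R) by rewrite !mulr_ge0.
have y0 : 0 <= y by rewrite yE !mulr_ge0.
have yle : y <= t * (2 * h0 * vol%:R) by rewrite yE !ler_wpM2l ?mulr_ge0// ler_nat.
have y1 : y <= 4^-1 by apply: le_trans x1.
pose eps1 := y ^+ L.+1 + delta.
have eps1le : eps1 <= eps by rewrite epsE lerD2r; apply: lerXn2r; rewrite ?nnegrE.
have eps10 : 0 <= eps1 by rewrite addr_ge0 ?exprn_ge0.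
pose m := 2 * M + 2 * eps + 2^-1 ^+ L.
have p0 : 0 <= 2^-1 ^+ L :> R by rewrite exprn_ge0// invr_ge0.
have eps0 := le_trans eps10 eps1le.
have m0 : 0 <= m by rewrite /m !addr_ge0 ?mulr_ge0.
pose X0 := hood [set x] b; pose X1 := hood [set x] (b + G).
(* Removing the larger ball [Z1] turns both [S] and [S1] into the same [S2], through which the
   first-order term and f_S are compared. *)
pose S1 := S :\: Z; pose Z1 := hood X1 (L + b); pose S2 := S :\: Z1.
have ZE : Z = hood X0 (L + b) by rewrite ZdE hoodD.
have Z1E : Z1 = hood [set x] (b + G + (L + b)) by rewrite /Z1 /X1 -hoodD.
have ZZ1 : Z \subset Z1 by rewrite ZdE Z1E; apply: hood_leq; clear; lia.
have S2E : S1 :\: Z1 = S2 by rewrite /S1 /S2 finset.setDDl (finset.setUidPr ZZ1).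
have S1S : S1 \subset S by exact: finset.subsetDl.
have SZ : S :\: S1 \subset Z.
  by apply/fintype.subsetP => z; rewrite !inE; case: (z \in Z) => //=; rewrite andNb.
have hvZ : (#|hood Z (2 * b * L + b)| <= vol1)%N.
  apply: leq_trans hv1; rewrite ZdE -hoodD; apply/subset_leq_card/hood_leq; clear; lia.
have hvZ1 : (#|hood Z1 (2 * b * L + b)| <= vol1)%N.
  apply: leq_trans hv1; rewrite Z1E -hoodD; apply/subset_leq_card/hood_leq; clear; lia.
have [Y [sY YX0 _]] := ksupp x; have sk : supp X0 (k x) := suppS YX0 sY.
have bk := kbnd x.
have EX1 : hood Z (2 * b * L) = X1 by rewrite ZdE -hoodD; congr hood; clear; lia.
have X01 : X0 \subset X1 by apply: hood_leq; clear; lia.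
have sk1 : supp X1 (k x) := suppS X01 sk.
pose W2 := \sum_(2 <= i < L.+1) (t ^+ i)%:C%C *: dyson S S1 i.
have dE : dyson_sum S S1 L t = 1%:M + (0 -i* t)%C *: HS (S :&: Z) + W2.
  rewrite /dyson_sum big_ltn// big_ltn ?ltnS// expr0 scale1r addrA; congr (_ + _ + _).
  rewrite expr1 dysonS mulmx1 mul1mx (HSU S Z) -/S1 addrK scalerA; congr (_ *: _).
  by apply/eqP; rewrite eq_complex /= invr1; apply/andP; split; apply/eqP; ring.
have h1 := duhamel_bound S1S SZ h00 hvZ t0 bk; rewrite dE -yE in h1.
have eE : ev psi (k x *m ((1%:M + (0 -i* t)%C *: HS (S :&: Z) + W2) *m US S1 t)) =
    ev psi (k x *m US S1 t) + (0 -i* t)%C * ev psi (k x *m HS (S :&: Z) *m US S1 t) +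
    ev psi (k x *m W2 *m US S1 t).
  rewrite mulmxDl mulmxDl mul1mx !mulmxDr !evD -scalemxAl -scalemxAr evZ.
  by rewrite !mulmxA.
rewrite eE in h1.
have h2 : normc (ev psi (k x *m US S1 t)) <= h0 * delta.
  have := decouple t sk bk; rewrite -ZE => /(_ S1); rewrite k_mean0 mul0r subr0; apply.
  by rewrite finset.disjoints_subset; apply/fintype.subsetP => z; rewrite !inE => /andP[].
have far X S3 A a : S3 \subset S -> S :\: S3 \subset Z1 -> supp X A -> bnd A a ->
    X \subset hood [set x] (b + 2 * G) -> normc (ev psi (A *m US S3 t)) <= a * m.
  move=> S3S hS3 sA bA XX; have sA' := suppS XX sA.
  rewrite /m epsE; apply: (local_expectation_bound L_gt0 h00 t0 x1 M0 _ sA' bA).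
    by apply: leq_trans hv; rewrite -hoodD; apply/subset_leq_card/hood_leq; clear; lia.
  rewrite -hoodD => S' S'S hS'; apply: hM; first exact: fintype.subset_trans S'S S3S.
  apply/fintype.subsetP => z; rewrite inE => /andP[zS' zS].
  have [zS3|zS3] := boolP (z \in S3).
    by apply: (fintype.subsetP hS'); rewrite inE zS' zS3.
  have zZ1 : z \in Z1 by apply: (fintype.subsetP hS3); rewrite inE zS3 zS.
  by move: zZ1; rewrite Z1E; apply: (fintype.subsetP (hood_leq _ _ _)); clear; lia.
have h3 : normc (ev psi (k x *m W2 *m US S1 t)) <= h0 * (2 * y ^+ 2) * m.
  apply: (far X1) => //.
  - exact: fintype.subset_trans SZ ZZ1.
  - by apply: suppM => //; rewrite -EX1; exact: dyson_tail_supp.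
  - by apply: bndM => //; rewrite yE in y1 *; exact: (dyson_tail_bnd _ S1S SZ h00 hvZ t0 y1).
  - by apply: hood_leq; clear; lia.
have bH : bnd (HS (S :&: Z)) (h0 * vol1%:R).
  apply: bnd_le (HS_bnd _); rewrite ler_wpM2l// ler_nat; apply: leq_trans hvZ.
  apply: leq_trans (subset_leq_card (finset.subsetIr _ _)) _.
  by apply/subset_leq_card/sub_hood.
pose A := k x *m HS (S :&: Z).
have bA : bnd A (h0 * (h0 * vol1%:R)) by exact: bndM.
have sA : supp X1 A.
  apply: suppM => //; apply: suppS (HS_near _); rewrite /X1.
  apply: fintype.subset_trans (hoodS _ _ (finset.subsetIr _ _)) _.
  by rewrite ZdE -hoodD; apply: hood_leq; move: L_gt0; clear; nia.
have EX2 : hood Z1 (2 * b * L) = hood [set x] (b + 2 * G).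
  by rewrite Z1E -hoodD; congr hood; clear; lia.
have sub12 S3 : S3 \subset S -> S :\: S2 \subset Z1.
  by move=> _; apply/fintype.subsetP => z; rewrite !inE; case: (z \in Z1) => //=; rewrite andNb.
(* Used with [B = A] on [S1] for the first-order term, and with [B = 1] on [S] to compare f_S with
   f_S2. *)
have step B S3 c : supp X1 B -> bnd B c -> S3 :\: Z1 = S2 ->
    normc (ev psi (B *m US S3 t) - ev psi B * fS S2 t) <= c * (eps1 + 2 * y * m).
  move=> sB bB S3E.
  have y1' := y1; rewrite yE in y1'.
  have [B' [sB' bB' hB']] := shell_step S3 L_gt0 sB bB (erefl Z1) h00 hvZ1 t0 y1'.
  rewrite S3E -yE -/eps1 in hB' bB'; rewrite EX2 in sB'.
  have hB2 : normc (ev psi (B' *m US S2 t)) <= c * (2 * y) * m.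
    by apply: far sB' bB' _ => //; [exact: finset.subsetDl | exact: sub12 S1S].
  rewrite mulrDr [c * (_ * m)]mulrA; move: hB' hB2; exact: normc_le_split.
have h4 := step A S1 _ sA bA S2E.
have h5 := step 1%:M S 1 (supp1 _ _ X1) (bnd1 _ _) (erefl S2).
rewrite mul1mx ev1// mul1r mul1r in h5.
have h6 := normc_ev_le psi1 bA.
apply: le_trans (normc_first_order t0 h1 h2 h3 h4 h5 h6) _.
have -> : t * (h0 * (h0 * vol1%:R) * (eps1 + 2 * y * m)) =
    h0 * (y / 2 * (eps1 + 2 * y * m)) by rewrite yE; field.
have -> : t * (h0 * (h0 * vol1%:R)) * (eps1 + 2 * y * m) =
    h0 * (y / 2 * (eps1 + 2 * y * m)) by rewrite yE; field.
apply: (@le_trans _ _ (h0 * (eps1 * (1 + y) + 4 * (y ^+ 2 * m)))).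
  by rewrite le_eqVlt; apply/orP; left; apply/eqP; rewrite /eps1; field.
rewrite ler_wpM2l//.
by apply: first_order_arith; rewrite ?y0 ?eps10.
Qed.

Local Notation Zx x := (hood [set x] (b + (L + b))).

(** Zero mean of [k x] removes the product of expectations. The far part of [Q] is treated as one
    operator of norm at most [h0 * #|T|]; this crude factor is affordable because [delta] will be
    O(N^-3). *)
Lemma pair_far x Q :
  normc (ev psi (k x *m HS Q) - ev psi (k x *m HS (Q :&: Zx x))) <=
    h0 * (h0 * #|T|%:R) * delta.
Proof.
rewrite {1}(HSU Q (Zx x)) mulmxDr evD [X in X - _]addrC addrK.
have [Y [sY YX _]] := ksupp x; have sk := suppS YX sY.
have bQ : bnd (HS (Q :\: Zx x)) (h0 * #|T|%:R).
  by apply: bnd_le (HS_bnd _); rewrite ler_wpM2l ?(h0_ge0 x)// ler_nat max_card.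
have := @decay _ (~: hood (hood [set x] b) L) _ _ _ _ _ sk _ (kbnd x) bQ.
rewrite k_mean0 mul0r subr0; apply.
  by rewrite disjoint_sym -finset.setI_eq0 finset.setICr.
apply: HS_far; rewrite -!hoodD addnA finset.disjoints_subset.
by apply/fintype.subsetP => z; rewrite !inE => /andP[].
Qed.

Lemma pair_bound x Q vol1 : (#|Zx x| <= vol1)%N ->
  normc (ev psi (k x *m HS Q)) <= h0 * (h0 * vol1%:R) + h0 * (h0 * #|T|%:R) * delta.
Proof.
move=> hv; have := pair_far x Q; set u := ev psi (k x *m HS Q); set w := ev _ _ => h.
have -> : u = w + (u - w) by rewrite addrC subrK.
rewrite (le_trans (normcD _ _))// lerD// (normc_ev_le psi1 (bndM (kbnd x) _))//.
apply: bnd_le (HS_bnd _); rewrite ler_wpM2l ?(h0_ge0 x)// ler_nat.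
exact: leq_trans (subset_leq_card (finset.subsetIr _ _)) hv.
Qed.

Lemma pair_boundr x Q vol1 : (#|Zx x| <= vol1)%N ->
  normc (ev psi (HS Q *m k x)) <= h0 * (h0 * vol1%:R) + h0 * (h0 * #|T|%:R) * delta.
Proof.
move=> hv; have -> : HS Q *m k x = (k x *m HS Q)^t*.
  by rewrite adjM (hermsymmxE (HS_herm Q)) (hermsymmxE (kherm x)).
by rewrite ev_adj normc_conj; exact: pair_bound.
Qed.

Lemma ev_HSl S A : ev psi (HS S *m A) = \sum_(x in S) ev psi (k x *m A).
Proof. by rewrite /HS mulmx_suml ev_sum. Qed.

Lemma ev_HSr S A : ev psi (A *m HS S) = \sum_(x in S) ev psi (A *m k x).
Proof. by rewrite /HS mulmx_sumr ev_sum. Qed.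

Lemma normc_sum_card S (F : T -> C) (c : R) :
  (forall x, x \in S -> normc (F x) <= c) -> normc (\sum_(x in S) F x) <= #|S|%:R * c.
Proof.
move=> h; apply: le_trans (normc_sum _ _ _) _; apply: le_trans (ler_sum _ h) _.
by rewrite sumr_const mulr_natl.
Qed.

Lemma local_energy S :
  normc (\sum_(x in S) ev psi (k x *m HS (S :&: Zx x)) - ev psi (HS S *m HS S)) <=
    #|S|%:R * (h0 * (h0 * #|T|%:R) * delta).
Proof.
rewrite ev_HSl -sumrB; apply: normc_sum_card => x _.
by rewrite -normc_opp opprB; exact: pair_far.
Qed.

(** Expanding the square of [HS S + HS (~: S)] leaves three sums over removed sites, and each
    removed term is correlated essentially only with its neighbourhood. The cost is thus
    proportional to the number of removed sites. *)
Lemma energy_removed S vol1 : (forall x, #|Zx x| <= vol1)%N ->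
  normc (ev psi (HS S *m HS S) - ev psi (HS [set: T] *m HS [set: T])) <=
    #|~: S|%:R * (3 * (h0 * (h0 * vol1%:R) + h0 * (h0 * #|T|%:R) * delta)).
Proof.
move=> hv; set c := _ + _ * delta.
have -> : HS [set: T] = HS S + HS (~: S).
  by rewrite (HSU [set: T] S) finset.setTI finset.setTD.
rewrite mulmxDl !mulmxDr !evD -normc_opp opprB.
have -> : ev psi (HS S *m HS S) + ev psi (HS S *m HS (~: S)) +
    (ev psi (HS (~: S) *m HS S) + ev psi (HS (~: S) *m HS (~: S))) -
    ev psi (HS S *m HS S) = ev psi (HS S *m HS (~: S)) +
    (ev psi (HS (~: S) *m HS S) + ev psi (HS (~: S) *m HS (~: S))).
  by rewrite addrAC; congr (_ + _); rewrite addrC addKr.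
rewrite mulrCA mulrDl mul1r -[X in _ <= X](_ : #|~: S|%:R * c +
  (#|~: S|%:R * c + #|~: S|%:R * c) = _); last by ring.
rewrite (le_trans (normcD _ _))// lerD//.
  by rewrite ev_HSr; apply: normc_sum_card => x _; exact: pair_boundr.
rewrite (le_trans (normcD _ _))// lerD// ev_HSl;
  by apply: normc_sum_card => x _; exact: pair_bound.
Qed.

Definition dfS S t : C := (0 -i* 1)%C * ev psi (HS S *m US S t).

Lemma cder_fS S t : cder (fS S) t (dfS S t).
Proof.
rewrite /dfS -evZ; apply: cder_ev.
by apply: mder_evolution; exact: HS_herm.
Qed.

Lemma first_order S t M vol1 vol (v y eps : R) : 0 <= t -> 0 <= M ->
  y = t * (2 * h0 * vol1%:R) -> eps = (t * (2 * h0 * vol%:R)) ^+ L.+1 + delta ->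
  ev psi (HS [set: T] *m HS [set: T]) = v%:C%C -> 0 <= h0 ->
  (forall x, #|hood [set x] (2 * b + 2 * G)| <= vol1)%N ->
  (forall x, #|hood [set x] (2 * b + 2 * G + L * G)| <= vol)%N -> (vol1 <= vol)%N ->
  t * (2 * h0 * vol%:R) <= 4^-1 ->
  (forall S' x, S' \subset S -> S :\: S' \subset hood [set x] (b + 2 * G + L * G) ->
     normc (fS S' t) <= M) -> normc (fS S t) <= M ->
  normc (dfS S t + (t * v)%:C%C * fS S t) <=
    #|T|%:R * (h0 * (8 * y ^+ 2 * M + 2 * eps + 2^-1 ^+ L)) +
    t * (3 * #|~: S|%:R * h0 ^+ 2 * vol1%:R * M + 4 * #|T|%:R ^+ 2 * h0 ^+ 2 * delta).
Proof.
move=> t0 M0 yE epsE vE h00 hv1 hv v1v x1 hM hMS.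
set B := h0 * (8 * _ * _ + _ + _).
pose loc := \sum_(x in S) ev psi (k x *m HS (S :&: Zx x)).
have h1 : normc (\sum_(x in S) (ev psi (k x *m US S t) +
    (0 +i* t)%C * ev psi (k x *m HS (S :&: Zx x)) * fS S t)) <= #|S|%:R * B.
  apply: normc_sum_card => x _.
  exact: (local_first_order t0 M0 yE epsE (erefl _) (hv1 x) (hv x) v1v x1 (hM^~ x)).
have hZ x : (#|Zx x| <= vol1)%N.
  apply: leq_trans (hv1 x); apply/subset_leq_card/hood_leq; clear; lia.
have h2 := local_energy S; have h3 := energy_removed S hZ.
rewrite -/loc in h2; rewrite vE in h3.
have cT X : (#|X|%:R <= #|T|%:R :> R) by rewrite ler_nat max_card.
set D := h0 * (h0 * #|T|%:R) * delta in h2 h3.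
have D0 : 0 <= D by rewrite !mulr_ge0.
set w := ev psi (HS S *m HS S) in h2 h3.
have -> : dfS S t + (t * v)%:C%C * fS S t =
    (0 -i* 1)%C * \sum_(x in S) (ev psi (k x *m US S t) +
      (0 +i* t)%C * ev psi (k x *m HS (S :&: Zx x)) * fS S t) +
    t%:C%C * ((v%:C%C - w) + (w - loc)) * fS S t.
  rewrite big_split /= -ev_HSl -mulr_suml -mulr_sumr -/loc mulrDr -/(dfS S t).
  rewrite addrA subrK rmorphM /= mulrBr mulrBl.
  have -> : (0 -i* 1)%C * ((0 +i* t)%C * loc * fS S t) = t%:C%C * loc * fS S t.
    rewrite !mulrA; congr (_ * _ * _); apply/eqP; rewrite eq_complex /=.
    by apply/andP; split; apply/eqP; ring.
  by rewrite -addrA; congr (_ + _); rewrite addrC subrK.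
rewrite (le_trans (normcD _ _))// lerD//.
  rewrite Normc.normcM; have -> : normc (0 -i* 1)%C = 1 :> R.
    by rewrite /= expr0n/= add0r sqrrN expr1n sqrtr1.
  rewrite mul1r (le_trans h1)// ler_wpM2r//.
  have eps0 : 0 <= eps by rewrite epsE addr_ge0 ?exprn_ge0// !mulr_ge0.
  have p0 : 0 <= 2^-1 ^+ L :> R by rewrite exprn_ge0// invr_ge0.
  by apply: mulr_ge0 => //; rewrite !addr_ge0 ?mulr_ge0 ?exprn_ge0// yE !mulr_ge0.
rewrite -mulrA Normc.normcM normc_real ger0_norm// ler_wpM2l//.
have h4 : normc (v%:C%C - w + (w - loc)) <= #|~: S|%:R * (3 * (h0 * (h0 * vol1%:R) + D)) +
  #|S|%:R * D.
  by rewrite (le_trans (normcD _ _))// lerD// -normc_opp opprB.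
have hf1 := normc_fS_le1 S t.
have h5 : normc (v%:C%C - w + (w - loc)) <=
    (3 * #|~: S|%:R * h0 ^+ 2 * vol1%:R) + 4 * #|T|%:R ^+ 2 * h0 ^+ 2 * delta.
  apply: le_trans h4 _; rewrite mulrDr mulrDr.
  have -> : 4 * #|T|%:R ^+ 2 * h0 ^+ 2 * delta = #|T|%:R * (3 * D) + #|T|%:R * D by rewrite /D;
    ring.
  rewrite -addrA lerD//; first by rewrite le_eqVlt; apply/orP; left; apply/eqP; ring.
  by rewrite lerD// ler_wpM2r// mulr_ge0.
rewrite Normc.normcM; move: h5; rewrite -(ler_pM2r (ltr0n _ 1)) !mulr1 => h5.
apply: le_trans (ler_wpM2r (normc_ge0 _) h5) _.
(* The variance shift keeps the factor |f_S| <= M, so that it enters [gronwall] as forcing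
   proportional to the bound; for the [delta] part |f_S| <= 1 suffices. *)
rewrite mulrDl; apply: lerD; first by rewrite ler_wpM2l// !mulr_ge0// ?sqr_ge0.
by rewrite ler_piMr// !mulr_ge0// ?sqr_ge0.
Qed.

(** The two hypotheses with [v / 32] add up to kappa = 1/16 in [gronwall]. The prefactor 8/7 is the
    fixed point of A -> 1 + 2 kappa A = 1 + A / 8, so it does not grow over the rounds, while the
    additive part is multiplied by 1/16 up to a new [eps0]. *)
Lemma fidelity_decay (vol1 vol : nat) (v T0 eps0 : R) : 0 < v -> 0 <= h0 ->
  ev psi (HS [set: T] *m HS [set: T]) = v%:C%C ->
  (forall x, #|hood [set x] (2 * b + 2 * G)| <= vol1)%N ->
  (forall x, #|hood [set x] (2 * b + 2 * G + L * G)| <= vol)%N -> (vol1 <= vol)%N ->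
  0 <= T0 <= 1 -> T0 * (2 * h0 * vol%:R) <= 4^-1 ->
  8 * #|T|%:R * h0 * (2 * h0 * vol1%:R) ^+ 2 * T0 <= v / 32 ->
  3 * (L * vol)%:R * h0 ^+ 2 * vol1%:R <= v / 32 ->
  eps0 = #|T|%:R * h0 * (2 * (4^-1 ^+ L.+1 + delta) + 2^-1 ^+ L) +
         4 * #|T|%:R ^+ 2 * h0 ^+ 2 * delta ->
  forall t, 0 <= t <= T0 ->
    normc (fS [set: T] t) <= 8 / 7 * expR (- (v / 4) * t ^+ 2) + (2^-1 ^+ L + 2 * eps0).
Proof.
move=> v0 h00 vE hv1 hv v1v /andP[T00 T01] hT0 hK1 hK2 eps0E.
have e00 : 0 <= eps0.
  rewrite eps0E; apply: addr_ge0; last by rewrite !mulr_ge0// ?sqr_ge0.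
  apply: mulr_ge0; first exact: mulr_ge0.
  rewrite !addr_ge0 ?mulr_ge0 ?addr_ge0 ?exprn_ge0 ?invr_ge0//.
pose M j t := 8 / 7 * expR (- (v / 4) * t ^+ 2) + (2^-1 ^+ j + 2 * eps0).
have M0 j t : 0 <= M j t.
  by rewrite /M !addr_ge0 ?mulr_ge0 ?exprn_ge0 ?invr_ge0 ?expR_ge0.
(* Regions may miss [(L - j) * vol] sites; at [j = 0] the bound is trivial because
   [2^-1 ^+ 0 = 1]. *)
suff H : forall j, (j <= L)%N -> forall S, (#|~: S| <= (L - j) * vol)%N ->
    forall t, 0 <= t <= T0 -> normc (fS S t) <= M j t.
  by apply: (H L) => //; rewrite finset.setCT cards0.
elim=> [|j IH] jL S hS t ht.
  rewrite (le_trans (normc_fS_le1 S t))// /M expr0 addrCA lerDl.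
  by rewrite addr_ge0 ?mulr_ge0 ?expR_ge0.
have {}IH := IH (ltnW jL).
have f0 : fS S 0 = 1 by rewrite /fS /US evolution0 ?HS_herm// ev1.
have hS' : (#|~: S| <= (L - j) * vol)%N.
  apply: leq_trans hS _; rewrite leq_mul2r leq_sub2l ?orbT//.
have hr X : S :\: X \subset S by exact: finset.subsetDl.
have vold : 0 <= 2 * h0 * vol%:R by rewrite !mulr_ge0.
have key s : 0 <= s <= T0 -> normc (dfS S s + (s * v)%:C%C * fS S s) <=
    16^-1 * v * s * (8 / 7 * expR (- (v / 4) * s ^+ 2) + (2^-1 ^+ j + 2 * eps0)) + eps0.
  move=> /andP[s0 sT].
  have sx1 : s * (2 * h0 * vol%:R) <= 4^-1 by apply: le_trans hT0; rewrite ler_wpM2r.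
  (* The ball removed here has at most [vol] sites, exactly the budget given up between [j] and
     [j.+1]. *)
  have hM S' x : S' \subset S -> S :\: S' \subset hood [set x] (b + 2 * G + L * G) ->
      normc (fS S' s) <= M j s.
    move=> S'S hSS'; apply: IH; last by rewrite s0.
    have -> : ~: S' = ~: S :|: (S :\: S').
      apply/finset.setP => z; rewrite !inE.
      by have := fintype.subsetP S'S z; case: (z \in S'); case: (z \in S) => //= /(_ isT).
    apply: leq_trans (leq_card_setU _ _) _.
    apply: (@leq_trans ((L - j.+1) * vol + vol)); last by rewrite -mulSnr subnSK.
    apply: leq_add => //; apply: leq_trans (hv x); apply: leq_trans (subset_leq_card hSS') _.
    by apply/subset_leq_card/hood_leq; rewrite leq_add2r leq_add2r mulSn leq_addr.
  have hMS : normc (fS S s) <= M j s by apply: IH => //; rewrite s0.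
  apply: le_trans (first_order s0 (M0 j s) (erefl _) (erefl _) vE h00 hv1 hv v1v sx1 hM hMS) _.
  rewrite -/(M j s); move: (M j s) (M0 j s) => m m0.
  have p4 : (s * (2 * h0 * vol%:R)) ^+ L.+1 <= 4^-1 ^+ L.+1.
    by apply: lerXn2r; rewrite ?nnegrE ?invr_ge0 ?mulr_ge0.
  have cS : #|~: S|%:R <= (L * vol)%:R :> R.
    by rewrite ler_nat (leq_trans hS)// leq_mul2r leq_subr orbT.
  have nh0 : 0 <= #|T|%:R * h0 by rewrite mulr_ge0.
  have s1 : s <= 1 by apply: le_trans T01.
  have h1 : #|T|%:R * (h0 * (8 * (s * (2 * h0 * vol1%:R)) ^+ 2 * m +
      2 * ((s * (2 * h0 * vol%:R)) ^+ L.+1 + delta) + 2^-1 ^+ L)) <=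
      v / 32 * (s * m) + #|T|%:R * h0 * (2 * (4^-1 ^+ L.+1 + delta) + 2^-1 ^+ L).
    rewrite mulrA -addrA mulrDr; apply: lerD; last by rewrite ler_wpM2l// lerD2r ler_wpM2l//
      lerD2r.
    have -> : #|T|%:R * h0 * (8 * (s * (2 * h0 * vol1%:R)) ^+ 2 * m) =
        8 * #|T|%:R * h0 * (2 * h0 * vol1%:R) ^+ 2 * s * (s * m) by ring.
    rewrite ler_wpM2r ?mulr_ge0// (le_trans _ hK1)// ler_wpM2l//.
    by rewrite mulr_ge0 ?sqr_ge0// -mulrA mulr_ge0.
  have h2 : s * (3 * #|~: S|%:R * h0 ^+ 2 * vol1%:R * m + 4 * #|T|%:R ^+ 2 * h0 ^+ 2 * delta) <=
      v / 32 * (s * m) + 4 * #|T|%:R ^+ 2 * h0 ^+ 2 * delta.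
    rewrite mulrDr; apply: lerD; last by rewrite ler_piMl// !mulr_ge0// ?sqr_ge0.
    rewrite mulrCA ler_wpM2r ?mulr_ge0// (le_trans _ hK2)//.
    by rewrite ler_wpM2r// ler_wpM2r ?sqr_ge0// ler_wpM2l.
  apply: le_trans (lerD h1 h2) _; rewrite eps0E le_eqVlt; apply/orP; left; apply/eqP.
  by field.
have := gronwall v0 _ _ _ e00 f0 (cder_fS S) key ht.
have p0 : 0 <= 2^-1 ^+ j :> R by rewrite exprn_ge0// invr_ge0.
move=> /(_ ltac:(rewrite invr_ge0//) ltac:(done) ltac:(rewrite addr_ge0// mulr_ge0//)).
move=> /le_trans; apply; rewrite /M (exprS 2^-1 j).
have et : eps0 * t <= eps0.
  by rewrite ler_piMr//; case/andP: ht => _ /le_trans; apply.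
have := expR_ge0 (- (v / 4) * t ^+ 2); move: (expR _) (2^-1 ^+ j) p0 => p w; lra.
Qed.

End ManyBody.

(** * Averages of positive definite functions *)

Section CosineKernel.
Variable R : realType.
Implicit Types (om t a h : R).

Lemma is_derive_sumr (I : Type) (r : seq I) (F : I -> R -> R) t (F' : I -> R) :
  (forall i, is_derive t 1 (F i) (F' i)) ->
  is_derive t 1 (fun s : R => \sum_(i <- r) F i s) (\sum_(i <- r) F' i).
Proof.
move=> h; elim: r => [|i r IH].
  rewrite big_nil; have -> : (fun s : R => \sum_(i <- [::]) F i s) = (fun=> 0).
    by apply/funext => s; rewrite big_nil.
  exact: is_derive_cst.
rewrite big_cons.
have -> : (fun s : R => \sum_(i <- (i :: r)) F i s) =
    F i + (fun s => \sum_(i <- r) F i s).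
  by apply/funext => s; rewrite big_cons fctE.
exact: is_deriveD.
Qed.

Definition cos_int om t : R := if om == 0 then t else sin (t * om) / om.

Definition cos_int2 om t : R :=
  if om == 0 then t ^+ 2 / 2 else (1 - cos (t * om)) / om ^+ 2.

Lemma is_derive_mulr om t : is_derive t 1 (fun s : R => s * om) om.
Proof.
have := is_deriveM (is_derive_id t 1) (is_derive_cst om t 1).
by move=> /is_derive_eq; apply; rewrite /GRing.scale /= mulr0 add0r mulr1.
Qed.

Lemma is_derive_cos_int om t : is_derive t 1 (cos_int om) (cos (t * om)).
Proof.
have [->|om0] := eqVneq om 0.
  have -> : cos_int 0 = id by apply/funext => s; rewrite /cos_int eqxx.
  by rewrite mulr0 cos0; exact: is_derive_id.
have -> : cos_int om = om^-1 \*: (sin \o (fun s => s * om)).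
  by apply/funext => s; rewrite /cos_int (negbTE om0) /= /GRing.scale /= mulrC.
have := is_deriveZ om^-1 (@is_derive1_comp _ _ (fun s => s * om) t _ _ (is_derive_sin (t * om))
  (is_derive_mulr om t)).
by move=> /is_derive_eq; apply; rewrite /GRing.scale /= mulrCA mulVf// mulr1.
Qed.

Lemma is_derive_cos_int2 om t : is_derive t 1 (cos_int2 om) (cos_int om t).
Proof.
have [->|om0] := eqVneq om 0.
  have -> : cos_int2 0 = 2^-1 \*: (fun s : R => s ^+ 2).
    by apply/funext => s; rewrite /cos_int2 eqxx /GRing.scale /= mulrC.
  have := is_deriveZ 2^-1 (is_derive_pow 2 t).
  by move=> /is_derive_eq; apply; rewrite /GRing.scale /= /cos_int eqxx expr1; field.
have -> : cos_int2 om = (om ^- 2) \*: (cst 1 - (cos \o (fun s => s * om))).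
  by apply/funext => s; rewrite /cos_int2 (negbTE om0) /= !fctE /GRing.scale /= mulrC.
have := is_deriveZ (om ^- 2) (is_deriveB (is_derive_cst (1 : R) t 1)
  (@is_derive1_comp _ _ (fun s => s * om) t _ _ (is_derive_cos (t * om)) (is_derive_mulr om t))).
move=> /is_derive_eq; apply; rewrite /GRing.scale /= /cos_int (negbTE om0); field.
exact: om0.
Qed.

(** The centre [a] enters only through [cos (a * om)], with a nonnegative cofactor: summed with
    nonnegative weights, the second difference is largest at [a = 0]. *)
Lemma cos_int2_second_difference om a h :
  cos_int2 om (a + h) + cos_int2 om (a - h) - 2 * cos_int2 om a =
  cos (a * om) * (2 * cos_int2 om h).
Proof.
rewrite /cos_int2; have [->|om0] := eqVneq om 0; first by rewrite mulr0 cos0; field.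
by rewrite [(a + h) * om]mulrDl [(a - h) * om]mulrBl cosD cosB; field.
Qed.

Lemma cos_int2_ge0 om h : 0 <= cos_int2 om h.
Proof.
rewrite /cos_int2; case: ifP => _; first by rewrite divr_ge0// sqr_ge0.
by rewrite divr_ge0 ?sqr_ge0// subr_ge0 cos_le1.
Qed.

End CosineKernel.

Section PositiveDefinite.
Variables (R : realType) (I : finType) (w om : I -> R).
Hypothesis w_ge0 : forall i, 0 <= w i.
Implicit Types (t a h : R).

Definition cos_sum t := \sum_i w i * cos (t * om i).
Definition cos_sum_int t := \sum_i w i * cos_int (om i) t.
Definition cos_sum_int2 t := \sum_i w i * cos_int2 (om i) t.

Hypothesis cos_sum_ge0 : forall t, 0 <= cos_sum t.

Lemma is_derive_cos_sum_int t : is_derive t 1 cos_sum_int (cos_sum t).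
Proof. by apply: is_derive_sumr => i; exact: (is_deriveZ (w i) (is_derive_cos_int (om i) t)). Qed.

Lemma is_derive_cos_sum_int2 t : is_derive t 1 cos_sum_int2 (cos_sum_int t).
Proof.
by apply: is_derive_sumr => i; exact: (is_deriveZ (w i) (is_derive_cos_int2 (om i) t)).
Qed.

Lemma cos_sum_int_le a b : a <= b -> cos_sum_int a <= cos_sum_int b.
Proof. by move=> ab; apply: (ler_of_derive ab is_derive_cos_sum_int). Qed.

Lemma cos_sum_int0 : cos_sum_int 0 = 0.
Proof.
rewrite /cos_sum_int big1// => i _; rewrite /cos_int; case: ifP => _.
  by rewrite mulr0.
by rewrite mul0r sin0 mul0r mulr0.
Qed.

Lemma cos_sum_int_ge0 t : 0 <= t -> 0 <= cos_sum_int t.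
Proof. by rewrite -{2}cos_sum_int0; exact: cos_sum_int_le. Qed.

Lemma cos_sum_int2_convex x y : cos_sum_int2 x + (y - x) * cos_sum_int x <= cos_sum_int2 y.
Proof.
have dl (s : R) : is_derive s 1 (fun s : R => s * cos_sum_int x) (cos_sum_int x) :=
  is_derive_mulr _ s.
have [xy|/ltW yx] := leP x y.
  have := @ler_of_derive _ (cos_sum_int2 - (fun s => s * cos_sum_int x)) _ x y xy
    (fun s => is_deriveB (is_derive_cos_sum_int2 s) (dl s)).
  rewrite !fctE => H; have {H} : cos_sum_int2 x - x * cos_sum_int x <= cos_sum_int2 y - y *
    cos_sum_int x.
    by apply: H => s /andP[xs _]; rewrite subr_ge0; exact: cos_sum_int_le.
  lra.
have := @ler_of_derive _ ((fun s => s * cos_sum_int x) - cos_sum_int2) _ y x yx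
  (fun s => is_deriveB (dl s) (is_derive_cos_sum_int2 s)).
rewrite !fctE => H; have {H} : y * cos_sum_int x - cos_sum_int2 y <= x * cos_sum_int x -
  cos_sum_int2 x.
  by apply: H => s /andP[_ sx]; rewrite subr_ge0; exact: cos_sum_int_le.
lra.
Qed.

(* The second difference of [cos_sum_int2] is a Fejer average of [cos_sum]: it is
   maximal at the origin by positive definiteness, and convexity bounds it from
   below by the integral of [cos_sum] over the middle half of the window. *)
Lemma cos_sum_int_window a h : 0 < h -> cos_sum_int (a + h / 2) - cos_sum_int (a - h / 2) <=
  4 * cos_sum_int h.
Proof.
move=> h0.
have up : cos_sum_int2 (a + h) + cos_sum_int2 (a - h) - 2 * cos_sum_int2 a <= 2 * cos_sum_int2 h.
  rewrite /cos_sum_int2 !mulr_sumr -big_split -sumrB /=; apply: ler_sum => i _.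
  have -> : w i * cos_int2 (om i) (a + h) + w i * cos_int2 (om i) (a - h) -
      2 * (w i * cos_int2 (om i) a) = w i * (cos (a * om i) * (2 * cos_int2 (om i) h)).
    by rewrite -cos_int2_second_difference; ring.
  rewrite [leRHS]mulrCA ler_wpM2l// ler_piMl ?cos_le1// mulr_ge0//; exact: cos_int2_ge0.
(* With G = [cos_sum_int2] and g = [cos_sum_int], the four tangents [c1] to [c4] bound the second
   difference below by (h/2) (g(a + h/2) - g(a - h/2)); [c5] gives G(h) <= h g(h), so it is at most
   2 h g(h). The quotient of the coefficients is 4. *)
have c1 := cos_sum_int2_convex (a + h / 2) (a + h).
have c2 := cos_sum_int2_convex (a - h / 2) (a - h).
have c3 := cos_sum_int2_convex a (a + h / 2).
have c4 := cos_sum_int2_convex a (a - h / 2).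
have c5 := cos_sum_int2_convex h 0.
have z : cos_sum_int2 0 = 0.
  rewrite /cos_sum_int2 big1// => i _; rewrite /cos_int2; case: ifP => _.
    by rewrite expr0n /= mul0r mulr0.
  by rewrite mul0r cos0 subrr mul0r mulr0.
have e1 : a + h - (a + h / 2) = h / 2 by field.
have e2 : a - h - (a - h / 2) = - (h / 2) by field.
have e3 : a + h / 2 - a = h / 2 by field.
have e4 : a - h / 2 - a = - (h / 2) by field.
rewrite e1 in c1; rewrite e2 in c2; rewrite e3 in c3; rewrite e4 in c4; rewrite z in c5.
have h20 : 0 < h / 2 by rewrite divr_gt0.
rewrite -(ler_pM2l h20); move: up c1 c2 c3 c4 c5.
move: (cos_sum_int2 _) (cos_sum_int2 (a + h)) (cos_sum_int2 (a - h)) (cos_sum_int2 (a + h / 2)).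
move: (cos_sum_int2 (a - h / 2)) (cos_sum_int2 a) (cos_sum_int (a + h / 2)) (cos_sum_int (a - h
  / 2)).
move: (cos_sum_int h) (cos_sum_int a) => *; lra.
Qed.

(** At most t/h + 1 <= 2t/h windows of length [h] cover [0, t], each contributing at most
    [4 * cos_sum_int h]. *)
Lemma cos_sum_int_long h t : 0 < h -> h <= t -> cos_sum_int t <= 8 * (t / h) * cos_sum_int h.
Proof.
move=> h0 ht.
have step n : cos_sum_int (n%:R * h) <= 4 * n%:R * cos_sum_int h.
  elim: n => [|n IH]; first by rewrite !mul0r mulr0 mul0r cos_sum_int0.
  have := cos_sum_int_window (n%:R * h + h / 2) h0.
  have -> : n%:R * h + h / 2 + h / 2 = n.+1%:R * h by rewrite -natr1; field.
  rewrite addrK => H; rewrite -natr1; move: H IH; rewrite -natr1.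
  move: (cos_sum_int _) (cos_sum_int (n%:R * h)) (cos_sum_int h) => *; lra.
have th0 : 0 <= t / h by rewrite divr_ge0 ?ltW// (lt_le_trans h0).
have [n tn nt] : exists2 n : nat, t <= n%:R * h & n%:R <= t / h + 1.
  exists (Num.truncn (t / h)).+1.
    by rewrite -ler_pdivrMr// ltW// truncnS_gt.
  by rewrite -natr1 lerD2r truncn_le.
apply: le_trans (cos_sum_int_le tn) _; apply: le_trans (step n) _.
apply: ler_wpM2r; first by rewrite cos_sum_int_ge0// ltW.
have : 1 <= t / h by rewrite ler_pdivlMr// mul1r.
move: nt; move: (t / h) => z; lra.
Qed.

Lemma integral_cos_sum t c : 0 < t ->
  (\int[lebesgue_measure]_(s in `[0%R, t]%classic) (cos_sum s * c)%:E = (cos_sum_int t * c)%:E)%E.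
Proof.
move=> t0.
have dF (s : R) : is_derive s 1 (fun s => cos_sum_int s * c) (cos_sum s * c).
  have := is_deriveZ c (is_derive_cos_sum_int s).
  have -> : c \*: cos_sum_int = (fun s => cos_sum_int s * c).
    by apply/funext => u; rewrite /= /GRing.scale /= mulrC.
  by move=> /is_derive_eq; apply; rewrite /GRing.scale /= mulrC.
have cont (F F' : R -> R) : (forall s : R, is_derive s 1 F (F' s)) -> continuous F.
  move=> d s; apply: differentiable_continuous; apply/derivable1_diffP.
  by case: (d s).
have dcos (s : R) : is_derive s 1 (fun s => cos_sum s * c)
    (c * \sum_i w i * (- sin (s * om i) * om i)).
  have -> : (fun s => cos_sum s * c) = c \*: cos_sum.
    by apply/funext => u; rewrite /= /GRing.scale /= mulrC.
  apply: is_deriveZ; apply: is_derive_sumr => i.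
  exact: (is_deriveZ (w i) (@is_derive1_comp _ _ (fun s => s * om i) s _ _ (is_derive_cos (s *
    om i)) (is_derive_mulr (om i) s))).
have cF := cont _ _ dF; have cf := cont _ _ dcos.
rewrite (@continuous_FTC2 _ _ (fun s => cos_sum_int s * c) 0 t t0).
- by rewrite cos_sum_int0 mul0r sube0.
- exact: continuous_subspaceT.
- split.
  + by move=> s _; case: (dF s).
  + by apply: cvg_at_right_filter; exact: cF.
  + by apply: cvg_at_left_filter; exact: cF.
- by move=> s _; rewrite derive1E; have := dF s => -[_ ->].
Qed.

(** The Gaussian is dominated by 1 / (1 + v s^2 / 2), whose primitive is an arctangent, below pi/2.
    The constant exceeds that of the Gaussian integral, for which the final 5/2 leaves room. *)
Lemma cos_sum_int_short (v A e h t : R) : 0 < v -> 0 <= A -> 0 <= t <= h ->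
  (forall s, 0 <= s <= h -> cos_sum s <= A * expR (- (v / 2) * s ^+ 2) + e) ->
  cos_sum_int t <= A * (pi / (Num.sqrt v * Num.sqrt 2)) + e * t.
Proof.
move=> v0 A0 /andP[t0 th] hG.
pose c := Num.sqrt v / Num.sqrt 2.
have s20 : 0 < Num.sqrt 2 :> R by rewrite sqrtr_gt0.
have sv0 : 0 < Num.sqrt v by rewrite sqrtr_gt0.
have c0 : 0 < c by rewrite divr_gt0.
have c2 : c ^+ 2 = v / 2 by rewrite /c expr_div_n !sqr_sqrtr// ltW.
have dE (s : R) : is_derive s 1 ((A / c) \*: (atan \o (fun s => s * c)) + e \*: id)
    (A * (1 + (s * c) ^+ 2)^-1 + e).
  have := is_deriveD (is_deriveZ (A / c) (@is_derive1_comp _ _ (fun s => s * c) s _ _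
    (is_derive1_atan (s * c)) (is_derive_mulr c s)))
    (is_deriveZ e (is_derive_id s 1)).
  move=> /is_derive_eq; apply; rewrite /GRing.scale /= mulr1; field.
  by apply/andP; split; rewrite gt_eqF// ltr_pwDl// sqr_ge0.
have := ler_of_derive t0 (fun s => is_deriveB (dE s) (is_derive_cos_sum_int s)).
rewrite !fctE /= /GRing.scale /= cos_sum_int0 !mul0r atan0 !mulr0 addr0 subrr => H.
have {H} : 0 <= A / c * atan (t * c) + e * t - cos_sum_int t.
  apply: H => s /andP[s0 st]; rewrite subr_ge0.
  apply: le_trans (hG s _) _; first by rewrite s0 (le_trans st).
  rewrite lerD2r ler_wpM2l// exprMn c2 mulNr expRN lef_pV2 ?posrE ?expR_gt0//.
    by rewrite mulrC expR_ge1Dx.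
  by rewrite ltr_pwDl// mulr_ge0 ?sqr_ge0// divr_ge0// ltW.
rewrite subr_ge0 => /le_trans; apply; rewrite lerD2r.
have -> : A * (pi / (Num.sqrt v * Num.sqrt 2)) = A / c * (pi / 2).
  rewrite /c; have : Num.sqrt 2 ^+ 2 = 2 :> R by rewrite sqr_sqrtr.
  move: s20 sv0; move: (Num.sqrt 2) (Num.sqrt v) => p q p0 q0 p2.
  rewrite -[X in pi / X]p2; field.
  by rewrite !gt_eqF.
by rewrite ler_wpM2l ?divr_ge0 ?(ltW c0)// ltW// atan_ltpi2.
Qed.

End PositiveDefinite.

(** * Geometry of the lattice *)

Lemma abszD_le (x y : int) m n :
  (`|x| <= m)%N -> (`|y| <= n)%N -> (`|(x + y)%R| <= m + n)%N.
Proof. lia. Qed.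

Lemma leq_expn m n k : (m <= n)%N -> (m ^ k <= n ^ k)%N.
Proof. by case: k => // k mn; rewrite leq_exp2r. Qed.

Section LatticeGeometry.
Variables (D : nat) (U : lattice_type D) (Lt : lattice U).
Local Notation site := (site Lt).
Local Notation hood := (hood (adj (L := Lt))).
Implicit Types (p q : site) (X Y : {set site}).

Lemma path_hood p w : path (adj (L := Lt)) p w -> last p w \in hood [set p] (size w).
Proof.
elim/last_ind: w => [|w q IH]; first by rewrite inE.
rewrite rcons_path last_rcons size_rcons => /andP[/IH hw wq].
rewrite -addn1 hoodD; apply/finset.setUP; right; rewrite inE.
by apply/existsP; exists (last p w); rewrite hw.
Qed.

(** A path of length at most [r] would put [q] in the ball. The condition [r < #|site|] reflects
    that [site_dist] is capped at that value. *)
Lemma site_dist_hood p q r : q \notin hood [set p] r -> (r < #|site|)%N ->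
  (r < site_dist p q)%N.
Proof.
move=> qr rN; rewrite ltnNge; apply: contra qr => le_r.
have hs : has (fun n => [exists w : n.-tuple site, path (adj (L := Lt)) p w && (last p w == q)])
    (iota 0 #|site|).
  by rewrite has_find size_iota; apply: leq_ltn_trans rN.
have := nth_find 0%N hs; rewrite -/(site_dist p q) nth_iota; last first.
  exact: leq_ltn_trans rN.
rewrite add0n => /existsP[w /andP[pw /eqP <-]].
have := path_hood pw; rewrite size_tuple.
by apply: (fintype.subsetP (hood_leq _ _ le_r)).
Qed.

Lemma region_dist_hood X Y r : [disjoint Y & hood X r] -> (r < #|site|)%N ->
  (r < region_dist X Y)%N.
Proof.
move=> XY rN; rewrite /region_dist.
elim/big_ind: _ => // [x y hx hy|p pX]; first by rewrite leq_min hx.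
elim/big_ind: _ => // [x y hx hy|q qY]; first by rewrite leq_min hx.
apply: site_dist_hood => //; have := disjointFr XY qY; apply: contraFN.
by apply: (fintype.subsetP (hoodS _ _ _)); rewrite finset.sub1set.
Qed.

(** A repetition-free path inside [X] has fewer than [n] steps. This turns the cluster size [b] into
    a range. *)
Lemma connected_region_hood X n p q : connected_region X -> (#|X| <= n)%N ->
  p \in X -> q \in X -> q \in hood [set p] n.
Proof.
move=> cX Xn pX qX; have /connectP[w0 pw0 ->] := cX p q pX qX.
case/shortenP: pw0 => w pw uw _.
have wX : {subset p :: w <= X}.
  move=> z; rewrite inE => /predU1P[->//|]; elim: w p pX pw {uw} => //= y w IH p pX.
  by move=> /andP[/and3P[_ yX _] yw]; rewrite inE => /predU1P[->//|]; exact: IH yw.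
have pw' : path (adj (L := Lt)) p w by apply: sub_path pw => y z /and3P[].
apply: (fintype.subsetP (hood_leq _ _ _)) (path_hood pw').
apply: leq_trans Xn; apply: ltnW.
have : (#|p :: w| <= #|X|)%N by apply: subset_leq_card; apply/fintype.subsetP.
by rewrite (card_uniqP uw).
Qed.

Definition bond_range : nat :=
  \max_(be <- bonds U) \max_(i < D) `|be.2 i|%N.

Lemma bond_range_ge (be : 'I_(nbasis U) * 'I_(nbasis U) * {ffun 'I_D -> int}) i :
  be \in bonds U -> (`|be.2 i| <= bond_range)%N.
Proof.
move=> hb; rewrite /bond_range; apply: leq_trans (leq_bigmax_seq _ hb isT).
by apply: (@leq_bigmax _ (fun i => `|be.2 i|%N)).
Qed.

(** Congruence modulo the side treats periodic and open directions at once, an exact displacement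
    being in particular a congruent one. *)
Lemma adj_displacement p q i : adj p q ->
  exists2 z : int, (`|z| <= bond_range)%N &
    ((q.1 i)%:Z = (p.1 i)%:Z + z %[mod (side Lt i)%:Z])%Z.
Proof.
have bd (u v : site) : bonded u v -> exists2 z : int, (`|z| <= bond_range)%N &
    ((v.1 i)%:Z = (u.1 i)%:Z + z %[mod (side Lt i)%:Z])%Z.
  move=> /hasP[be hb /and3P[_ _ /forallP/(_ i)]] h.
  exists (be.2 i); first exact: bond_range_ge.
  by move: h; case: ifP => _ /eqP // ->.
move=> /andP[_ /orP[/bd //|/bd [z hz e]]]; exists (- z); first by rewrite abszN.
apply/eqP; rewrite eqz_mod_dvd; move/eqP: e; rewrite eqz_mod_dvd.
have -> : ((q.1 i)%:Z - ((p.1 i)%:Z - z) = - ((p.1 i)%:Z - ((q.1 i)%:Z + z)))%R by lia.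
by rewrite !dvdzE abszN.
Qed.

Lemma hood_displacement p q r : q \in hood [set p] r -> forall i,
  exists2 z : int, (`|z| <= r * bond_range)%N &
    ((q.1 i)%:Z = (p.1 i)%:Z + z %[mod (side Lt i)%:Z])%Z.
Proof.
elim: r q => [|r IH] q.
  by rewrite inE => /eqP -> i; exists 0; rewrite ?addr0.
rewrite -addn1 hoodD => /finset.setUP[/IH h i|].
  by have [z hz e] := h i; exists z => //; apply: leq_trans hz _; rewrite leq_mul2r leq_addr orbT.
rewrite inE => /existsP[q' /andP[/IH h qq'] i].
have [z hz e] := h i; have [z' hz' e'] := adj_displacement i qq'.
exists (z + z'); first by rewrite mulnDl mul1n; exact: abszD_le.
by rewrite e' addrA -modzDml e modzDml.
Qed.

(** A site of the ball is fixed by its basis index and its displacement modulo the sides, taken from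
    a cube of side [2 * (r * bond_range) + 1]. This growth of degree [D] is where the dimension
    enters. *)
Lemma card_hood p r :
  (#|hood [set p] r| <= (nbasis U).+1 * (2 * bond_range).+1 ^ D * r.+1 ^ D)%N.
Proof.
set m := (2 * (r * bond_range)).+1.
(* Displacements are shifted by [r * bond_range] to become natural numbers. At sites of the ball the
   residue is an actual coordinate, so the default of [insubd] is not reached there. *)
pose g (u : {ffun 'I_D -> 'I_m} * 'I_(nbasis U)) : site :=
  ([ffun i => insubd (p.1 i)
     `|(((p.1 i)%:Z + (u.1 i)%:Z - (r * bond_range)%:Z) %% (side Lt i)%:Z)%Z|%N], u.2).
have sub : hood [set p] r \subset [set g u | u in [set: _]].
  apply/fintype.subsetP => q hq; apply/imsetP.
  have /choice[z hz] : forall i, exists z : 'I_m,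
      ((q.1 i)%:Z = (p.1 i)%:Z + (z%:Z - (r * bond_range)%:Z) %[mod (side Lt i)%:Z])%Z.
    move=> i; have [z hz e] := hood_displacement hq i.
    have hm : (`|(z + (r * bond_range)%:Z)%R|%N < m)%N.
      by rewrite /m ltnS mul2n -addnn; exact: abszD_le.
    exists (Ordinal hm); rewrite e /=; congr ((_ + _) %% _)%Z.
    by move: hz; clear; lia.
  exists ([ffun i => z i], q.2); first by rewrite inE.
  case: q hq hz => q1 q2 /= hq hz; congr (_, _); apply/ffunP => i; rewrite !ffunE.
  apply/val_inj; rewrite val_insubd.
  have e : `|(((p.1 i)%:Z + (z i)%:Z - (r * bond_range)%:Z) %% (side Lt i)%:Z)%Z|%N = q1 i.
    by rewrite -addrA -hz modz_small// ltz_nat ltn_ord.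
  by rewrite e ltn_ord.
apply: leq_trans (subset_leq_card sub) _; apply: leq_trans (leq_imset_card _ _) _.
rewrite cardsT card_prod card_ffun !card_ord mulnC -mulnA; apply: leq_mul => //.
by rewrite -expnMn; apply: leq_expn; rewrite /m; nia.
Qed.

End LatticeGeometry.

(** * Time average of |F|^2 from its decay at short times *)

Section TimeAverage.
Variables (R : realType) (n : nat) (p lam : 'I_n -> R).
Hypothesis p_ge0 : forall j, 0 <= p j.

Let w (a : 'I_n * 'I_n) : R := p a.1 * p a.2.
Let om (a : 'I_n * 'I_n) : R := lam a.1 - lam a.2.

(** Pairs of energies carry the nonnegative weights p_i p_j, so |F|^2 is both nonnegative and
    positive definite in time, as [cos_sum_int_window] requires. *)
Lemma sqr_normc_cis_sum t :
  normc (\sum_j (p j)%:C%C * cis (- (t * lam j))) ^+ 2 = cos_sum w om t.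
Proof.
rewrite normc_sqr !raddf_sum /=.
have -> : \sum_j complex.Re ((p j)%:C%C * cis (- (t * lam j))) =
    \sum_j p j * cos (t * lam j).
  by apply: eq_bigr => j _; rewrite ReM /= cosN; ring.
have -> : \sum_j complex.Im ((p j)%:C%C * cis (- (t * lam j))) =
    \sum_j - (p j * sin (t * lam j)).
  by apply: eq_bigr => j _; rewrite ImM /= sinN; ring.
rewrite sumrN sqrrN !expr2 !mulr_suml -big_split /= /cos_sum -(pair_bigA _ (fun i j => w (i, j)
  * cos (t * om (i, j)))) /=.
apply: eq_bigr => i _; rewrite !mulr_sumr -big_split /=; apply: eq_bigr => j _.
by rewrite /w /om /= mulrBr cosB; ring.
Qed.

Let cos_sum_w_ge0 t : 0 <= cos_sum w om t.
Proof. by rewrite -sqr_normc_cis_sum sqr_ge0. Qed.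

Lemma cos_sum_int_le_time t : \sum_j p j = 1 -> 0 <= t -> cos_sum_int w om t <= t.
Proof.
move=> p1 t0.
have := ler_of_derive t0 (fun s => is_deriveB (is_derive_id s (1 : R)) (is_derive_cos_sum_int w
  om s)).
rewrite !fctE cos_sum_int0 subr0 => H; rewrite -subr_ge0; apply: H => s _.
rewrite subr_ge0 -sqr_normc_cis_sum expr_le1 ?normc_ge0//.
apply: le_trans (normc_sum _ _ _) _; rewrite -p1; apply: ler_sum => j _.
by rewrite Normc.normcM normc_cis mulr1 normc_real ger0_norm.
Qed.

(** For t <= T0 the short-time bound applies directly. Beyond, [cos_sum_int_long] multiplies it by 8
    t / T0: the constants are 20 = 8 * 5/2 and 16 = 8 * 2. *)
Lemma time_average (v T0 eta t : R) : 0 < v -> 0 < T0 -> 0 <= eta -> 0 < t ->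
  (forall s, 0 <= s <= T0 -> normc (\sum_j (p j)%:C%C * cis (- (s * lam j))) <=
     8 / 7 * expR (- (v / 4) * s ^+ 2) + eta) ->
  cos_sum_int w om t / t <= 5 * pi / (2 * Num.sqrt v * t) +
    (20 * pi / (Num.sqrt v * T0) + 16 * eta ^+ 2).
Proof.
move=> v0 T00 eta0 t0 hF.
have sv0 : 0 < Num.sqrt v by rewrite sqrtr_gt0.
have pi0 : 0 < pi :> R by exact: pi_gt0.
have w0 a : 0 <= w a by rewrite mulr_ge0.
(* From (x + y)^2 <= 2 x^2 + 2 y^2, with 128/49 = 2 (8/7)^2. *)
have hG s : 0 <= s <= T0 -> cos_sum w om s <= 128 / 49 * expR (- (v / 2) * s ^+ 2) + 2 * eta ^+ 2.
  move=> /hF; rewrite -sqr_normc_cis_sum.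
  have -> : expR (- (v / 2) * s ^+ 2) = expR (- (v / 4) * s ^+ 2) ^+ 2.
    by rewrite [RHS]expr2 -expRD; congr expR; field.
  have := normc_ge0 (\sum_j (p j)%:C%C * cis (- (s * lam j))).
  move: (normc _) (expR _) (expR_ge0 (- (v / 4) * s ^+ 2)) => x y y0 x0 xy.
  apply: (@le_trans _ _ ((8 / 7 * y + eta) ^+ 2)).
    by rewrite lerXn2r ?nnegrE// (le_trans x0).
  rewrite -subr_ge0; have -> : 128 / 49 * y ^+ 2 + 2 * eta ^+ 2 - (8 / 7 * y + eta) ^+ 2 =
      (8 / 7 * y - eta) ^+ 2 by field.
  exact: sqr_ge0.
have short s : 0 <= s <= T0 -> cos_sum_int w om s <= 5 * pi / (2 * Num.sqrt v) + 2 * eta ^+ 2 * s.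
  move=> hs; apply: le_trans (cos_sum_int_short v0 _ hs hG) _; first by rewrite divr_ge0.
  rewrite lerD2r.
  (* A sufficient rational bound: (128/49) / (6/5) < 5/2. *)
  have s2 : 6 / 5 <= Num.sqrt 2 :> R.
    rewrite -(@ler_pXn2r _ 2)// ?nnegrE ?sqrtr_ge0 ?divr_ge0// sqr_sqrtr//.
    lra.
  have s20 : 0 < Num.sqrt 2 :> R by rewrite sqrtr_gt0.
  have -> : 128 / 49 * (pi / (Num.sqrt v * Num.sqrt 2)) =
      pi / Num.sqrt v * (128 / 49 / Num.sqrt 2).
    by field; rewrite !gt_eqF.
  have -> : 5 * pi / (2 * Num.sqrt v) = pi / Num.sqrt v * (5 / 2).
    by field; rewrite gt_eqF.
  by rewrite ler_wpM2l ?divr_ge0 ?(ltW pi0) ?(ltW sv0)// ler_pdivrMr//; lra.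
have [tT|/ltW Tt] := leP t T0.
  have := short t; rewrite (ltW t0) tT => /(_ isT) h.
  rewrite ler_pdivrMr//; apply: le_trans h _.
  have -> : (5 * pi / (2 * Num.sqrt v * t) + (20 * pi / (Num.sqrt v * T0) + 16 * eta ^+ 2)) * t =
      5 * pi / (2 * Num.sqrt v) + (20 * pi / (Num.sqrt v * T0) + 16 * eta ^+ 2) * t.
    by field; rewrite !gt_eqF.
  rewrite lerD2l ler_wpM2r ?(ltW t0)//.
  have : 0 <= 20 * pi / (Num.sqrt v * T0) by rewrite divr_ge0 ?mulr_ge0 ?ltW.
  by have := sqr_ge0 eta; lra.
have := cos_sum_int_long w0 cos_sum_w_ge0 T00 Tt.
have := short T0; rewrite lexx (ltW T00) => /(_ isT) hs hl.
rewrite ler_pdivrMr//; apply: le_trans hl _.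
have : 8 * (t / T0) * cos_sum_int w om T0 <=
    8 * (t / T0) * (5 * pi / (2 * Num.sqrt v) + 2 * eta ^+ 2 * T0).
  by rewrite ler_wpM2l// mulr_ge0 ?divr_ge0// ltW.
move=> /le_trans; apply.
have -> : (5 * pi / (2 * Num.sqrt v * t) + (20 * pi / (Num.sqrt v * T0) + 16 * eta ^+ 2)) * t =
    5 * pi / (2 * Num.sqrt v) + 8 * (t / T0) * (5 * pi / (2 * Num.sqrt v) + 2 * eta ^+ 2 * T0).
  by field; rewrite !gt_eqF.
by rewrite lerDr divr_ge0 ?mulr_ge0 ?ltW.
Qed.

End TimeAverage.

Section Asymptotics.
Variable R : realType.

Lemma sqr_expR_half (y : R) : expR (y / 2) ^+ 2 = expR y.
Proof. by rewrite expr2 -expRD; congr expR; field. Qed.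

Lemma expR_half_ln (N : nat) : (0 < N)%N -> expR (ln N%:R / 2) = Num.sqrt N%:R :> R.
Proof.
move=> N0; apply/eqP; rewrite -(@eqrXn2 _ 2)// ?expR_ge0 ?sqrtr_ge0//.
by rewrite sqr_expR_half sqr_sqrtr// lnK// posrE ltr0n.
Qed.

(* [x <= exp x] at [x = ln N / 2m]. *)
Lemma ln_pow_le_sqrt (N m : nat) : (0 < N)%N ->
  ln N%:R ^+ m <= (2 * m%:R) ^+ m * Num.sqrt N%:R :> R.
Proof.
move=> N0; case: m => [|m].
  rewrite !expr0 mul1r -[leLHS]sqrtr1 ler_wsqrtr// ler1n//.
have y0 : 0 <= ln N%:R :> R by rewrite ln_ge0// ler1n.
set y := ln N%:R in y0 *.
rewrite -(expR_half_ln N0) -/y.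
have -> : expR (y / 2) = expR (y / (2 * m.+1%:R)) ^+ m.+1.
  rewrite -expRM_natl; congr expR.
  have : m.+1%:R != 0 :> R by rewrite pnatr_eq0.
  by move: (m.+1%:R) => c c0; field.
rewrite -exprMn lerXn2r ?nnegrE// ?mulr_ge0 ?expR_ge0//.
rewrite mulrC -ler_pdivrMr ?mulr_gt0//.
by apply: le_trans (expR_ge1Dx _); rewrite lerDr.
Qed.

End Asymptotics.

(** * The time average of the fidelity *)

Section Covariance.
Variables (R : realType) (d : nat) (T : finType) (psi : state R d T).
Local Notation C := R[i].
Implicit Types (A B : op R d T) (X Y : {set T}).

Definition cov A B : C := ev psi (A *m B) - ev psi A * ev psi B.

Lemma covDl A B A' z : cov (A + z *: A') B = cov A B + z * cov A' B.
Proof. by rewrite /cov mulmxDl -scalemxAl !evD !evZ mulrDl opprD addrACA mulrBr mulrA. Qed.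

Lemma covDr A B B' z : cov A (B + z *: B') = cov A B + z * cov A B'.
Proof. by rewrite /cov mulmxDr -scalemxAr !evD !evZ mulrDr opprD addrACA mulrBr mulrCA. Qed.

Lemma adjZ n (A : 'M[C]_n) z : (z *: A)^t* = z^*%C *: A^t*.
Proof. by rewrite linearZ /= map_mxZ. Qed.

Lemma hermitian_split X A (a : R) : supp X A -> bnd A a -> exists A1 A2 : op R d T,
  [/\ A1^t* = A1, A2^t* = A2, supp X A1 /\ supp X A2, bnd A1 a /\ bnd A2 a &
      A = A1 + (0 +i* 1)%C *: A2].
Proof.
move=> sA bA; have sA' := supp_adj sA; have bA' := bnd_adj bA.
have half (z : C) B : normc z = 2^-1 -> bnd B (a + a) -> bnd (z *: B) a.
  by move=> hz /(bndZ z); apply: bnd_le; rewrite hz; lra.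
exists ((2^-1)%:C%C *: (A + A^t*)), ((0 -i* 2^-1)%C *: (A - A^t*)); split.
- by rewrite adjZ raddfD map_mxD /= trmxCK addrC oppr0.
- rewrite adjZ raddfB map_mxB /= trmxCK -opprB scalerN -scaleNr; congr (_ *: _).
  by apply/eqP; rewrite eq_complex /= oppr0 opprK !eqxx.
- by split; apply: suppZ; [exact: suppD | exact: suppB].
- split; apply: half; [|exact: bndD| |exact: bndB].
    by rewrite normc_real ger0_norm// invr_ge0.
  by rewrite /= expr0n/= add0r sqrrN sqrtr_sqr ger0_norm// invr_ge0.
- rewrite scalerA; have -> : (0 +i* 1)%C * (0 -i* 2^-1)%C = (2^-1)%:C%C :> C.
    by apply/eqP; rewrite eq_complex /=; apply/andP; split; apply/eqP; ring.
  rewrite -scalerDr addrACA subrr addr0 scalerDr -scalerDl.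
  have -> : (2^-1)%:C%C + (2^-1)%:C%C = 1 :> C; last by rewrite scale1r.
  by rewrite -rmorphD /=; congr (_%:C%C); field.
Qed.

(** Decay is assumed for self-adjoint observables, which evolution operators are not. Splitting both
    arguments into real and imaginary parts gives four covariances, hence the factor 4. *)
Lemma cov_of_hermitian X Y (c : R) :
  (forall A B a a', A^t* = A -> B^t* = B -> supp X A -> supp Y B -> bnd A a -> bnd B a' ->
     normc (cov A B) <= a * a' * c) ->
  forall A B a a', supp X A -> supp Y B -> bnd A a -> bnd B a' ->
    normc (cov A B) <= a * a' * (4 * c).
Proof.
move=> h A B a a' sA sB bA bB.
have [A1 [A2 [hA1 hA2 [sA1 sA2] [bA1 bA2] ->]]] := hermitian_split sA bA.
have [B1 [B2 [hB1 hB2 [sB1 sB2] [bB1 bB2] ->]]] := hermitian_split sB bB.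
have ni : normc (0 +i* 1)%C = 1 :> R by rewrite /= expr0n/= add0r expr1n sqrtr1.
rewrite covDl !covDr.
have h11 := h _ _ _ _ hA1 hB1 sA1 sB1 bA1 bB1.
have h12 := h _ _ _ _ hA1 hB2 sA1 sB2 bA1 bB2.
have h21 := h _ _ _ _ hA2 hB1 sA2 sB1 bA2 bB1.
have h22 := h _ _ _ _ hA2 hB2 sA2 sB2 bA2 bB2.
move: (cov A1 B1) (cov A1 B2) (cov A2 B1) (cov A2 B2) h11 h12 h21 h22 => x y z u hx hy hz hu.
have n1 (p : C) : normc ((0 +i* 1)%C * p) = normc p by rewrite Normc.normcM ni mul1r.
apply: le_trans (normcD _ _) _; rewrite n1.
have := normcD x ((0 +i* 1)%C * y); have := normcD z ((0 +i* 1)%C * u); rewrite !n1.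
lra.
Qed.

Lemma ev_hermitian A : A^t* = A -> ev psi A = (complex.Re (ev psi A))%:C%C.
Proof.
move=> hA; have := ev_adj psi A; rewrite hA; case: (ev psi A) => x y [] /eqP.
rewrite -subr_eq0 opprK -mulr2n mulrn_eq0 /= => /eqP ->; by [].
Qed.

End Covariance.

Section FidelityIntegral.
Variables (R : realType) (d : nat) (T : finType) (H : op R d T) (psi : state R d T).
Hypothesis H_herm : (H : 'M[R[i]]__) \is hermsymmx.
Hypothesis psi1 : l2norm psi = 1.

Lemma fidelity_integral_le1 t : 0 < t ->
  (\int[lebesgue_measure]_(s in `[0%R, t]%classic) (fidelity H psi s ^+ 2 / t)%:E <= 1%:E)%E.
Proof.
move=> t0; have [p [lam [p0 p1 pE]]] := ev_evolution H_herm psi1.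
have -> : (fun s => (fidelity H psi s ^+ 2 / t)%:E) =
    (fun s => (cos_sum (fun a : 'I__ * 'I__ => p a.1 * p a.2) (fun a => lam a.1 - lam a.2) s *
      t^-1)%:E).
  by apply/funext => s; rewrite /fidelity -[expect _ _]/(ev psi _) pE sqr_normc_cis_sum.
rewrite integral_cos_sum// lee_fin ler_pdivrMr// mul1r.
by apply: cos_sum_int_le_time => //; exact: ltW.
Qed.

Lemma fidelity_integral_bound (v T0 eta t : R) : 0 < v -> 0 < T0 -> 0 <= eta -> 0 < t ->
  (forall s, 0 <= s <= T0 -> fidelity H psi s <= 8 / 7 * expR (- (v / 4) * s ^+ 2) + eta) ->
  (\int[lebesgue_measure]_(s in `[0%R, t]%classic) (fidelity H psi s ^+ 2 / t)%:E <=
   (5 * pi / (2 * Num.sqrt v * t) + (20 * pi / (Num.sqrt v * T0) + 16 * eta ^+ 2))%:E)%E.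
Proof.
move=> v0 T00 eta0 t0 hF; have [p [lam [p0 p1 pE]]] := ev_evolution H_herm psi1.
have fE s : fidelity H psi s = normc (\sum_j (p j)%:C%C * cis (- (s * lam j))).
  by rewrite /fidelity -[expect _ _]/(ev psi _) pE.
have -> : (fun s => (fidelity H psi s ^+ 2 / t)%:E) =
    (fun s => (cos_sum (fun a : 'I__ * 'I__ => p a.1 * p a.2) (fun a => lam a.1 - lam a.2) s *
      t^-1)%:E).
  by apply/funext => s; rewrite fE sqr_normc_cis_sum.
rewrite integral_cos_sum// lee_fin; apply: time_average => // s hs.
by rewrite -fE; exact: hF.
Qed.

End FidelityIntegral.

Lemma decay_arith (R : realType) (c x y a a' p q : R) : 0 <= c -> 0 <= x -> 0 <= y ->
  x <= a -> y <= a' -> 0 <= p -> p <= q -> c * x * y * p <= a * a' * (c * q).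
Proof.
move=> c0 x0 y0 xa ya p0 pq; have -> : a * a' * (c * q) = c * a * a' * q by ring.
by rewrite !ler_pM ?mulr_ge0.
Qed.

(** The cube compensates the prefactor [n ^+ 2] of [delta] and leaves O(1/n). *)
Lemma eps_arith (R : realType) (n h C w q delta : R) : 1 <= n -> 0 <= h -> 0 <= C ->
  w <= n ^- 3 -> q <= n ^- 3 -> delta <= 4 * (C * n ^- 3) ->
  n * h * (2 * (q + delta) + w) + 4 * n ^+ 2 * h ^+ 2 * delta <=
  (h * (3 + 8 * C) + 16 * C * h ^+ 2) / n.
Proof.
move=> n1 h0 C0 wn qn dn; have n0 : 0 < n by rewrite (lt_le_trans _ n1).
have nh : 0 <= n * h by rewrite mulr_ge0// ltW.
have h1 : n * h * (2 * (q + delta) + w) <= n * h * (2 * (n ^- 3 + 4 * (C * n ^- 3)) + n ^- 3).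
  by rewrite ler_wpM2l//; lra.
have h2 : 4 * n ^+ 2 * h ^+ 2 * delta <= 4 * n ^+ 2 * h ^+ 2 * (4 * (C * n ^- 3)).
  apply: ler_wpM2l => //; exact: mulr_ge0 (mulr_ge0 (ler0n R 4) (sqr_ge0 _)) (sqr_ge0 _).
apply: le_trans (lerD h1 h2) _.
have -> : n * h * (2 * (n ^- 3 + 4 * (C * n ^- 3)) + n ^- 3) +
    4 * n ^+ 2 * h ^+ 2 * (4 * (C * n ^- 3)) =
    (h * (3 + 8 * C) / n + 16 * C * h ^+ 2) / n by field; rewrite gt_eqF.
rewrite ler_wpM2r ?invr_ge0 ?(ltW n0)// lerD2r ler_pdivrMr//.
by rewrite ler_peMr// mulr_ge0// addr_ge0// mulr_ge0.
Qed.

(** A sum in the denominator replaces the minimum of 1, 1/x and 1/y. *)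
Lemma inv_sum_spec (R : realType) (x y : R) : 0 <= x -> 0 <= y ->
  [/\ 0 < (1 + x + y)^-1, (1 + x + y)^-1 <= 1, (1 + x + y)^-1 * x <= 1 &
      (1 + x + y)^-1 * y <= 1].
Proof.
move=> x0 y0; have z0 : 0 < 1 + x + y by rewrite -addrA ltr_pwDl// addr_ge0.
split; first by rewrite invr_gt0.
- by rewrite invf_le1// -addrA lerDl addr_ge0.
- by rewrite mulrC ler_pdivrMr// mul1r; lra.
- by rewrite mulrC ler_pdivrMr// mul1r; lra.
Qed.

(** With G = L + b + 2bL and L >= 1, one plus the radius 2b + 2G is at most (8b + 3) L; for
    [large_volume], one plus 2b + 2G + LG is at most (11b + 4) L^2. *)
Definition small_volume (D : nat) (U : lattice_type D) (b : nat) : nat :=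
  (nbasis U).+1 * (2 * bond_range U).+1 ^ D * (8 * b + 3) ^ D.

Definition large_volume (D : nat) (U : lattice_type D) (b : nat) : nat :=
  (nbasis U).+1 * (2 * bond_range U).+1 ^ D * (11 * b + 4) ^ D.

(** * The bound for a single lattice system *)

Section SystemBound.
Variables (R : realType) (d D b : nat) (U : lattice_type D) (S : lattice_system R d U).
Variables (h C xi s : R).
Local Notation T := (site (lat S)).
Local Notation N := (nsites S).
Local Notation H := (hamiltonian S).
Local Notation e := (adj (L := lat S)).
Hypothesis N_gt0 : (0 < N)%N.
Hypothesis C_gt0 : 0 < C.
Hypothesis xi_gt0 : 0 < xi.
Hypothesis s_gt0 : 0 < s.
Hypothesis hlocal : local_hamiltonian S b h.
Hypothesis psi1 : l2norm (psi S) = 1.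
Hypothesis hdecay : decaying_correlations S C xi.
Hypothesis hstd : energy_std H (psi S) = s * Num.sqrt N%:R.

Local Notation h0 := (2 * h + 1).

Definition local_mean (x : T) : R := complex.Re (ev (psi S) (local_term x)).

Definition centred_term (x : T) : op R d T :=
  local_term x - (local_mean x)%:C%C *: 1%:M.

Local Notation mean := local_mean.
Local Notation k := centred_term.

Lemma h_ge0 : 0 <= h.
Proof.
move: N_gt0; rewrite /nsites => /card_gt0P[x _]; have [_ hx _] := hlocal x.
exact: le_trans (bnd_opnorm _).1 hx.
Qed.

Lemma local_adj (x : T) : (local_term x)^t* = local_term x.
Proof. by have [/hermsymmxE] := hlocal x. Qed.

Lemma local_bnd (x : T) : bnd (local_term x) h.
Proof. by have [_ hx _] := hlocal x; apply: bnd_le hx (bnd_opnorm _). Qed.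

Lemma centred_herm x : (k x : 'M[R[i]]__) \is hermsymmx.
Proof.
apply: hermsymmx_of_adj; rewrite /centred_term raddfB map_mxB /= local_adj; congr (_ - _).
by rewrite adjZ trmx1 map_mx1; congr (_ *: _); apply/eqP; rewrite eq_complex /= oppr0 !eqxx.
Qed.

Lemma centred_bnd x : bnd (k x) h0.
Proof.
have hm : `|mean x| <= h.
  by apply: le_trans (Re_le_normc _) _; apply: normc_ev_le => //; exact: local_bnd.
have := bndB (local_bnd x) (bndZ (mean x)%:C%C (bnd1 _ _)).
by apply: bnd_le; rewrite normc_real; lra.
Qed.

Lemma centred_supp x : exists Y : {set T}, [/\ supp Y (k x), Y \subset hood e [set x] b &
  forall Z : {set T}, ~~ [disjoint Y & Z] -> x \in hood e Z b].
Proof.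
have [_ _ [X [xX cX conX sX]]] := hlocal x; exists X; split.
- by apply: suppB; [exact/suppP | apply: suppZ; exact: supp1].
- by apply/fintype.subsetP => q qX; exact: connected_region_hood conX cX xX qX.
- move=> Z /pred0Pn[z /andP[zX zZ]].
  apply: (fintype.subsetP (hoodS e b _)) (connected_region_hood conX cX zX xX).
  by rewrite finset.sub1set.
Qed.

Lemma centred_mean0 x : ev (psi S) (k x) = 0.
Proof.
rewrite /centred_term evB evZ ev1// mulr1 [X in X - _](ev_hermitian (psi S) (local_adj x)).
by rewrite subrr.
Qed.

Lemma centred_decay (L : nat) : (L < N)%N -> forall (X Y : {set T}) A A' a a',
  [disjoint Y & hood e X L] -> supp X A -> supp Y A' -> bnd A a -> bnd A' a' ->
  normc (ev (psi S) (A *m A') - ev (psi S) A * ev (psi S) A') <=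
    a * a' * (4 * (C * expR (- (L%:R / xi)))).
Proof.
move=> LN X Y A A' a a' XY; apply: cov_of_hermitian => {A A' a a'} A B a a' hA hB sA sB bA bB.
have := hdecay (hermsymmx_of_adj hA) (hermsymmx_of_adj hB) ((suppP _ _).2 sA) ((suppP _ _).2 sB).
rewrite -[expect _ _]/(ev _ _) => /le_trans; apply.
apply: decay_arith; rewrite ?opnorm_le ?(bnd_opnorm _).1 ?expR_ge0 ?(ltW C_gt0)//.
rewrite ler_expR lerN2 ler_pM2r ?invr_gt0// ler_nat ltnW//.
exact: region_dist_hood.
Qed.

Lemma HS_centred : HS k [set: T] = H - (\sum_x mean x)%:C%C%:M.
Proof.
rewrite /HS /centred_term sumrB /hamiltonian; congr (_ - _).
  by apply: eq_bigl => x; rewrite inE.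
rewrite -scaler_suml scalemx1; congr (_%:M); rewrite rmorph_sum.
by apply: eq_bigl => x; rewrite inE.
Qed.

Lemma hamiltonian_adj : H^t* = H.
Proof.
rewrite /hamiltonian; elim/big_rec: _ => [|x A _ IH].
  by rewrite trmx0 map_mx0.
by rewrite raddfD map_mxD/= IH local_adj.
Qed.

Lemma fidelity_fS t : fidelity H (psi S) t = normc (fS k (psi S) [set: T] t).
Proof.
rewrite /fS /US HS_centred evolution_shift; last exact: (hermsymmx_of_adj hamiltonian_adj).
by rewrite evZ Normc.normcM normc_cis mul1r.
Qed.

Lemma centred_variance :
  ev (psi S) (HS k [set: T] *m HS k [set: T]) = (s ^+ 2 * N%:R)%:C%C.
Proof.
set K := HS k [set: T]; have hK : K^t* = K.
  by apply: hermsymmxE; apply: HS_herm; exact: centred_herm.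
have KE : ev (psi S) (K *m K) = (l2norm (K *m psi S) ^+ 2)%:C%C.
  by rewrite evE -mulmxA -[LHS]dot_adj hK dotvv.
rewrite KE; congr (_%:C%C).
have sqr : complex.Re (expect (psi S) (H *m H) - expect (psi S) H ^+ 2) =
    l2norm (K *m psi S) ^+ 2.
  have HE : H = K + (\sum_x mean x)%:C%C *: 1%:M by rewrite /K HS_centred scalemx1 subrK.
  have K0 : ev (psi S) K = 0.
    by rewrite /K /HS ev_sum big1// => x _; exact: centred_mean0.
  rewrite -![expect _ _]/(ev _ _) HE mulmxDl !mulmxDr -!scalemxAl -!scalemxAr !mulmx1 !mul1mx.
  rewrite !evD !evZ K0 ev1// KE.
  move: (l2norm _ ^+ 2) (\sum_x mean x)%:C%C => y c.
  by rewrite [X in complex.Re X](_ : _ = y%:C%C) //; ring.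
have := hstd; rewrite /energy_std sqr sqrtr_sqr ger0_norm ?l2norm_ge0// => ->.
by rewrite exprMn sqr_sqrtr.
Qed.

Lemma card_hood_small (L : nat) (x : T) : (0 < L)%N ->
  (#|hood e [set x] (2 * b + 2 * (L + b + 2 * b * L))| <= small_volume U b * L ^ D)%N.
Proof.
move=> L0; apply: leq_trans (card_hood _ _) _; rewrite /small_volume -[X in (_ <= X)%N]mulnA
  leq_mul2l.
by rewrite -expnMn leq_expn ?orbT//; clear -L0; nia.
Qed.

Lemma card_hood_large (L : nat) (x : T) : (0 < L)%N ->
  (#|hood e [set x] (2 * b + 2 * (L + b + 2 * b * L) + L * (L + b + 2 * b * L))| <=
   large_volume U b * L ^ (2 * D))%N.
Proof.
move=> L0; apply: leq_trans (card_hood _ _) _; rewrite /large_volume -[X in (_ <= X)%N]mulnA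
  leq_mul2l.
rewrite expnM -expnMn leq_expn ?orbT// expnS expn1.
have h1 : (L <= L * L)%N by rewrite leq_pmulr.
have h2 : (b <= b * (L * L))%N by rewrite leq_pmulr// muln_gt0 L0.
have h3 : (b * L <= b * (L * L))%N by rewrite leq_mul2l h1 orbT.
by clear -L0 h1 h2 h3; lia.
Qed.

Local Notation V1 := ((small_volume U b)%:R : R).
Local Notation V2 := ((large_volume U b)%:R : R).

(** For T0 = [time_const] / L^(2D), the three summands give T0 <= 1, the convergence condition 2 h0
    vol T0 <= 1/4, and the smallness of the second-order remainder. *)
Definition time_const : R :=
  (1 + 8 * h0 * V2 + h0 * (32 * h0 * V1 / s) ^+ 2)^-1.

(** The first summand bounds the variance shift caused by all removed sites, with 96 = 3 * 32; the
    second ensures [L < N], as the capped graph distance requires. *)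
Definition size_const : R := 96 * h0 ^+ 2 * V1 * V2 / s ^+ 2 + 1.

Definition error_const : R := h0 * (3 + 8 * C) + 16 * C * h0 ^+ 2.

Lemma h0_gt0 : 0 < h0.
Proof.
have hh := h_ge0.
have h2 := mulr_ge0 (ler0n R 2) hh.
exact: (ltr_wpDl h2 ltr01).
Qed.

Lemma time_const_spec : [/\ 0 < time_const, time_const <= 1,
  time_const * (8 * h0 * V2) <= 1 & time_const * (h0 * (32 * h0 * V1 / s) ^+ 2) <= 1].
Proof.
have h00 := ltW h0_gt0; apply: inv_sum_spec.
  exact: mulr_ge0 (mulr_ge0 (ler0n _ 8) h00) (ler0n _ _).
exact: mulr_ge0 h00 (sqr_ge0 _).
Qed.

Lemma system_bound (L : nat) (t : R) : (0 < L)%N -> 0 < t ->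
  size_const * L%:R ^+ (3 * D + 1) < N%:R ->
  expR (- (L%:R / xi)) <= N%:R ^- 3 -> 2^-1 ^+ L <= N%:R ^- 3 :> R ->
  (\int[lebesgue_measure]_(u in `[0%R, t]%classic) (fidelity H (psi S) u ^+ 2 / t)%:E <=
   (5 * pi / (2 * (s * Num.sqrt N%:R) * t) +
    (20 * pi / (s * Num.sqrt N%:R * (time_const / L%:R ^+ (2 * D))) +
     16 * ((1 + 2 * error_const) / N%:R) ^+ 2))%:E)%E.
Proof.
move=> L0 t0 hsize hxi h2L.
have h00 := h0_gt0; have [tau0 tau1 tau2 tau3] := time_const_spec.
have n1 : 1 <= N%:R :> R by rewrite ler1n.
have n0 : 0 < N%:R :> R by rewrite ltr0n.
have L1 : 1 <= L%:R :> R by rewrite ler1n.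
have Lp m : 1 <= L%:R ^+ m :> R by rewrite exprn_ege1.
have Lp0 m : 0 < L%:R ^+ m :> R by apply: lt_le_trans (Lp m).
have s2 : 0 < s ^+ 2 by rewrite exprn_gt0.
have v0 : 0 < s ^+ 2 * N%:R by rewrite mulr_gt0.
have sv : Num.sqrt (s ^+ 2 * N%:R) = s * Num.sqrt N%:R.
  by rewrite sqrtrM ?sqr_ge0// sqrtr_sqr ger0_norm// ltW.
pose T0 := time_const / L%:R ^+ (2 * D).
have T00 : 0 < T0 by rewrite divr_gt0.
have sizeQ : 96 * h0 ^+ 2 * V1 * V2 * L%:R ^+ (3 * D + 1) <= s ^+ 2 * N%:R.
  rewrite -ler_pdivrMl//; apply/ltW; apply: le_lt_trans hsize.
  rewrite [X in _ <= X]mulrDl mul1r.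
  have -> : (s ^+ 2)^-1 * (96 * h0 ^+ 2 * V1 * V2 * L%:R ^+ (3 * D + 1)) =
      96 * h0 ^+ 2 * V1 * V2 / s ^+ 2 * L%:R ^+ (3 * D + 1) by ring.
  by rewrite lerDl ltW.
have LN : (L < N)%N.
  rewrite -(ltr_nat R); apply: le_lt_trans hsize; rewrite /size_const mulrDl mul1r.
  apply: (@le_trans _ _ (L%:R ^+ (3 * D + 1))).
    by rewrite addn1 exprS ler_peMr ?Lp// ler0n.
  rewrite lerDr; apply: mulr_ge0 (ltW (Lp0 _)); apply: divr_ge0 (ltW s2).
  exact: mulr_ge0 (mulr_ge0 (mulr_ge0 (ler0n _ 96) (sqr_ge0 _)) (ler0n _ _)) (ler0n _ _).
pose delta := 4 * (C * expR (- (L%:R / xi))).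
have d0 : 0 <= delta by rewrite !mulr_ge0 ?expR_ge0// ltW.
pose eps0 := N%:R * h0 * (2 * (4^-1 ^+ L.+1 + delta) + 2^-1 ^+ L) +
  4 * N%:R ^+ 2 * h0 ^+ 2 * delta.
have e0 : eps0 <= error_const / N%:R.
  apply: eps_arith => //; rewrite ?(ltW h00) ?(ltW C_gt0)//.
    apply: le_trans h2L; apply: (@le_trans _ _ (2^-1 ^+ L.+1)).
      by rewrite lerXn2r ?nnegrE ?invr_ge0// lef_pV2 ?posrE// ler_nat.
    by rewrite exprS ler_piMl ?exprn_ge0 ?invr_ge0// invf_le1// ler1n.
  by rewrite ler_wpM2l// ler_wpM2l// ltW.
have p2 : 0 <= 2^-1 ^+ L :> R by rewrite exprn_ge0// invr_ge0.
have p4 : 0 <= 4^-1 ^+ L.+1 :> R by rewrite exprn_ge0// invr_ge0.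
have e00 : 0 <= eps0.
  apply: addr_ge0; last first.
    exact: mulr_ge0 (mulr_ge0 (mulr_ge0 (ler0n R 4) (sqr_ge0 _)) (sqr_ge0 _)) d0.
  apply: mulr_ge0 (mulr_ge0 (ltW n0) (ltW h00)) _.
  exact: addr_ge0 (mulr_ge0 (ler0n R 2) (addr_ge0 p4 d0)) p2.
pose eta := 2^-1 ^+ L + 2 * eps0.
have eta0 : 0 <= eta := addr_ge0 p2 (mulr_ge0 (ler0n R 2) e00).
have etaN : eta <= (1 + 2 * error_const) / N%:R.
  rewrite mulrDl mul1r -mulrA /eta lerD ?ler_wpM2l//; apply: le_trans h2L _.
  by rewrite lef_pV2 ?posrE ?exprn_gt0// exprS ler_peMr ?(ltW n0)// exprn_ege1.
have hF u : 0 <= u <= T0 ->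
    fidelity H (psi S) u <= 8 / 7 * expR (- (s ^+ 2 * N%:R / 4) * u ^+ 2) + eta.
  move=> hu; rewrite fidelity_fS.
  apply: (fidelity_decay (e := e) centred_herm centred_bnd
    centred_supp psi1 centred_mean0 L0 d0
    (centred_decay LN) v0 (ltW h00)
    centred_variance
    (fun x => card_hood_small x L0) (fun x => card_hood_large x L0) _ _ _ _ _ (erefl _) hu).
  - apply: leq_mul; first by rewrite leq_mul2l leq_expn ?orbT//; clear; lia.
    by rewrite leq_pexp2l//; clear; lia.
  - rewrite (ltW T00)/= ler_pdivrMr// mul1r; exact: le_trans tau1 (Lp _).
  - rewrite natrM natrX /T0; have -> : time_const / L%:R ^+ (2 * D) *
      (2 * h0 * (V2 * L%:R ^+ (2 * D))) = time_const * (8 * h0 * V2) / 4.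
      by field; rewrite gt_eqF.
    by rewrite ler_pdivrMr// mulVf.
  - rewrite natrM natrX /T0 [(2 * D)%N]mulnC exprM.
    have -> : 8 * #|T|%:R * h0 * (2 * h0 * (V1 * L%:R ^+ D)) ^+ 2 *
      (time_const / (L%:R ^+ D) ^+ 2) =
      s ^+ 2 * #|T|%:R / 32 * (time_const * (h0 * (32 * h0 * V1 / s) ^+ 2)).
      by field; rewrite !gt_eqF.
    by rewrite ler_piMr// divr_ge0// ltW.
  - rewrite ler_pdivlMr//; apply: le_trans sizeQ.
    move: (small_volume U b) (large_volume U b) => v1 v2; rewrite !natrM !natrX.
    rewrite (_ : (3 * D + 1 = 1 + 2 * D + D)%N); last by clear; lia.
    rewrite exprD (exprD _ 1 (2 * D)) expr1; move: (L%:R ^+ (2 * D)) (L%:R ^+ D) => x y.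
    by rewrite le_eqVlt; apply/orP; left; apply/eqP; ring.
have := fidelity_integral_bound (hermsymmx_of_adj hamiltonian_adj) psi1 v0 T00 eta0 t0 hF.
move=> /le_trans; apply; rewrite lee_fin sv -/T0 lerD2l lerD2l ler_wpM2l//.
by rewrite lerXn2r ?nnegrE// (le_trans eta0).
Qed.

End SystemBound.

(** * The length scale and the final constants *)

Section FinalConstants.
Variable R : realType.

Lemma ln2_gt0 : 0 < ln 2 :> R.
Proof. by rewrite ln_gt0// ltr1n. Qed.

Lemma expRN_pow3 (x : R) (N : nat) : (0 < N)%N -> 3 * ln N%:R <= x ->
  expR (- x) <= N%:R ^- 3.
Proof.
move=> N0 hx; have -> : N%:R ^- 3 = expR (- (3 * ln N%:R)) :> R.
  by rewrite expRN expRM_natl lnK// posrE ltr0n.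
by rewrite ler_expR lerN2.
Qed.

(** The two decay conditions ask for L >= 3 xi ln N and L >= (3 / ln 2) ln N; the sum serves both.
    Rounding up costs at most 1 <= ln N / ln 2, which turns 3 / ln 2 into 4 / ln 2. *)
Lemma range_constants (xi : R) (N : nat) : 0 < xi -> (2 <= N)%N ->
  exists2 L : nat, (0 < L)%N & [/\ L%:R <= (3 * xi + 4 / ln 2) * ln N%:R,
    expR (- (L%:R / xi)) <= N%:R ^- 3 & 2^-1 ^+ L <= N%:R ^- 3 :> R].
Proof.
move=> xi0 N2; have N0 : (0 < N)%N by apply: leq_trans N2.
have l2 := ln2_gt0; have hy : ln 2 <= ln N%:R :> R.
  by rewrite ler_ln ?posrE ?ltr0n// ler_nat.
set y := ln N%:R in hy *; have y0 : 0 < y by apply: lt_le_trans hy.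
pose x := (3 * xi + 3 / ln 2) * y.
have x0 : 0 <= x by rewrite mulr_ge0 ?(ltW y0)// addr_ge0 ?divr_ge0 ?mulr_ge0 ?ltW.
exists (Num.truncn x).+1 => //.
have xL : x <= (Num.truncn x).+1%:R by rewrite ltW// truncnS_gt.
have hL : (Num.truncn x).+1%:R <= x + 1 by rewrite -natr1 lerD2r truncn_le.
move: (Num.truncn x).+1 xL hL => L xL Lx; split.
- apply: le_trans Lx _.
  have -> : (3 * xi + 4 / ln 2) * y = x + y / ln 2 by rewrite /x; field; rewrite gt_eqF.
  by rewrite lerD2l ler_pdivlMr// mul1r.
- apply: expRN_pow3 => //; rewrite ler_pdivlMr//; apply: le_trans xL.
  have -> : x = 3 * y * xi + 3 / ln 2 * y by rewrite /x; ring.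
  by rewrite lerDl mulr_ge0 ?(ltW y0)// divr_ge0// ltW.
- have -> : 2^-1 ^+ L = expR (- (L%:R * ln 2)) :> R.
    by rewrite -mulrN expRM_natl expRN lnK// posrE.
  apply: expRN_pow3 => //; rewrite -ler_pdivrMr//; apply: le_trans xL.
  have -> : x = 3 * xi * y + 3 * y / ln 2 by rewrite /x; ring.
  by rewrite lerDr mulr_ge0 ?(ltW y0)// mulr_ge0// ltW.
Qed.

(** The first term has the right order because L = O(log N). The second is O(N^-2), and the factor
    (ln N / ln 2)^(2D) >= 1 gives it the common shape. *)
Lemma error_terms (N L D : nat) (s tau lam E : R) : (2 <= N)%N -> (0 < L)%N ->
  0 < s -> 0 < tau -> L%:R <= lam * ln N%:R ->
  20 * pi / (s * Num.sqrt N%:R * (tau / L%:R ^+ (2 * D))) + 16 * ((1 + 2 * E) / N%:R) ^+ 2 <=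
  (20 * pi * lam ^+ (2 * D) / (s * tau) + 16 * (1 + 2 * E) ^+ 2 / ln 2 ^+ (2 * D)) *
    (ln N%:R ^+ (2 * D) / Num.sqrt N%:R).
Proof.
move=> N2 L0 s0 tau0 hL; set y := ln N%:R in hL *; set r := Num.sqrt N%:R.
have N0 : 0 < N%:R :> R by rewrite ltr0n (leq_trans _ N2).
have r0 : 0 < r by rewrite sqrtr_gt0.
have r1 : 1 <= r by rewrite -sqrtr1 ler_wsqrtr// ler1n (leq_trans _ N2).
have rN : r ^+ 2 = N%:R by rewrite sqr_sqrtr// ltW.
have l2 := ln2_gt0; have hy : ln 2 <= y.
  by rewrite /y ler_ln ?posrE// ler_nat.
have Lp0 m : 0 < L%:R ^+ m :> R by rewrite exprn_gt0// ltr0n.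
have lp0 m : 0 < ln 2 ^+ m :> R by rewrite exprn_gt0.
rewrite [leRHS]mulrDl; apply: lerD.
  have -> : 20 * pi / (s * r * (tau / L%:R ^+ (2 * D))) =
      20 * pi / (s * tau) / r * L%:R ^+ (2 * D) by field; rewrite !gt_eqF.
  have -> : 20 * pi * lam ^+ (2 * D) / (s * tau) * (y ^+ (2 * D) / r) =
      20 * pi / (s * tau) / r * (lam * y) ^+ (2 * D).
    by rewrite exprMn; field; rewrite !gt_eqF.
  rewrite ler_wpM2l//.
    by rewrite !divr_ge0 ?mulr_ge0 ?pi_ge0 ?(ltW s0) ?(ltW tau0) ?(ltW r0).
  by rewrite lerXn2r ?nnegrE// (le_trans _ hL).
have -> : 16 * ((1 + 2 * E) / N%:R) ^+ 2 = 16 * (1 + 2 * E) ^+ 2 / r * (r ^- 3).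
  by rewrite -rN; field; rewrite gt_eqF.
have -> : 16 * (1 + 2 * E) ^+ 2 / ln 2 ^+ (2 * D) * (y ^+ (2 * D) / r) =
    16 * (1 + 2 * E) ^+ 2 / r * (y ^+ (2 * D) / ln 2 ^+ (2 * D)).
  by field; rewrite !gt_eqF.
apply: ler_wpM2l.
  exact: divr_ge0 (mulr_ge0 (ler0n R 16) (sqr_ge0 _)) (ltW r0).
apply: (@le_trans _ _ 1).
  by rewrite invf_le1 ?exprn_gt0// exprn_ege1.
by rewrite ler_pdivlMr// mul1r lerXn2r ?nnegrE ?(ltW l2) ?(le_trans (ltW l2)).
Qed.

(** If N is at most a multiple of log^m N, then sqrt N is bounded, by [ln_pow_le_sqrt] for the same
    power. So log^(2D) N / sqrt N is bounded below, and a multiple of it dominates the trivial value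
    1 of the average. *)
Lemma small_size_bound (N L D m : nat) (Q lam : R) : (2 <= N)%N -> 0 <= Q ->
  L%:R <= lam * ln N%:R -> N%:R <= Q * L%:R ^+ m ->
  1 <= Q * (lam * (2 * m%:R)) ^+ m / ln 2 ^+ (2 * D) *
    (ln N%:R ^+ (2 * D) / Num.sqrt N%:R).
Proof.
move=> N2 Q0 hL hN; have N0 : (0 < N)%N by apply: leq_trans N2.
have N0' : 0 < N%:R :> R by rewrite ltr0n.
have l2 := ln2_gt0; have hy : ln 2 <= ln N%:R :> R.
  by rewrite ler_ln ?posrE ?ltr0n// ler_nat.
have ly := ln_pow_le_sqrt R m N0.
set y := ln N%:R in hL hy ly *; set r := Num.sqrt N%:R in ly *.
have y0 : 0 < y by apply: lt_le_trans hy.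
have lam0 : 0 <= lam by rewrite -(pmulr_lge0 _ y0) (le_trans _ hL).
have r0 : 0 < r by rewrite sqrtr_gt0.
have rN : N%:R = r * r by rewrite -expr2 sqr_sqrtr// ltW.
have rB : r <= Q * (lam * (2 * m%:R)) ^+ m.
  rewrite -(ler_pM2r r0) -rN; apply: le_trans hN _; rewrite -mulrA ler_wpM2l//.
  apply: (@le_trans _ _ ((lam * y) ^+ m)); first by rewrite lerXn2r ?nnegrE// (le_trans _ hL).
  by rewrite !exprMn -mulrA ler_wpM2l ?exprn_ge0// -exprMn.
have -> : Q * (lam * (2 * m%:R)) ^+ m / ln 2 ^+ (2 * D) * (y ^+ (2 * D) / r) =
    (Q * (lam * (2 * m%:R)) ^+ m / r) * (y ^+ (2 * D) / ln 2 ^+ (2 * D)).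
  by move: (Q * _) => B; field; rewrite !gt_eqF// exprn_gt0.
rewrite mulr_ege1//; first by rewrite ler_pdivlMr// mul1r.
by rewrite ler_pdivlMr ?exprn_gt0// mul1r lerXn2r ?nnegrE ?(ltW l2) ?(ltW y0).
Qed.

End FinalConstants.

Theorem theorem4 (R : realType) (d D b : nat) (h : R) (U : lattice_type D)
    (sizes : set nat) (sys : nat -> lattice_system R d U) (C xi s : R)
    (d_gt0 : (0 < d)%N) (D_gt0 : (0 < D)%N)
    (C_gt0 : 0 < C) (xi_gt0 : 0 < xi) (s_gt0 : 0 < s)
    (sites : forall N, sizes N ->
       [/\ (2 <= N)%N, nsites (sys N) = N & connected_lattice (lat (sys N))])
    (local : forall N, sizes N -> local_hamiltonian (sys N) b h)
    (pure : forall N, sizes N -> l2norm (psi (sys N)) = 1)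
    (decay : forall N, sizes N -> decaying_correlations (sys N) C xi)
    (std : forall N, sizes N ->
       energy_std (hamiltonian (sys N)) (psi (sys N)) = s * Num.sqrt N%:R) :
  exists K' : R, 0 <= K' /\
    forall N (T : R), sizes N -> 0 < T ->
      (\int[lebesgue_measure]_(t in `[0%R, T]%classic)
         (fidelity (hamiltonian (sys N)) (psi (sys N)) t ^+ 2 / T)%:E
       <= (5 * pi / (2 * energy_std (hamiltonian (sys N)) (psi (sys N)) * T)
           + K' * (ln N%:R ^+ (2 * D) / Num.sqrt N%:R))%:E)%E.
Proof.
pose lam : R := 3 * xi + 4 / ln 2.
pose tau := time_const b U h s.
pose Q := size_const b U h s.
pose E := error_const h C.
pose m := (3 * D + 1)%N.
pose Ka := 20 * pi * lam ^+ (2 * D) / (s * tau) + 16 * (1 + 2 * E) ^+ 2 / ln 2 ^+ (2 * D).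
pose Kb := Q * (lam * (2 * m%:R)) ^+ m / ln 2 ^+ (2 * D).
(* [Ka] and [Kb] are nonnegative only if [h] is, which is unknown when [sizes] is empty. *)
exists (`|Ka| + `|Kb|); split; first by rewrite addr_ge0.
move=> N T hN T0; have [N2 nN _] := sites N hN.
have stdN : energy_std (hamiltonian (sys N)) (psi (sys N)) =
    s * Num.sqrt (nsites (sys N))%:R by rewrite nN; exact: std.
have N0 : (0 < nsites (sys N))%N by rewrite nN (leq_trans _ N2).
have [L L0 [hL hxi h2]] := range_constants xi_gt0 N2.
have g0 : 0 <= ln N%:R ^+ (2 * D) / Num.sqrt N%:R :> R.
  by rewrite divr_ge0 ?sqrtr_ge0// exprn_ge0// ln_ge0// ler1n (leq_trans _ N2).
rewrite [(_ + `|Kb|) * _]mulrDl (std N hN).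
(* For small N the average is at most 1, which [Kb] covers; for large N the expansion applies and
   yields [Ka]. *)
have [small|large] := leP N%:R (Q * L%:R ^+ m).
  have Q0 : 0 <= Q.
    apply: addr_ge0 ler01; apply: divr_ge0 (sqr_ge0 _).
    exact: mulr_ge0 (mulr_ge0 (mulr_ge0 (ler0n R 96) (sqr_ge0 _)) (ler0n _ _)) (ler0n _ _).
  have one := small_size_bound D N2 Q0 hL small.
  apply: le_trans (fidelity_integral_le1 (hermsymmx_of_adj (hamiltonian_adj (local N hN)))
    (pure N hN) T0) _.
  have hb := ler_wpM2r g0 (ler_norm Kb).
  rewrite lee_fin; apply: le_trans one (le_trans hb _).
  rewrite addrA lerDr; apply: addr_ge0; last exact: mulr_ge0.
  by rewrite divr_ge0 ?mulr_ge0 ?pi_ge0 ?sqrtr_ge0 ?(ltW s_gt0) ?(ltW T0).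
have large' : Q * L%:R ^+ m < (nsites (sys N))%:R by rewrite nN.
have hxi' : expR (- (L%:R / xi)) <= (nsites (sys N))%:R ^- 3 by rewrite nN.
have h2' : 2^-1 ^+ L <= (nsites (sys N))%:R ^- 3 :> R by rewrite nN.
have [tau0 _ _ _] := time_const_spec s N0 (local N hN).
have := system_bound N0 C_gt0 xi_gt0 s_gt0 (local N hN) (pure N hN) (decay N hN) stdN
  L0 T0 large' hxi' h2'.
rewrite nN => /le_trans; apply; rewrite lee_fin lerD2l.
apply: le_trans (error_terms D E N2 L0 s_gt0 tau0 hL) _.
have ha := ler_wpM2r g0 (ler_norm Ka).
by apply: le_trans ha _; rewrite lerDl mulr_ge0.
Qed.
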